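(* Let $U\subset\mathbb{R}^n$ be open and $m$ a positive Radon measure on $U$ with $\mathrm{supp}[m]=U$. Let $(\mathcal{E},D(\mathcal{E}))$ be a semi-Dirichlet form on $L^2(U;m)$ with $C_0^\infty(U)\subset D(\mathcal{E})$ satisfying: for every relatively compact open set $O\subset U$, whenever $f_n,f\in C_0^\infty(O)$ are such that $f_n$ and all its partial derivatives converge uniformly to $f$ and its corresponding partial derivatives, one has $\mathcal{E}(f,g)=\lim_{n}\mathcal{E}(f_n,g)$ and $\mathcal{E}(g,f)=\lim_n\mathcal{E}(g,f_n)$ for every $g\in C_0^\infty(U)$. Let $J$ and $K$ be the jumping and killing measures of $\mathcal{E}$ and let $\delta>0$ with $U^\delta\ne\emptyset$. Then there exist signed Radon measures $\{\nu_{ij}\}_{i,j=1}^n$ on $U$ such that for every compact $F\subset U$, $\nu_{ij}(F)=\nu_{ji}(F)$ and $\sum_{i,j}\xi_i\xi_j\nu_{ij}(F)\ge0$ for all $\xi\in\mathbb{R}^n$, and distributions (generalized functions) $\{\Psi^\delta_i\}_{i=1}^n$ on $U^\delta$, such that for all $u,v\in C_0^\infty(U^\delta)$, \begin{align*} \mathcal{E}(u,v)&=\frac12\sum_{i,j=1}^n\int_U\frac{\partial u}{\partial x_i}\frac{\partial v}{\partial x_j}\,\nu_{ij}(dx)+\sum_{i=1}^n\Big\langle\Psi^\delta_i,\frac{\partial u}{\partial x_i}v\Big\rangle\\ &\quad+\int_{U\times U\setminus d}\sum_{i=1}^n(y_i-x_i)\Big(\frac{\partial u}{\partial y_i}(y)v(y)-\frac{\partial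 u}{\partial x_i}(x)v(x)\Big)I_{\{|x-y|\le\delta\}}(x,y)\,J(dxdy)\\ &\quad+\int_{U\times U\setminus d}2\Big(u(y)-u(x)-\sum_{i=1}^n(y_i-x_i)\frac{\partial u}{\partial y_i}(y)I_{\{|x-y|\le\delta\}}(x,y)\Big)v(y)\,J(dxdy)\\ &\quad+\int_U u(x)v(x)\,K(dx). \end{align*}
   Context: $d$ is the diagonal of $U\times U$. The jumping measure $J$ (a positive Radon measure on $U\times U\setminus d$) and killing measure $K$ (a positive Radon measure on $U$) are the unique such measures with $\mathcal{E}(u,v)=\int_{U\times U\setminus d}2(u(y)-u(x))v(y)J(dxdy)+\int_U u(x)v(x)K(dx)$ for all $v\in C_0^\infty(U)$ and all $u\in C_0^\infty(U)$ constant on a neighbourhood of $\mathrm{supp}[v]$. $U^\delta:=\{x\in U:\inf_{y\in\partial U}|x-y|>\delta\}$. A generalized function on $U^\delta$ is a linear functional $\Psi$ on $C_0^\infty(U^\delta)$ such that for every relatively compact open $O\subset U^\delta$, if $f_n,f\in C_0^\infty(O)$ and $f_n$ with all partial derivatives converges uniformly to $f$ with its partial derivatives, then $\langle\Psi,f_n\rangle\to\langle\Psi,f\rangle$. *)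

(* Defs.v *)
From HB Require Import structures.
From mathcomp Require Import all_boot all_order all_algebra.
From mathcomp Require Import all_classical all_reals all_analysis.
Set Implicit Arguments. Unset Strict Implicit. Unset Printing Implicit Defensive.
Import Order.TTheory GRing.Theory Num.Theory.
Import numFieldNormedType.Exports.
Local Open Scope classical_set_scope.
Local Open Scope ring_scope.

Notation Rn R n := ('rV[R]_n).

Definition Bor (R : realType) (n : nat) := g_sigma_algebraType (@open (Rn R n)).

(* Euclidean norm |x| on R^n (the library norm on matrices is the max norm). *)
Definition enorm (R : realType) (n : nat) (x : Rn R n) : R :=
  Num.sqrt (\sum_(i < n) x ord0 i ^+ 2).

Definition evec (R : realType) (n : nat) (i : 'I_n) : Rn R n := delta_mx ord0 i.
Definition dpart (R : realType) (n : nat) (i : 'I_n) (f : Rn R n -> R) : Rn R n -> R :=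
  fun x => derive f x (evec R i).
Fixpoint dparts (R : realType) (n : nat) (s : seq 'I_n) (f : Rn R n -> R) : Rn R n -> R :=
  match s with [::] => f | i :: s' => dpart i (dparts s' f) end.

Definition fsupp (R : realType) (n : nat) (f : Rn R n -> R) : set (Rn R n) :=
  closure [set x | f x != 0].

Definition Cc_inf (R : realType) (n : nat) (O : set (Rn R n)) (f : Rn R n -> R) : Prop :=
  (forall (s : seq 'I_n) (i : 'I_n) (x : Rn R n), derivable (dparts s f) x (evec R i)) /\
  (forall s : seq 'I_n, continuous (dparts s f)) /\
  compact (fsupp f) /\ fsupp f `<=` O.

Definition rel_compact_open (R : realType) (n : nat) (U O : set (Rn R n)) : Prop :=
  open O /\ compact (closure O) /\ closure O `<=` U.

Definition unif_all_deriv (R : realType) (n : nat) (fk : nat -> Rn R n -> R)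
    (f : Rn R n -> R) : Prop :=
  forall (s : seq 'I_n) (eps : R), 0 < eps ->
    exists N : nat, forall k, (N <= k)%N -> forall x,
      `|dparts s (fk k) x - dparts s f x| < eps.

(* U^delta = {x in U : inf_{y in boundary U} |x - y| > delta} *)
Definition Udelta (R : realType) (n : nat) (U : set (Rn R n)) (delta : R) : set (Rn R n) :=
  [set x | U x /\ exists r : R, delta < r /\
     forall y, (closure U `\` U) y -> r <= enorm (x - y)].

Definition offdiag (R : realType) (n : nat) (U : set (Rn R n)) : set (Bor R n * Bor R n) :=
  [set p | U p.1 /\ U p.2 /\ p.1 <> p.2].

Definition radon_on (R : realType) (n : nat) (U : set (Rn R n))
    (mu : {measure set (Bor R n) -> \bar R}) : Prop :=
  mu (~` U) = 0%E /\ forall F : set (Rn R n), compact F -> F `<=` U -> (mu F < +oo)%E.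

Definition radon_offdiag (R : realType) (n : nat) (U : set (Rn R n))
    (J : {measure set (Bor R n * Bor R n) -> \bar R}) : Prop :=
  J (~` offdiag U) = 0%E /\
  forall F : set (Rn R n * Rn R n), compact F -> F `<=` offdiag U -> (J F < +oo)%E.

Definition full_support (R : realType) (n : nat) (U : set (Rn R n))
    (m : {measure set (Bor R n) -> \bar R}) : Prop :=
  forall V : set (Rn R n), open V -> V `<=` U -> V !=set0 -> (0 < m V)%E.

Definition L2fun (R : realType) (n : nat) (m : {measure set (Bor R n) -> \bar R})
    (f : Rn R n -> R) : Prop :=
  measurable_fun (setT : set (Bor R n)) f /\
  m.-integrable (setT : set (Bor R n)) (fun x => (f x ^+ 2)%:E).

Definition L2inner (R : realType) (n : nat) (m : {measure set (Bor R n) -> \bar R})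
    (f g : Rn R n -> R) : R :=
  fine (\int[m]_(x in (setT : set (Bor R n))) (f x * g x)%:E).

(* Semi-Dirichlet form (E, D) on L^2(U; m) (Ma-Overbeck-Roeckner convention):
   D is a dense linear subspace of L^2 (closed under m-a.e. modification),
   E is bilinear on D and compatible with m-a.e. equality, lower bounded,
   satisfies the weak sector condition, is closed, and has the
   semi-Dirichlet (one-sided Markov) property. *)
Definition semi_dirichlet (R : realType) (n : nat) (m : {measure set (Bor R n) -> \bar R})
    (D : set (Rn R n -> R)) (E : (Rn R n -> R) -> (Rn R n -> R) -> R) : Prop :=
  D `<=` L2fun m /\
      D (fun _ => 0) /\
      (forall (a : R) f g, D f -> D g -> D (fun x => a * f x + g x)) /\
      (forall f g, D f -> L2fun m g -> {ae m, forall x, f x = g x} -> D g) /\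
      (forall (a : R) f g h, D f -> D g -> D h ->
         E (fun x => a * f x + g x) h = a * E f h + E g h /\
         E h (fun x => a * f x + g x) = a * E h f + E h g) /\
      (forall f f' g, D f -> D f' -> D g -> {ae m, forall x, f x = f' x} ->
         E f g = E f' g /\ E g f = E g f') /\
      (forall f, L2fun m f -> forall eps : R, 0 < eps -> exists2 u, D u &
         L2inner m (fun x => f x - u x) (fun x => f x - u x) < eps) /\
      (exists alpha0 : R, exists Kc : R, 0 <= alpha0 /\ 0 < Kc /\
        let E1 := fun f g => E f g + (alpha0 + 1) * L2inner m f g in
        [/\ forall u, D u -> 0 <= E u u + alpha0 * L2inner m u u,
            forall u v, D u -> D v ->
              `|E1 u v| <= Kc * Num.sqrt (E1 u u) * Num.sqrt (E1 v v) &
            forall uk : nat -> (Rn R n -> R), (forall k, D (uk k)) ->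
              (forall eps : R, 0 < eps -> exists N : nat, forall k l, (N <= k)%N -> (N <= l)%N ->
                 E1 (fun x => uk k x - uk l x) (fun x => uk k x - uk l x) < eps) ->
              exists2 u, D u &
                (fun k => E1 (fun x => uk k x - u x) (fun x => uk k x - u x)) @ \oo --> 0]) /\
      (forall u, D u ->
         let w := fun x => Num.min (Num.max (u x) 0) 1 in
         D w /\ 0 <= E w (fun x => u x - w x)).

Definition E_continuous (R : realType) (n : nat) (U : set (Rn R n))
    (E : (Rn R n -> R) -> (Rn R n -> R) -> R) : Prop :=
  forall O, rel_compact_open U O ->
  forall (fk : nat -> Rn R n -> R) (f : Rn R n -> R),
    (forall k, Cc_inf O (fk k)) -> Cc_inf O f -> unif_all_deriv fk f ->
    forall g, Cc_inf U g ->
      (fun k => E (fk k) g) @ \oo --> E f g /\ (fun k => E g (fk k)) @ \oo --> E g f.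

Definition jump_kill (R : realType) (n : nat) (U : set (Rn R n))
    (E : (Rn R n -> R) -> (Rn R n -> R) -> R)
    (J : {measure set (Bor R n * Bor R n) -> \bar R})
    (K : {measure set (Bor R n) -> \bar R}) : Prop :=
  radon_offdiag U J /\ radon_on U K /\
  forall u v, Cc_inf U u -> Cc_inf U v ->
    (exists W, open W /\ fsupp v `<=` W /\ exists c : R, forall x, W x -> u x = c) ->
    (E u v)%:E =
      (\int[J]_(p in offdiag U) (2 * (u p.2 - u p.1) * v p.2)%:E +
       \int[K]_(x in (U : set (Bor R n))) (u x * v x)%:E)%E.

Definition gen_function (R : realType) (n : nat) (O : set (Rn R n))
    (Psi : (Rn R n -> R) -> R) : Prop :=
  (forall (a : R) f g, Cc_inf O f -> Cc_inf O g ->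
      Psi (fun x => a * f x + g x) = a * Psi f + Psi g) /\
  forall W, rel_compact_open O W ->
  forall (fk : nat -> Rn R n -> R) (f : Rn R n -> R),
    (forall k, Cc_inf W (fk k)) -> Cc_inf W f -> unif_all_deriv fk f ->
    (fun k => Psi (fk k)) @ \oo --> Psi f.

(* Main.v *)
Require Import Defs.
From HB Require Import structures.
From mathcomp Require Import all_boot all_order all_algebra.
From mathcomp Require Import all_classical all_reals all_analysis measurable_realfun.
From mathcomp Require Import ring lra.
Set Implicit Arguments. Unset Strict Implicit. Unset Printing Implicit Defensive.
Import Order.TTheory GRing.Theory Num.Theory.
Import numFieldNormedType.Exports.
Local Open Scope classical_set_scope.
Local Open Scope ring_scope.

(* The form is extended linearly to kernels F(x,y) = sum_k a_k(x) b_k(y) by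
   F |-> - sum_k E(a_k, b_k), written [tform].  The resolvents of a semi-Dirichlet form are
   positivity preserving, and approximating E by the associated bounded forms shows that
   [tform] F >= 0 whenever F >= 0 vanishes on the diagonal.  On kernels vanishing near the
   diagonal, [tform] is integration against 2J; positivity and Fatou's lemma then give
   2 int F dJ <= tform F for every F >= 0 vanishing on the diagonal, with equality when F is
   of third order there.  Hence v |-> tform F - 2 int F dJ, for
   F = chi(x) v(y) <xi, x - y>^2, is a positive linear functional, and the Riesz
   representation theorem and polarization in xi yield the measures nu_ij.
   The kernel u(x) v(y) minus chi(x) v(y) times the second order Taylor polynomial of u at y
   is of third order, which expresses E(u,v) through J, K, the second order functionals and
   the first order terms E(chi x_i, g), E(chi, y_i g) with g = (d_i u) v; the latter,
   together with the remaining truncation terms, form Psi_i(g). *)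

(** * Lax-Milgram without completion *)

(** The form is neither symmetric nor nonnegative, and its contraction property tests only one of
    the two arguments, so there is no energy measure to start from. Passing to kernels makes that
    property a linear positivity statement. The restriction to kernels vanishing on the diagonal is
    forced: the approximating forms contain beta times the m-integral of the kernel over the
    diagonal, with the wrong sign. Positivity also makes the extension independent of how a kernel
    is decomposed. Integrability of |x - y|^2 against J near the diagonal is not assumed but
    obtained. First order kernels need not be J-integrable, so their contribution is in general
    neither a measure nor a J-integral; it survives only as a distribution, continuous because E is.
    On U^delta the closed delta-neighbourhood of a compact support is compact in U, and a cutoff
    equal to 1 on it replaces the sharp truncation up to an integrable error. The domain consists of
    functions, not of classes, and is complete for a seminorm only, so the Hilbert space arguments
    are carried out for semi-inner products. *)

Section BilinearForms.
Variables (R : realType) (T : Type).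
Implicit Types (D : set (T -> R)) (B S I : (T -> R) -> (T -> R) -> R)
  (l : (T -> R) -> R).

Definition lin_subspace D :=
  D (fun _ => 0) /\ forall (a : R) f g, D f -> D g -> D (fun x => a * f x + g x).

Definition lin_on D l := forall (a : R) f g, D f -> D g ->
  l (fun x => a * f x + g x) = a * l f + l g.

Definition bilin_on D B :=
  (forall h, D h -> lin_on D (B^~ h)) /\ (forall h, D h -> lin_on D (B h)).

(** Only semidefinite: elements of [D] are functions rather than classes, so null vectors remain and
    limits are determined up to them. *)
Definition inner_on D S := [/\ bilin_on D S,
  forall f g, D f -> D g -> S f g = S g f & forall f, D f -> 0 <= S f f].

Definition cauchy_on S (uk : nat -> T -> R) := forall eps : R, 0 < eps ->
  exists N : nat, forall k j, (N <= k)%N -> (N <= j)%N ->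
    S (fun x => uk k x - uk j x) (fun x => uk k x - uk j x) < eps.

Definition complete_on D S := forall uk : nat -> (T -> R), (forall k, D (uk k)) ->
  cauchy_on S uk -> exists2 u, D u & forall eps : R, 0 < eps ->
    exists N : nat, forall k, (N <= k)%N ->
      S (fun x => uk k x - u x) (fun x => uk k x - u x) < eps.

Section Subspace.
Variable D : set (T -> R).
Hypothesis Dsub : lin_subspace D.

Lemma subspaceB f g : D f -> D g -> D (fun x => f x - g x).
Proof.
move=> Df Dg; have := Dsub.2 (-1) g f Dg Df.
by congr D; apply: funext => x; ring.
Qed.

Lemma subspaceD f g : D f -> D g -> D (fun x => f x + g x).
Proof.
move=> Df Dg; have := Dsub.2 1 g f Dg Df.
by congr D; apply: funext => x; ring.
Qed.

Lemma subspaceZ a f : D f -> D (fun x => a * f x).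
Proof.
move=> Df; have := Dsub.2 a f _ Df Dsub.1.
by congr D; apply: funext => x; ring.
Qed.

Lemma subspace_sum (J : Type) (s : seq J) (c : J -> R) (f : J -> T -> R) :
  (forall k, D (f k)) -> D (fun x => \sum_(k <- s) c k * f k x).
Proof.
move=> Df; elim: s => [|k s IH].
  by have := Dsub.1; congr D; apply: funext => x; rewrite big_nil.
by have := Dsub.2 (c k) _ _ (Df k) IH; congr D; apply: funext => x; rewrite big_cons.
Qed.

Section Linear.
Variable l : (T -> R) -> R.
Hypothesis ll : lin_on D l.

Lemma lin_on0 : l (fun _ => 0) = 0.
Proof.
have E : l (fun _ => 0) = 1 * l (fun _ => 0) + l (fun _ => 0).
  rewrite -(ll 1 Dsub.1 Dsub.1); congr l; apply: funext => x; ring.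
lra.
Qed.

Lemma lin_onB f g : D f -> D g -> l (fun x => f x - g x) = l f - l g.
Proof.
move=> Df Dg; have -> : l f - l g = -1 * l g + l f by ring.
by rewrite -(ll (-1) Dg Df); congr l; apply: funext => x; ring.
Qed.

Lemma lin_onD f g : D f -> D g -> l (fun x => f x + g x) = l f + l g.
Proof.
move=> Df Dg; have -> : l f + l g = 1 * l f + l g by ring.
by rewrite -(ll 1 Df Dg); congr l; apply: funext => x; ring.
Qed.

Lemma lin_onZ a f : D f -> l (fun x => a * f x) = a * l f.
Proof.
move=> Df; have -> : a * l f = a * l f + l (fun=> 0) by rewrite lin_on0; ring.
by rewrite -(ll a Df Dsub.1); congr l; apply: funext => x; ring.
Qed.

Lemma lin_on_sum (J : Type) (s : seq J) (c : J -> R) (f : J -> T -> R) :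
  (forall k, D (f k)) ->
  l (fun x => \sum_(k <- s) c k * f k x) = \sum_(k <- s) c k * l (f k).
Proof.
move=> Df; elim: s => [|k s IH].
  rewrite big_nil -[RHS]lin_on0; congr l; apply: funext => x; exact: big_nil.
have Ds := @subspace_sum _ s c f Df.
rewrite big_cons -IH -(ll _ (Df k) Ds); congr l; apply: funext => x; exact: big_cons.
Qed.

End Linear.

(** Discriminant criterion; [a = 0] has to be covered because [S f f] may vanish for a nonzero
    [f]. *)
Lemma quad_ge0 (a b c : R) : (forall t, 0 <= a * t ^+ 2 + 2 * b * t + c) -> b ^+ 2 <= a * c.
Proof.
move=> H; have [a0|a0] := eqVneq a 0; last first.
  have a_gt0 : 0 < a.
    rewrite lt_neqAle eq_sym a0 /= leNgt; apply/negP => an.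
    have c0 : 0 <= c by have := H 0; lra.
    pose r := (`|b| + c + 1 - a) / (- a).
    have [b0 b1] : b <= `|b| /\ - b <= `|b| by split; rewrite ?ler_norm// -normrN ler_norm.
    (* Chosen so that a t = a - 2(|b| + c + 1): with t >= 1 this makes t(a t + 2 b) + c negative. *)
    pose t := 1 + 2 * (`|b| + c + 1) / (- a).
    have ta : a * t = a - 2 * (`|b| + c + 1) by rewrite /t; field; lra.
    have t1 : 1 <= t by rewrite lerDl divr_ge0 //; lra.
    have := H t; rewrite expr2 mulrA ta; nra.
  have := H (- b / a).
  have -> : a * (- b / a) ^+ 2 + 2 * b * (- b / a) + c = (a * c - b ^+ 2) / a by field.
  by rewrite pmulr_lge0 ?invr_gt0// subr_ge0.
subst a; rewrite mul0r; have [->|b0] := eqVneq b 0; first by rewrite expr0n.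
have := H (- (c + 1) / (2 * b)).
have -> : 0 * (- (c + 1) / (2 * b)) ^+ 2 + 2 * b * (- (c + 1) / (2 * b)) + c = -1 by field.
by rewrite lerNr oppr0 ler10.
Qed.

Section Bilinear.
Variable B : (T -> R) -> (T -> R) -> R.
Hypothesis Bb : bilin_on D B.

Lemma bilinDD f g : D f -> D g ->
  B (fun x => f x + g x) (fun x => f x + g x) = B f f + B f g + B g f + B g g.
Proof.
move=> Df Dg; have Ds := subspaceD Df Dg.
rewrite (lin_onD (Bb.1 _ Ds) Df Dg) (lin_onD (Bb.2 _ Df) Df Dg).
by rewrite (lin_onD (Bb.2 _ Dg) Df Dg); ring.
Qed.

Lemma bilinBB f g : D f -> D g ->
  B (fun x => f x - g x) (fun x => f x - g x) = B f f - B f g - B g f + B g g.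
Proof.
move=> Df Dg; have Ds := subspaceB Df Dg.
rewrite (lin_onB (Bb.1 _ Ds) Df Dg) (lin_onB (Bb.2 _ Df) Df Dg).
by rewrite (lin_onB (Bb.2 _ Dg) Df Dg); ring.
Qed.

Lemma bilinZZ a f : D f -> B (fun x => a * f x) (fun x => a * f x) = a ^+ 2 * B f f.
Proof.
move=> Df; have Ds := subspaceZ a Df.
by rewrite (lin_onZ (Bb.1 _ Ds) _ Df) (lin_onZ (Bb.2 _ Df) _ Df); ring.
Qed.

End Bilinear.

Section Inner.
Variable S : (T -> R) -> (T -> R) -> R.
Hypothesis SI : inner_on D S.

Lemma inner_cs f g : D f -> D g -> S f g ^+ 2 <= S f f * S g g.
Proof.
move=> Df Dg; case: SI => Sb Ss Sp; apply: quad_ge0 => t.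
have := Sp _ (subspaceD (subspaceZ t Df) Dg).
rewrite (bilinDD Sb (subspaceZ t Df) Dg) (bilinZZ Sb t Df).
rewrite (lin_onZ (Sb.1 _ Dg) _ Df) (lin_onZ (Sb.2 _ Dg) _ Df) (Ss _ _ Dg Df).
by congr (0 <= _); ring.
Qed.

Lemma inner_addle f g : D f -> D g ->
  S (fun x => f x + g x) (fun x => f x + g x) <= 2 * S f f + 2 * S g g.
Proof.
move=> Df Dg; case: SI => Sb Ss Sp; have := Sp _ (subspaceB Df Dg).
rewrite (bilinDD Sb Df Dg) (bilinBB Sb Df Dg); lra.
Qed.

Lemma small_eq0 (r c : R) : (forall eps, 0 < eps -> r ^+ 2 <= eps * c) -> r = 0.
Proof.
move=> H; apply/eqP; rewrite -sqrf_eq0; apply/eqP/le_anti; rewrite sqr_ge0 andbT.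
apply/ler_addgt0Pr => e e0; rewrite add0r.
have c1 : 0 < `|c| + 1 by have := normr_ge0 c; lra.
have := H (e / (`|c| + 1)) (divr_gt0 e0 c1) => /le_trans; apply.
rewrite mulrAC ler_pdivrMr// ler_pM2l//.
by have := ler_norm c; lra.
Qed.

(* Minimizing sequences of [S w w - 2 * l w] are Cauchy by the parallelogram
   identity, and their limit represents [l]. *)
Lemma inner_riesz l (M : R) : complete_on D S -> lin_on D l ->
  (forall w, D w -> l w ^+ 2 <= M * S w w) ->
  exists2 z, D z & forall w, D w -> S z w = l w.
Proof.
move=> Sc ll lM; case: (SI) => Sb Ss Sp.
have M0 w : D w -> 0 <= `|M| * S w w - l w ^+ 2.
  move=> Dw; have := lM _ Dw; have := Sp _ Dw; have := ler_norm M; nra.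
pose F w := S w w - 2 * l w.
(* The bound on [l] and AM-GM give 2 l(w) <= |M| + S(w,w). *)
have Flb w : D w -> - `|M| <= F w.
  move=> Dw; have := M0 _ Dw; have := Sp _ Dw; have := normr_ge0 M.
  rewrite /F; set s := S w w; set t := l w; set u := `|M| => u0 s0 H.
  have : (2 * t) ^+ 2 <= (u + s) ^+ 2 by have := sqr_ge0 (u - s); nra.
  move=> H2; have : 2 * t <= u + s by rewrite leNgt; apply/negP => H3; nra.
  lra.
have Fhi : has_inf [set F w | w in D].
  split; first by exists (F (fun=> 0)); exists (fun=> 0) => //; exact: Dsub.1.
  by exists (- `|M|) => _ [w Dw <-]; exact: Flb.
pose mi := inf [set F w | w in D].
have mlb w : D w -> mi <= F w by move=> Dw; apply: (inf_lbound Fhi.2); exists w.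
have ex k : exists w, D w /\ F w < mi + k.+1%:R^-1.
  have k0 : 0 < k.+1%:R^-1 :> R by rewrite invr_gt0.
  by have [_ [w Dw <-] Hw] := inf_adherent k0 Fhi; exists w.
pose wk k := projT1 (cid (ex k)).
have Dwk k : D (wk k) by rewrite /wk; case: cid => w [].
have Fwk k : F (wk k) < mi + k.+1%:R^-1 by rewrite /wk; case: cid => w [].
have inve (eps : R) : 0 < eps -> exists N, forall k, (N <= k)%N -> k.+1%:R^-1 < eps.
  by move=> e0; have [N _ HN] := near_infty_natSinv_lt (PosNum e0); exists N => k /HN.
have Cwk : cauchy_on S wk.
  move=> eps e0; have e4 : 0 < eps / 4 by lra.
  have [N HN] := inve _ e4; exists N => k j Nk Nj.
  have Dm := subspaceZ (2^-1) (subspaceD (Dwk k) (Dwk j)).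
  have := mlb _ Dm; have := Fwk k; have := Fwk j; have := HN _ Nk; have := HN _ Nj.
  rewrite /F (bilinZZ Sb _ (subspaceD (Dwk k) (Dwk j))) (bilinDD Sb (Dwk k) (Dwk j)).
  rewrite (lin_onZ ll _ (subspaceD (Dwk k) (Dwk j))) (lin_onD ll (Dwk k) (Dwk j)).
  rewrite (bilinBB Sb (Dwk k) (Dwk j)) (Ss _ _ (Dwk j) (Dwk k)).
  have -> : (2^-1 : R) ^+ 2 = 4^-1 by field.
  by set i := j.+1%:R^-1; set i' := k.+1%:R^-1; lra.
have [z Dz Hz] := Sc _ Dwk Cwk; exists z => // w Dw.
apply/eqP; rewrite -subr_eq0; apply/eqP; apply: (@small_eq0 _ (4 * S w w)) => eps e0.
have [N1 HN1] := Hz _ e0; have [N2 HN2] := inve _ e0.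
pose k := maxn N1 N2.
have H1 := HN1 k (leq_maxl _ _); have H2 := HN2 k (leq_maxr _ _).
(* Approximate Euler-Lagrange equation: moving from [wk k] along [w] lowers [F] by at most 1/(k+1),
   and the discriminant of this quadratic in [t] bounds its linear coefficient. *)
have Q : (S (wk k) w - l w) ^+ 2 <= S w w * k.+1%:R^-1.
  apply: quad_ge0 => t; have Dt := subspaceZ t Dw.
  have := mlb _ (subspaceD (Dwk k) Dt); have := Fwk k.
  rewrite /F (bilinDD Sb (Dwk k) Dt) (bilinZZ Sb _ Dw) (lin_onD ll (Dwk k) Dt).
  rewrite (lin_onZ ll _ Dw) (lin_onZ (Sb.1 _ (Dwk k)) _ Dw) (lin_onZ (Sb.2 _ (Dwk k)) _ Dw).
  rewrite (Ss _ _ Dw (Dwk k)); set i := _^-1 => I1 I2.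
  have -> : 2 * (S (wk k) w - l w) * t = 2 * t * S (wk k) w - 2 * t * l w by ring.
  lra.
have P : S (fun x => wk k x - z x) w ^+ 2 <= S (fun x => wk k x - z x) (fun x => wk k x - z x) * S w w.
  exact: inner_cs (subspaceB (Dwk k) Dz) Dw.
move: P; rewrite (lin_onB (Sb.1 _ Dw) (Dwk k) Dz).
have := Sp _ Dw; move: H1 H2 Q; set p := S (fun x => _) _; set i := _^-1.
set a := S _ w; set b := S z w; set c := l w; set s := S w w.
move=> H1 H2 Q s0 P.
have : (b - c) ^+ 2 <= 2 * (a - b) ^+ 2 + 2 * (a - c) ^+ 2.
  by have := sqr_ge0 ((a - b) + (a - c)); nra.
nra.
Qed.

End Inner.

(* With [S (A u) w = B u w], the form [S (A u) (A v) = B u (A v)] is again a complete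
   inner product; the Riesz representative of [v |-> S z (A v)] solves the problem. *)
Lemma lax_milgram S B l (M c Ml : R) : inner_on D S -> complete_on D S ->
  bilin_on D B -> 0 < c ->
  (forall u v, D u -> D v -> B u v ^+ 2 <= M * S u u * S v v) ->
  (forall u, D u -> c * S u u <= B u u) ->
  lin_on D l -> (forall w, D w -> l w ^+ 2 <= Ml * S w w) ->
  exists2 u, D u & forall w, D w -> B u w = l w.
Proof.
move=> SI Sc Bb c0 BM Bc ll lM; case: (SI) => Sb Ss Sp.
(* Outside [D] the value is arbitrary; it only makes [A] a total function. *)
have exA u : exists Au, D u -> D Au /\ forall w, D w -> S Au w = B u w.
  have [Du|nDu] := pselect (D u); last by exists u.
  have [z Dz Hz] := inner_riesz SI Sc (Bb.2 _ Du) (fun w Dw => BM _ _ Du Dw).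
  by exists z.
pose A u := projT1 (cid (exA u)).
have DA u : D u -> D (A u) by rewrite /A; case: cid => a Ha /= /Ha[].
have SA u w : D u -> D w -> S (A u) w = B u w.
  by rewrite /A; case: cid => a Ha /= /Ha[_]; apply.
pose S' u v := B u (A v).
have S'E u v : D u -> D v -> S' u v = S (A u) (A v).
  by move=> Du Dv; rewrite SA//; exact: DA.
have S's u v : D u -> D v -> S' u v = S' v u.
  by move=> Du Dv; rewrite !S'E// Ss//; exact: DA.
have S'l h : D h -> lin_on D (S'^~ h).
  by move=> Dh a f g Df Dg; apply: Bb.1 => //; exact: DA.
have SI' : inner_on D S'.
  split=> //; last by move=> f Df; rewrite S'E//; apply/Sp/DA.
  split=> // h Dh a f g Df Dg; have Dl := Dsub.2 a _ _ Df Dg.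
  by rewrite ![S' h _]S's//; exact: S'l.
(* Since B(u,u) = S(Au,u), coercivity and Cauchy-Schwarz bound [S'] below by c^2 S. Together with
   [high] this makes the two seminorms equivalent, so [S'] inherits completeness. *)
have low u : D u -> c ^+ 2 * S u u <= S' u u.
  move=> Du; have := Bc _ Du; rewrite -SA// S'E//.
  have := inner_cs SI (DA _ Du) Du; have := Sp _ Du; have := Sp _ (DA _ Du).
  set s := S u u; set t := S _ u; set q := S _ _ => q0 s0 H1 H2.
  have [->|s1] := eqVneq s 0; first by rewrite mulr0.
  have sp : 0 < s by rewrite lt_neqAle eq_sym s1.
  have : (c * s) ^+ 2 <= t ^+ 2 by rewrite ler_sqr ?nnegrE//; nra.
  move=> H3; rewrite -(ler_pM2r sp); apply: le_trans _ H1; apply: le_trans _ H3.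
  by rewrite le_eqVlt; apply/orP; left; apply/eqP; ring.
have high u : D u -> S' u u <= `|M| * S u u.
  move=> Du; have := BM _ _ Du (DA _ Du); rewrite -/(S' u u) -S'E//.
  have [_ _ /(_ _ Du)] := SI'; have := Sp _ Du; have := ler_norm M.
  set s := S u u; set q := S' u u; set m := `|M| => Mm s0 q0 H.
  rewrite leNgt; apply/negP => H3.
  have : q * q <= M * s * q by rewrite -expr2.
  have : 0 <= m by exact: normr_ge0.
  move=> m0 H4; have q1 : 0 < q by nra.
  by have := H4; rewrite ler_pM2r//; nra.
have SC' : complete_on D S'.
  move=> uk Duk Cuk; have [|u Du Hu] := Sc uk Duk.
    move=> eps e0; have e1 : 0 < c ^+ 2 * eps by rewrite mulr_gt0// exprn_gt0.
    have [N HN] := Cuk _ e1; exists N => k j Nk Nj; have := HN _ _ Nk Nj.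
    have := low _ (subspaceB (Duk k) (Duk j)) => /le_lt_trans/[apply].
    by rewrite ltr_pM2l// exprn_gt0.
  exists u => // eps e0; have e1 : 0 < eps / (`|M| + 1).
    by rewrite divr_gt0//; have := normr_ge0 M; lra.
  have [N HN] := Hu _ e1; exists N => k Nk; have := HN _ Nk.
  rewrite ltr_pdivlMr; last by have := normr_ge0 M; lra.
  have := high _ (subspaceB (Duk k) Du); have := Sp _ (subspaceB (Duk k) Du); nra.
have [z Dz Hz] := inner_riesz SI Sc ll lM.
pose l' v := S z (A v).
have l'E v : D v -> l' v = B v z by move=> Dv; rewrite /l' Ss ?SA//; exact: DA.
have ll' : lin_on D l'.
  by move=> a f g Df Dg; rewrite !l'E//; [exact: Bb.1|exact: Dsub.2].
have lM' v : D v -> l' v ^+ 2 <= S z z * S' v v.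
  by move=> Dv; rewrite S'E//; apply: inner_cs => //; exact: DA.
have [u Du Hu] := inner_riesz SI' SC' ll' lM'.
exists u => // w Dw; rewrite -Hz// -SA//.
have DAu := DA _ Du; have Dr := subspaceB DAu Dz.
pose r := fun x => A u x - z x.
(* The residual [r] is orthogonal to the range of [A]. Tested against [A r] this says B(r,r) = 0,
   and coercivity makes [r] null. *)
have rA v : D v -> S r (A v) = 0.
  move=> Dv; have DAv := DA _ Dv; rewrite (lin_onB (Sb.1 _ DAv) DAu Dz).
  by rewrite -S'E// Hu// subrr.
have r0 : S r r = 0.
  have := rA _ Dr; rewrite Ss//; last exact: DA.
  rewrite SA// => H; have := Bc _ Dr; rewrite H; have := Sp _ Dr.
  set s := S _ _ => s0; nra.
have : S r w ^+ 2 <= S r r * S w w by exact: inner_cs.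
rewrite r0 mul0r (lin_onB (Sb.1 _ Dw) DAu Dz) => H.
by apply/eqP; rewrite -subr_eq0 -sqrf_eq0; apply/eqP/le_anti; rewrite sqr_ge0 H.
Qed.

(* [z k] represents [l] for [S + k I]; the values [l (z k)] decrease to [0]. *)
Lemma weakly_small S I l (M : R) : inner_on D S -> complete_on D S -> inner_on D I ->
  (forall f, D f -> I f f <= S f f) ->
  lin_on D l -> (forall w, D w -> l w ^+ 2 <= M * S w w) ->
  (forall w, D w -> I w w = 0 -> l w = 0) ->
  forall eps, 0 < eps -> exists2 C : R, 0 < C &
    forall w, D w -> l w ^+ 2 <= eps * (S w w + C * I w w).
Proof.
move=> SI Sc II IS ll lM l0 eps e0; case: (SI) => Sb Ss Sp; case: (II) => Ib Is Ip.
pose Q k f g := S f g + k.+1%:R * I f g.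
have QI k : inner_on D (Q k).
  split; first split.
  - by move=> h Dh a f g Df Dg; rewrite /Q (Sb.1 _ Dh)// (Ib.1 _ Dh)//; ring.
  - by move=> h Dh a f g Df Dg; rewrite /Q (Sb.2 _ Dh)// (Ib.2 _ Dh)//; ring.
  - by move=> f g Df Dg; rewrite /Q Ss// Is.
  - by move=> f Df; rewrite addr_ge0 ?Sp// mulr_ge0 ?Ip.
have QS k f : D f -> S f f <= Q k f f.
  by move=> Df; rewrite lerDl mulr_ge0 ?Ip.
have SQ k f : D f -> Q k f f <= k.+2%:R * S f f.
  move=> Df; rewrite [k.+2%:R]mulrS mulrDl mul1r lerD2l ler_wpM2l//; exact: IS.
have Qc k : complete_on D (Q k).
  move=> uk Duk Cuk; have [|u Du Hu] := Sc uk Duk.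
    move=> e e1; have [N HN] := Cuk _ e1; exists N => i j Ni Nj.
    exact: le_lt_trans (QS k _ (subspaceB (Duk i) (Duk j))) (HN _ _ Ni Nj).
  exists u => // e e1; have e2 : 0 < e / k.+2%:R by rewrite divr_gt0.
  have [N HN] := Hu _ e2; exists N => i Ni.
  apply: le_lt_trans (SQ k _ (subspaceB (Duk i) Du)) _.
  by rewrite mulrC -ltr_pdivlMr//; exact: HN.
have M0 w : D w -> l w ^+ 2 <= `|M| * S w w.
  by move=> Dw; apply: le_trans (lM _ Dw) _; rewrite ler_wpM2r ?Sp// ler_norm.
have ex k : exists z, D z /\ forall w, D w -> Q k z w = l w.
  have [|z Dz Hz] := inner_riesz (QI k) (Qc k) ll (M := `|M|); last by exists z.
  by move=> w Dw; apply: le_trans (M0 _ Dw) _; rewrite ler_wpM2l// QS.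
pose z k := projT1 (cid (ex k)).
have Dz k : D (z k) by rewrite /z; case: cid => w [].
have Hz k w : D w -> Q k (z k) w = l w by move=> Dw; rewrite /z; case: cid => y [Dy Hy] /=; exact: Hy.
pose s k := l (z k).
have sE k : s k = Q k (z k) (z k) by rewrite Hz.
have lQ k w : D w -> l w ^+ 2 <= s k * Q k w w.
  by move=> Dw; have := inner_cs (QI k) (Dz k) Dw; rewrite -sE Hz.
have s_ge0 k : 0 <= s k by rewrite sE; have [_ _] := QI k; apply.
have sM k : s k <= `|M|.
  have H := M0 _ (Dz k); have := QS k _ (Dz k); rewrite -sE.
  rewrite -/(s k) in H; have := normr_ge0 M; have := s_ge0 k.
  move: H; set a := s k; set b := `|M|; set c := S _ _ => H a0 b0 ca.
  rewrite leNgt; apply/negP => ba; nra.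
(* By [lQ], the penalty weight [k.+1] can serve as [C] as soon as [s k <= eps]. *)
suff [k sk] : exists k, s k <= eps.
  exists k.+1%:R => // w Dw; apply: le_trans (lQ k _ Dw) _.
  by rewrite ler_wpM2r//; have [_ _] := QI k; apply.
(* The distance between two representatives is controlled by the drop of [s]. As [s] decreases and
   is bounded below, [z] is Cauchy for [S]. *)
have dec k j : (k <= j)%N ->
    S (fun x => z k x - z j x) (fun x => z k x - z j x) <= s k - s j.
  move=> kj; have Dd := subspaceB (Dz k) (Dz j).
  apply: le_trans (QS k _ Dd) _; have [Qb Qs _] := QI k.
  rewrite (bilinBB Qb (Dz k) (Dz j)) (Qs _ _ (Dz j) (Dz k)) (Hz k _ (Dz k)) (Hz k _ (Dz j)).
  rewrite -/(s k) -/(s j); have : Q k (z j) (z j) <= s j.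
    rewrite sE /Q lerD2l ler_wpM2r ?Ip ?ler_nat//.
  lra.
have s_dec k j : (k <= j)%N -> s j <= s k.
  by move=> kj; rewrite -subr_ge0; apply: le_trans (dec _ _ kj); exact/Sp/subspaceB.
have sI : has_inf [set s k | k in [set: nat]].
  split; first by exists (s 0%N); exists 0%N.
  by exists 0 => _ [k _ <-]; exact: s_ge0.
pose si := inf [set s k | k in [set: nat]].
have s_inf k : si <= s k by apply: (inf_lbound sI.2); exists k.
have Cz : cauchy_on S z.
  move=> e e1; have [_ [N _ <-] HN] := inf_adherent e1 sI; exists N => k j Nk Nj.
  have HH i i' : (N <= i)%N -> (i <= i')%N ->
      S (fun x => z i x - z i' x) (fun x => z i x - z i' x) < e.
    move=> Ni ii'; apply: le_lt_trans (dec _ _ ii') _.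
    have := s_dec _ _ Ni; have := s_inf i'; rewrite -/si in HN; lra.
  have [kj|jk] := leqP k j; first exact: HH.
  have := HH _ _ Nj (ltnW jk).
  by rewrite (bilinBB Sb (Dz k) (Dz j)) (bilinBB Sb (Dz j) (Dz k)); lra.
have [y Dy Hy] := Sc _ Dz Cz.
(* The penalty forces I(z_k,z_k) = O(1/k), so the [S]-limit [y] is null for [I], where [l] vanishes
   by hypothesis. *)
have Iz k : I (z k) (z k) * k.+1%:R <= `|M|.
  apply: le_trans (sM k); rewrite sE /Q mulrC lerDr; exact: Sp.
have Iy : I y y = 0.
  apply/le_anti; rewrite Ip// andbT; apply/ler_addgt0Pr => e e1; rewrite add0r.
  have e4 : 0 < e / 4 by lra.
  have e5 : 0 < e / 4 / (`|M| + 1) by rewrite divr_gt0//; have := normr_ge0 M; lra.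
  have [N1 HN1] := Hy _ e4.
  have [N2 HN2] : exists N, forall k, (N <= k)%N -> k.+1%:R^-1 < e / 4 / (`|M| + 1).
    by have [N _ HN] := near_infty_natSinv_lt (PosNum e5); exists N => k /HN.
  pose k := maxn N1 N2.
  have H1 := HN1 k (leq_maxl _ _); have H2 := HN2 k (leq_maxr _ _).
  have H3 := IS _ (subspaceB (Dz k) Dy); have H4 := Iz k.
  have H5 : I (z k) (z k) < e / 4.
    move: H2; rewrite ltr_pdivlMr; last by have := normr_ge0 M; lra.
    apply: le_lt_trans; rewrite -ler_pdivrMl// invrK mulrC.
    by apply: le_trans H4 _; lra.
  have := inner_addle II (Dz k) (subspaceZ (-1) (subspaceB (Dz k) Dy)).
  rewrite (bilinZZ Ib (-1) (subspaceB (Dz k) Dy)).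
  rewrite (_ : (fun x => z k x + -1 * (z k x - y x)) = y); first lra.
  by apply: funext => x; ring.
have ly := l0 _ Dy Iy.
have e2 : 0 < eps ^+ 2 / (`|M| + 1).
  by rewrite divr_gt0 ?exprn_gt0//; have := normr_ge0 M; lra.
have [N HN] := Hy _ e2; exists N; have := HN N (leqnn N).
have := M0 _ (subspaceB (Dz N) Dy); rewrite (lin_onB ll (Dz N) Dy) ly subr0 -/(s N).
rewrite ltr_pdivlMr; last by have := normr_ge0 M; lra.
have := Sp _ (subspaceB (Dz N) Dy); have := normr_ge0 M; have := s_ge0 N.
set a := s N; set b := `|M|; set c := S _ _ => a0 b0 c0 H1 H2.
rewrite leNgt; apply/negP => ba; nra.
Qed.

End Subspace.
End BilinearForms.

(** * Resolvents of a semi-Dirichlet form *)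

Lemma ae_mono d (T : measurableType d) (R : realType) (mu : {measure set T -> \bar R})
    (P Q : T -> Prop) : (forall x, P x -> Q x) ->
  (\forall x \ae mu, P x) -> \forall x \ae mu, Q x.
Proof. by move=> PQ; apply: filterS. Qed.

(** * The L^2 inner product *)

Section SquareIntegrable.
Variables (R : realType) (n : nat) (m : {measure set (Bor R n) -> \bar R}).
Local Notation V := (Rn R n).
Local Notation T := (Bor R n).
Implicit Types f g : V -> R.

Lemma L2_integrableM f g : L2fun m f -> L2fun m g ->
  m.-integrable [set: T] (fun x => (f x * g x)%:E).
Proof.
move=> [mf f2] [mg g2]; apply: le_integrable (integrableD measurableT f2 g2) => //.
  by apply/measurable_EFinP; exact: measurable_funM.
move=> x _; rewrite /= lee_fin [leRHS]ger0_norm; last by rewrite addr_ge0 ?sqr_ge0.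
rewrite normrM -(real_normK (num_real (f x))) -(real_normK (num_real (g x))).
by have := sqr_ge0 (`|f x| - `|g x|); have := sqr_ge0 (`|f x| + `|g x|); nra.
Qed.

Lemma L2innerC f g : L2inner m f g = L2inner m g f.
Proof. by congr fine; apply: eq_integral => x _; rewrite mulrC. Qed.

Lemma L2inner_le0 f g : L2fun m f -> L2fun m g ->
  (forall x, f x * g x <= 0) -> L2inner m f g <= 0.
Proof.
move=> Lf Lg fg; have H := L2_integrableM Lf Lg.
have -> : 0 = Rintegral m [set: T] (fun=> 0) :> R.
  by rewrite Rintegral_cst// mul0r.
by apply: le_Rintegral => //; exact: integrable0.
Qed.

Lemma L2inner_lin D h : lin_subspace D -> D `<=` L2fun m -> L2fun m h ->
  lin_on D (L2inner m ^~ h).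
Proof.
move=> Ds DL Lh a f g Df Dg.
have If := L2_integrableM (DL _ Df) Lh; have Ig := L2_integrableM (DL _ Dg) Lh.
have E : L2inner m (fun x => a * f x + g x) h
    = Rintegral m [set: T] (fun x => a * (f x * h x) + g x * h x).
  by congr fine; apply: eq_integral => x _; congr EFin; ring.
rewrite E RintegralD//; last exact: (integrableZl measurableT a If).
by rewrite RintegralZl.
Qed.

Lemma L2inner_inner D : lin_subspace D -> D `<=` L2fun m -> inner_on D (L2inner m).
Proof.
move=> Ds DL; split; first split.
- by move=> h Dh; apply: L2inner_lin => //; exact: DL.
- move=> h Dh a f g Df Dg; rewrite !(L2innerC h).
  exact: (L2inner_lin Ds DL (DL _ Dh)).
- by move=> f g _ _; exact: L2innerC.
- by move=> f Df; apply: Rintegral_ge0 => x _; rewrite -expr2 sqr_ge0.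
Qed.

Lemma L2inner_eq0 f : L2fun m f -> L2inner m f f = 0 ->
  {ae m, forall x, f x = 0}.
Proof.
move=> Lf /eqP f0; have If := L2_integrableM Lf Lf.
have mf : measurable_fun [set: T] (fun x => (f x * f x)%:E).
  exact: (measurable_int m If).
have Fi : (\int[m]_(x in [set: T]) (f x * f x)%:E)%E \is a fin_num.
  exact: integrable_fin_num.
have : (\int[m]_(x in [set: T]) `|(f x * f x)%:E|)%E = 0%E.
  transitivity (\int[m]_(x in [set: T]) (f x * f x)%:E)%E.
    by apply: eq_integral => x _; rewrite gee0_abs// lee_fin -expr2 sqr_ge0.
  by apply/eqP; rewrite -(fineK Fi) eqe.
move/(ae_eq_integral_abs m measurableT mf); apply: ae_mono => x /(_ I)/= /eqP.
by rewrite eqe mulf_eq0 orbb => /eqP.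
Qed.

Lemma L2inner_sum_ge0 (J : finType) (u b : J -> V -> R) :
  (forall k, L2fun m (u k)) -> (forall k, L2fun m (b k)) ->
  {ae m, forall x, 0 <= \sum_k u k x * b k x} ->
  0 <= \sum_k L2inner m (u k) (b k).
Proof.
move=> Lu Lb ub.
have Ik k := L2_integrableM (Lu k) (Lb k).
have Is : m.-integrable [set: T] (fun x => (\sum_k (u k x * b k x)%:E)%E).
  by apply: integrable_sum => // k _; exact: Ik.
have Es : (\sum_k L2inner m (u k) (b k))%:E
    = (\int[m]_(x in [set: T]) (\sum_k (u k x * b k x)%:E))%E.
  rewrite integral_sum//= -sumEFin; apply: eq_bigr => k _.
  by rewrite /L2inner fineK//; exact: integrable_fin_num.
rewrite -lee_fin Es (@ae_eq_integral _ _ _ _ _ (fun x : T => `|\sum_k (u k x * b k x)%:E|)%E)//.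
- exact: integral_ge0.
- exact: (measurable_int m Is).
- by apply: measurableT_comp => //; exact: (measurable_int m Is).
- apply: (@ae_mono _ _ _ m _ _ _ ub) => x H _; rewrite gee0_abs//.
  by rewrite sumEFin lee_fin.
Qed.

End SquareIntegrable.

(** * Existence, weak convergence and positivity of the resolvents *)

Section Resolvent.
Variables (R : realType) (n : nat) (m : {measure set (Bor R n) -> \bar R}).
Variables (D : set (Rn R n -> R)) (E : (Rn R n -> R) -> (Rn R n -> R) -> R).
Hypothesis SD : semi_dirichlet m D E.
Local Notation V := (Rn R n).
Local Notation T := (Bor R n).
Local Notation I := (L2inner m).

Let DL : D `<=` L2fun m. Proof. by case: SD. Qed.

Let Dsub : lin_subspace D.
Proof. by case: SD => _ [D0 [Dl _]]; split. Qed.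

Let Eb : bilin_on D E.
Proof.
case: SD => _ [_ [_ [_ [El _]]]].
by split=> h Dh a f g Df Dg; have [] := El a f g h Df Dg Dh.
Qed.

Let Eae f g h : D f -> D g -> D h -> {ae m, forall x, f x = g x} -> E f h = E g h.
Proof. by case: SD => _ [_ [_ [_ [_ [H _]]]]] Df Dg Dh /(H _ _ _ Df Dg Dh)[]. Qed.

Let II : inner_on D I. Proof. exact: L2inner_inner. Qed.

(** Weak form of u = beta G_beta a, with G_beta the resolvent of [E]. The factor beta is included so
    that [u] approximates [a] as beta grows. *)
Definition resolves (beta : R) (a u : V -> R) :=
  D u /\ forall w, D w -> E u w + beta * I u w = beta * I a w.

Lemma resolves_sum (J : finType) beta (c : J -> R) (a u : J -> V -> R) :
  (forall k, D (a k)) -> (forall k, resolves beta (a k) (u k)) ->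
  resolves beta (fun x => \sum_k c k * a k x) (fun x => \sum_k c k * u k x).
Proof.
move=> Da Hu; have Du k := (Hu k).1; have [Ib _ _] := II.
split=> [|w Dw]; first exact: subspace_sum.
rewrite (lin_on_sum Dsub (Eb.1 _ Dw))// (lin_on_sum Dsub (Ib.1 _ Dw))//.
rewrite (lin_on_sum Dsub (Ib.1 _ Dw))// !mulr_sumr -big_split; apply: eq_bigr => k _ /=.
rewrite mulrCA -mulrDr (Hu k).2//; ring.
Qed.

Section Sector.
Variables (alpha Kc : R).
Hypothesis alpha0 : 0 <= alpha.
Hypothesis E_lb : forall u, D u -> 0 <= E u u + alpha * I u u.
Local Notation E1 := (fun f g => E f g + (alpha + 1) * I f g).
Hypothesis E_sector : forall u v, D u -> D v ->
  `|E1 u v| <= Kc * Num.sqrt (E1 u u) * Num.sqrt (E1 v v).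
Hypothesis E_complete : forall uk : nat -> (V -> R), (forall k, D (uk k)) ->
  (forall eps : R, 0 < eps -> exists N : nat, forall k l, (N <= k)%N -> (N <= l)%N ->
     E1 (fun x => uk k x - uk l x) (fun x => uk k x - uk l x) < eps) ->
  exists2 u, D u &
    (fun k => E1 (fun x => uk k x - u x) (fun x => uk k x - u x)) @ \oo --> 0.

(** The symmetric part of the shifted form carries the Hilbert structure; the shift alpha + 1,
    rather than alpha, makes it dominate the L^2 inner product. *)
Let S f g := 2^-1 * (E1 f g + E1 g f).

Let SE f : S f f = E1 f f.
Proof. by rewrite /S; field. Qed.

Let IS f : D f -> I f f <= S f f.
Proof. by move=> Df; rewrite SE; have := E_lb Df; lra. Qed.

Let SI : inner_on D S.
Proof.
have [Ib Is Ip] := II.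
split; first split.
- move=> h Dh a f g Df Dg; rewrite /S (Eb.1 _ Dh)// (Ib.1 _ Dh)//.
  by rewrite (Eb.2 _ Dh)// (Ib.2 _ Dh)//; ring.
- move=> h Dh a f g Df Dg; rewrite /S (Eb.1 _ Dh)// (Ib.1 _ Dh)//.
  by rewrite (Eb.2 _ Dh)// (Ib.2 _ Dh)//; ring.
- by move=> f g Df Dg; rewrite /S addrC.
- by move=> f Df; apply: le_trans (IS Df); exact: Ip.
Qed.

Let Sc : complete_on D S.
Proof.
move=> uk Duk Cuk; have [|u Du /cvgrPdist_lt Hu] := E_complete Duk.
  by move=> eps /Cuk[N HN]; exists N => k l Nk Nl; rewrite -SE; exact: HN.
exists u => // eps /Hu[N _ HN]; exists N => k Nk; rewrite SE.
by have := HN k Nk; rewrite /= sub0r normrN; apply: le_lt_trans; exact: ler_norm.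
Qed.

Let E1_le u v : D u -> D v -> E1 u v ^+ 2 <= Kc ^+ 2 * S u u * S v v.
Proof.
move=> Du Dv; have [_ _ Sp] := SI; have := E_sector Du Dv.
have := Sp _ Du; have := Sp _ Dv; rewrite !SE => v0 u0 H.
rewrite -(real_normK (num_real _)).
have -> : Kc ^+ 2 * E1 u u * E1 v v = (Kc * Num.sqrt (E1 u u) * Num.sqrt (E1 v v)) ^+ 2.
  by rewrite !exprMn !sqr_sqrtr.
by rewrite ler_sqr ?nnegrE// (le_trans _ H).
Qed.

Let I_le u v : D u -> D v -> I u v ^+ 2 <= S u u * S v v.
Proof.
move=> Du Dv; have [_ _ Ip] := II; apply: le_trans (inner_cs Dsub II Du Dv) _.
by apply: ler_pM; rewrite ?Ip// IS.
Qed.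

Let sq2 (p q t : R) : (p + t * q) ^+ 2 <= 2 * p ^+ 2 + 2 * t ^+ 2 * q ^+ 2.
Proof. rewrite -subr_ge0 (_ : _ - _ = (p - t * q) ^+ 2) ?sqr_ge0//; ring. Qed.

Lemma resolves_exists (beta : R) a : alpha + 1 <= beta -> D a -> exists u, resolves beta a u.
Proof.
move=> beta1 Da; have [Ib Is Ip] := II; have [Sb Ss Sp] := SI.
pose B f g := E f g + beta * I f g.
have Bb : bilin_on D B.
  split=> h Dh c f g Df Dg.
    by rewrite /B (Eb.1 _ Dh)// (Ib.1 _ Dh)//; ring.
  by rewrite /B (Eb.2 _ Dh)// (Ib.2 _ Dh)//; ring.
(* [B] is [E1] plus [t] times the L^2 product, so the sector bound of [E1] and [I_le] bound it. The
   assumption on [beta] gives t >= 0, hence coercivity with constant 1. *)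
pose t := beta - alpha - 1; pose M := 2 * Kc ^+ 2 + 2 * t ^+ 2.
have BM u v : D u -> D v -> B u v ^+ 2 <= M * S u u * S v v.
  move=> Du Dv; pose p := E1 u v; pose q := I u v; pose s := S u u; pose s' := S v v.
  have H2 : p ^+ 2 <= Kc ^+ 2 * s * s' := E1_le Du Dv.
  have H1 : q ^+ 2 <= s * s' := I_le Du Dv.
  have -> : B u v = p + t * q by rewrite /B /t /p /q; ring.
  rewrite -/s -/s'.
  have H3 : t ^+ 2 * q ^+ 2 <= t ^+ 2 * (s * s') by rewrite ler_wpM2l ?sqr_ge0.
  apply: le_trans (sq2 p q t) _; rewrite /M; lra.
have Bc u : D u -> 1 * S u u <= B u u.
  move=> Du; rewrite mul1r SE lerD2l ler_wpM2r//; exact: Ip.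
have ll : lin_on D (fun w => beta * I a w).
  by move=> c f g Df Dg; rewrite (Ib.2 _ Da)//; ring.
have lM w : D w -> (beta * I a w) ^+ 2 <= beta ^+ 2 * S a a * S w w.
  by move=> Dw; rewrite exprMn -mulrA ler_wpM2l ?sqr_ge0// I_le.
by have [u Du Hu] := lax_milgram Dsub SI Sc Bb ltr01 BM Bc ll lM; exists u.
Qed.

(** Testing the resolvent equation with d = u - a keeps S(d,d) bounded and sends I(d,d) to 0 like
    1/beta. This is only weak convergence for the form, and [weakly_small], applied to the
    functional E(., b), turns it into smallness of E(d,b). *)
Lemma resolves_cvg a b (eta : R) : D a -> D b -> 0 < eta -> exists beta0 : R,
  forall (beta : R) u, beta0 <= beta -> resolves beta a u -> `|E u b - E a b| < eta.
Proof.
move=> Da Db eta0; have [Ib Is Ip] := II; have [Sb Ss Sp] := SI.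
have Ele u v : D u -> D v ->
    E u v ^+ 2 <= (2 * Kc ^+ 2 + 2 * (alpha + 1) ^+ 2) * S u u * S v v.
  move=> Du Dv; pose p := E1 u v; pose q := I u v; pose s := S u u; pose s' := S v v.
  have H2 : p ^+ 2 <= Kc ^+ 2 * s * s' := E1_le Du Dv.
  have H1 : q ^+ 2 <= s * s' := I_le Du Dv.
  set c := alpha + 1; have -> : E u v = p + - c * q by rewrite /p /q /c; ring.
  rewrite -/s -/s'.
  have H3 : c ^+ 2 * q ^+ 2 <= c ^+ 2 * (s * s') by rewrite ler_wpM2l ?sqr_ge0.
  apply: le_trans (sq2 p q (- c)) _; rewrite sqrrN; lra.
set M := _ + _ in Ele.
pose Ca := M * S a a.
have M0 : 0 <= M by rewrite addr_ge0// mulr_ge0 ?sqr_ge0.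
have Ca0 : 0 <= Ca by rewrite mulr_ge0 ?Sp.
have lM w : D w -> E w b ^+ 2 <= (M * S b b) * S w w.
  by move=> Dw; apply: le_trans (Ele _ _ Dw Db) _; rewrite mulrAC.
have l0 w : D w -> I w w = 0 -> E w b = 0.
  move=> Dw /(L2inner_eq0 (DL Dw)) w0; rewrite -(lin_on0 Dsub (Eb.1 _ Db)).
  exact: (Eae Dw Dsub.1 Db).
have e0 : 0 < eta ^+ 2 / (2 * Ca + 1) by rewrite divr_gt0 ?exprn_gt0//; lra.
have [C C0 HC] := weakly_small Dsub SI Sc II IS (Eb.1 _ Db) lM l0 e0.
exists (alpha + 1 + C) => beta u betaC [Du Hu].
have Dd := subspaceB Dsub Du Da; set d := fun x => _ in Dd.
have Ed : E u b - E a b = E d b by rewrite -(lin_onB (Eb.1 _ Db)).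
have eq1 : E d d + E a d + beta * I d d = 0.
  have := Hu _ Dd; rewrite {2}/d {3}/d (lin_onB (Eb.1 _ Dd))//.
  rewrite -[E u d](subrK (E a d)) -(lin_onB (Eb.1 _ Dd))// -/d.
  rewrite (lin_onB (Ib.1 _ Dd))//; lra.
have X0 := Sp _ Dd; have XI := IS Dd; have I0 := Ip _ Dd.
have q2 := Ele _ _ Da Dd.
have eq2 : S d d + (beta - alpha - 1) * I d d = - E a d by rewrite SE; lra.
have t0 : C <= beta - alpha - 1 by lra.
have := HC _ Dd; rewrite Ed.
move: q2; rewrite -/Ca -sqrrN -eq2 => q2 H.
rewrite -ltr_sqr ?nnegrE// ?(ltW eta0)// real_normK ?num_real//.
apply: le_lt_trans H _; rewrite mulrAC ltr_pdivrMr; last by lra.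
rewrite ltr_pM2l ?exprn_gt0//.
move: q2 X0 XI I0 t0; set X := S d d; set Y := I d d; set t := beta - _ - _.
move=> q2 X0 XI I0 t0.
have tY : C * Y <= t * Y by rewrite ler_wpM2r.
have tY0 : 0 <= C * Y by rewrite mulr_ge0// ltW.
(* By [q2], (X + tY)^2 <= Ca X <= Ca (X + tY). *)
have h1 : X + t * Y <= Ca.
  have [->|x0] := eqVneq (X + t * Y) 0; first by [].
  have xp : 0 < X + t * Y by rewrite lt_neqAle eq_sym x0/=; lra.
  rewrite -(ler_pM2r xp) -expr2; apply: le_trans q2 _; rewrite ler_wpM2l//; lra.
lra.
Qed.

(** After scaling by [M] the unit contraction becomes the projection of [u] onto [0, M], an interval
    that contains all values of [a]; this is why [a] has to be bounded. The equation tested with the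
    defect u - w shows that the defect is null. *)
Lemma resolves_ge0 (beta : R) a u (M : R) : alpha + 1 <= beta -> 0 < M -> D a ->
  (forall x, 0 <= a x <= M) -> resolves beta a u -> {ae m, forall x, 0 <= u x}.
Proof.
move=> beta1 M0 Da aM [Du Hu]; have [Ib Is Ip] := II.
have Mn0 : M != 0 by rewrite gt_eqF.
pose t x := M^-1 * u x; have Dt : D t := subspaceZ Dsub _ Du.
pose w' x := Num.min (Num.max (t x) 0) 1; pose w x := M * w' x.
have [Dw' Ew'] : D w' /\ 0 <= E w' (fun x => t x - w' x).
  by case: SD => _ [_ [_ [_ [_ [_ [_ [_ H]]]]]]]; exact: H.
have Dw : D w := subspaceZ Dsub _ Dw'.
have Dd := subspaceB Dsub Du Dw; have Dd' := subspaceB Dsub Dt Dw'.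
have uE x : u x = M * t x by rewrite /t mulrA mulfV ?mul1r.
have dE : (fun x => u x - w x) = (fun x => M * (t x - w' x)).
  by apply: funext => x; rewrite uE /w; ring.
have Ew : 0 <= E w (fun x => u x - w x).
  rewrite dE (lin_onZ Dsub (Eb.2 _ Dw))// (lin_onZ Dsub (Eb.1 _ Dd'))//.
  by rewrite !mulr_ge0// ltW.
have Daw := subspaceB Dsub Da Dw.
(* [w x] is the point of [0, M] nearest to [u x] and [a x] lies in [0, M], so the two factors never
   have the same strict sign. *)
have neg : I (fun x => a x - w x) (fun x => u x - w x) <= 0.
  apply: L2inner_le0; [exact: DL|exact: DL|] => x.
  rewrite uE /w /w'; have /andP[a0 a1] := aM x.
  have [t0|t0] := leP (t x) 0.
    rewrite min_l ?ler01// mulr0 !subr0; have : M * t x <= 0 by nra.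
    nra.
  have [t1|t1] := leP (t x) 1; first by rewrite subrr mulr0.
  have : 0 <= M * t x - M * 1 by nra.
  nra.
have H := Hu _ Dd; rewrite (lin_onB (Ib.1 _ Dd) Da Dw) in neg.
have B1 := E_lb Dd; rewrite (lin_onB (Eb.1 _ Dd) Du Dw) in B1.
(* Lower boundedness, the contraction inequality [Ew] and [neg] combine to (beta - alpha) I(u - w, u
   - w) <= 0. *)
have I0 : I (fun x => u x - w x) (fun x => u x - w x) = 0.
  apply/le_anti; rewrite Ip// andbT.
  have Idd : I (fun x => u x - w x) (fun x => u x - w x) =
     I u (fun x => u x - w x) - I w (fun x => u x - w x).
    by rewrite (lin_onB (Ib.1 _ Dd) Du Dw).
  move: B1 H neg Idd Ew.
  set p := E u _; set q := E w _; set x := I u _; set y := I w _; set z := I a _.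
  set J := I _ _ => B1 H neg Idd Ew.
  have beta0 : 0 < beta by apply: lt_le_trans beta1; rewrite ltr_wpDl.
  have : beta * (z - y) <= 0 by rewrite pmulr_rle0.
  have : J * (beta - alpha) <= beta * (z - y).
    have bJ : beta * J = beta * x - beta * y by rewrite Idd mulrBr.
    lra.
  move=> h1 h2; have : J * (beta - alpha) <= 0 by lra.
  by rewrite pmulr_lle0//; lra.
have := L2inner_eq0 (DL Dd) I0; apply: ae_mono => x /eqP; rewrite subr_eq0 => /eqP ->.
rewrite /w /w' mulr_ge0//; first exact: ltW.
by rewrite le_min ler01 le_max lexx orbT.
Qed.

End Sector.
End Resolvent.

(** * The maximum norm and rational vectors *)

Section RowVectors.
Variables (R : realType) (n : nat).
Local Notation V := (Rn R n).

Lemma ler_coord_norm (x : V) i : `|x ord0 i| <= `|x|.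
Proof.
rewrite [leRHS]/Num.norm/= mx_normrE; exact: (le_bigmax _ (fun ij => `|x ij.1 ij.2|) (ord0, i)).
Qed.

Lemma rV_norm_le (x : V) (e : R) : 0 <= e -> (forall i, `|x ord0 i| <= e) -> `|x| <= e.
Proof.
move=> e0 H; rewrite [leLHS]/Num.norm/= mx_normrE; apply/bigmax_leP; split=> // -[i j] _ /=.
by rewrite ord1; exact: H.
Qed.

Lemma rV_norm_lt (x : V) (e : R) : 0 < e -> (forall i, `|x ord0 i| < e) -> `|x| < e.
Proof.
move=> e0 H; rewrite [ltLHS]/Num.norm/= mx_normrE; apply/bigmax_ltP; split=> // -[i j] _ /=.
by rewrite ord1; exact: H.
Qed.

(** A countable dense family: it lets a single null set serve all values of the second variable of a
    kernel. *)
Definition rV_rat (k : nat) : V :=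
  if @unpickle ('rV[rat]_n) k is Some q then map_mx ratr q else 0.

Lemma rV_rat_dense (x : V) (e : R) : 0 < e -> exists k, `|rV_rat k - x| < e.
Proof.
move=> e0.
have ex i : exists q : rat, `|ratr q - x ord0 i| < e.
  have [|q] := @rat_in_itvoo R (x ord0 i - e) (x ord0 i + e); first by lra.
  by rewrite in_itv/= -ltr_distl => ?; exists q.
pose q : 'rV[rat]_n := \row_i projT1 (cid (ex i)).
exists (pickle q); apply: rV_norm_lt => // i.
by rewrite /rV_rat pickleK !mxE; case: cid.
Qed.

Lemma continuous_rat_ge0 (f : V -> R) : continuous f ->
  (forall k, 0 <= f (rV_rat k)) -> forall x, 0 <= f x.
Proof.
move=> cf f0 x; rewrite leNgt; apply/negP => fx.
have /cvgrPdist_lt/(_ (- f x)) := cf x; rewrite oppr_gt0 => /(_ fx)/nbhs_normP[e /= e0 He].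
have [k qk] := rV_rat_dense x e0.
have /He : ball_ Num.norm x e (rV_rat k) by rewrite /ball_/= distrC.
by rewrite /= ltr_distl => /andP[]; have := f0 k; lra.
Qed.

Lemma continuous_sumR (J : Type) (s : seq J) (f : J -> V -> R) :
  (forall k, continuous (f k)) -> continuous (fun x => \sum_(k <- s) f k x).
Proof.
move=> cf; apply: (@continuous_big R^o J +%R 0 xpredT _ _ s f) => // x.
exact: add_continuous.
Qed.

End RowVectors.

(* The resolvents of the form are positivity preserving, so the approximating forms
   [beta * I (a - u_beta) b] satisfy this inequality; it survives in the limit. *)
Lemma semi_dirichlet_sum_le0 (R : realType) (n : nat)
    (m : {measure set (Bor R n) -> \bar R})
    (D : set (Rn R n -> R)) (E : (Rn R n -> R) -> (Rn R n -> R) -> R)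
    (J : finType) (a b : J -> Rn R n -> R) :
  semi_dirichlet m D E -> (forall k, D (a k)) -> (forall k, D (b k)) ->
  (forall k, continuous (b k)) ->
  (forall y, exists M : R, forall x, 0 <= \sum_k a k x * b k y <= M) ->
  (forall x, \sum_k a k x * b k x = 0) ->
  \sum_k E (a k) (b k) <= 0.
Proof.
move=> SD Da Db cb Phi_ge0 Phi_diag.
have [DL [D0 [Dl [_ [_ [_ [_ [EE _]]]]]]]] := SD.
have [alpha [Kc [alpha0 [Kc0 [E_lb E_sector E_complete]]]]] := EE.
have Ds : lin_subspace D by [].
apply/ler_addgt0Pr => eta eta0; rewrite add0r.
have eta1 : 0 < eta / (#|J|.+1)%:R by rewrite divr_gt0.
have ex k : exists beta0 : R, forall (beta : R) u, beta0 <= beta ->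
    resolves m D E beta (a k) u -> `|E u (b k) - E (a k) (b k)| < eta / (#|J|.+1)%:R.
  exact: (resolves_cvg SD E_lb E_sector E_complete (Da k) (Db k) eta1).
pose b0 k := projT1 (cid (ex k)).
have Hb0 k beta u : b0 k <= beta -> resolves m D E beta (a k) u ->
    `|E u (b k) - E (a k) (b k)| < eta / (#|J|.+1)%:R.
  by rewrite /b0; case: cid => ? /= H; exact: H.
pose beta := alpha + 1 + \sum_k `|b0 k|.
have beta1 : alpha + 1 <= beta by rewrite lerDl sumr_ge0.
have beta0 : 0 < beta by apply: lt_le_trans beta1; rewrite ltr_wpDl.
have betab k : b0 k <= beta.
  apply: le_trans (ler_norm _) _; rewrite /beta (bigD1 k)//=.
  have : 0 <= \sum_(i | i != k) `|b0 i| by rewrite sumr_ge0.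
  lra.
have exu k := resolves_exists SD E_lb E_sector E_complete beta1 (Da k).
pose u k := projT1 (cid (exu k)).
have Hu k : resolves m D E beta (a k) (u k) by rewrite /u; case: cid.
have Du k := (Hu k).1.
(* For fixed [y] the section of the kernel is nonnegative and bounded, so its resolvent is
   nonnegative off a null set, which depends on [y]. *)
have pos y : {ae m, forall x, 0 <= \sum_k b k y * u k x}.
  have [M HM] := Phi_ge0 y.
  apply: (resolves_ge0 SD alpha0 E_lb beta1 (_ : 0 < `|M| + 1) _ _
    (resolves_sum SD (b^~ y) Da Hu)).
  - by rewrite ltr_wpDl.
  - exact: subspace_sum.
  - move=> x; have := HM x; under eq_bigr do rewrite mulrC.
    by move=> /andP[-> /le_trans]; apply; have := ler_norm M; lra.
(* Rational [y] share one null set; continuity of the [b k] extends the inequality to every [y], in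
   particular to [y = x]. *)
have posb : {ae m, forall x, 0 <= \sum_k u k x * b k x}.
  have := ae_foralln (fun j => pos (rV_rat R n j)); apply: ae_mono => x H.
  under eq_bigr do rewrite mulrC.
  have cf : continuous (fun y => \sum_k b k y * u k x).
    by apply: continuous_sumR => k y; exact: (cvgM (cb k y) (cvg_cst _)).
  exact: (continuous_rat_ge0 cf H x).
have Iub : 0 <= \sum_k L2inner m (u k) (b k).
  by apply: L2inner_sum_ge0 => // k; exact: DL.
(* Vanishing on the diagonal removes the one term of the approximating form that has no sign. *)
have Iab : \sum_k L2inner m (a k) (b k) = 0.
  have Ik k := L2_integrableM (DL _ (Da k)) (DL _ (Db k)).
  apply: EFin_inj; rewrite -sumEFin.
  transitivity (\int[m]_(x in [set: Bor R n]) (\sum_k (a k x * b k x)%:E))%E.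
    rewrite integral_sum//=; apply: eq_bigr => k _.
    by rewrite /L2inner fineK//; exact: integrable_fin_num.
  by rewrite integral0_eq// => x _; rewrite sumEFin Phi_diag.
have Eub : \sum_k E (u k) (b k) <= 0.
  have -> : \sum_k E (u k) (b k)
      = \sum_k (beta * L2inner m (a k) (b k) - beta * L2inner m (u k) (b k)).
    by apply: eq_bigr => k _; rewrite -(Hu k).2//; ring.
  by rewrite sumrB -!mulr_sumr Iab mulr0 sub0r oppr_le0 mulr_ge0// ltW.
have -> : \sum_k E (a k) (b k) = \sum_k E (u k) (b k) - \sum_k (E (u k) (b k) - E (a k) (b k)).
  by rewrite sumrB; ring.
have : `|\sum_k (E (u k) (b k) - E (a k) (b k))| <= eta.
  apply: le_trans (ler_norm_sum _ _ _) _.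
  apply: (@le_trans _ _ (\sum_(k : J) eta / (#|J|.+1)%:R)).
    by apply: ler_sum => k _; apply/ltW/(Hb0 _ _ _ (betab k) (Hu k)).
  rewrite sumr_const -[_ *+ _]mulr_natr -mulrA ger_pMr//.
  by rewrite ler_pdivrMl// mulr1 ler_nat.
by rewrite ler_norml => /andP[]; lra.
Qed.

(** * Smooth functions and cutoffs *)

Section Smooth.
Variables (R : realType) (n : nat).
Local Notation V := (Rn R n).
Implicit Types (f g : V -> R) (x : V).

(** Recursion on the order, peeling off the first derivative taken, makes closure under products and
    inverses a plain induction: the derivative of a product is a sum of products of lower order.
    Induction on the list in [dparts] would need the full Leibniz formula. *)
Fixpoint Ck (k : nat) f : Prop := continuous f /\
  if k is k'.+1 then forall i : 'I_n,
    (forall x, derivable f x (evec R i)) /\ Ck k' (dpart i f) else True.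

Definition smooth f := forall k, Ck k f.

Lemma Ck_cont k f : Ck k f -> continuous f.
Proof. by case: k => [[]|k []]. Qed.
Arguments Ck_cont {k f} _.

Lemma smooth_cont f : smooth f -> continuous f.
Proof. by move=> /(_ 0%N)[]. Qed.
Arguments smooth_cont {f} _.

Lemma smooth_derivable f i x : smooth f -> derivable f x (evec R i).
Proof. by move=> /(_ 1%N)[_ /(_ i)[]]. Qed.

Lemma smooth_dpart f i : smooth f -> smooth (dpart i f).
Proof. by move=> sf k; have [_ /(_ i)[]] := sf k.+1. Qed.

Lemma smooth_dparts f s : smooth f -> smooth (dparts s f).
Proof. by move=> sf; elim: s => //= i s IH; exact: smooth_dpart. Qed.

Lemma smoothP f : smooth f <->
  (forall (s : seq 'I_n) (i : 'I_n) (x : V), derivable (dparts s f) x (evec R i)) /\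
  (forall s : seq 'I_n, continuous (dparts s f)).
Proof.
split=> [sf|[df cf] k].
  by split=> [s i x|s]; [exact/smooth_derivable/smooth_dparts|exact/smooth_cont/smooth_dparts].
suff : forall s, Ck k (dparts s f) by move=> /(_ [::]).
elim: k => [|k IH] s; split=> // i; split; first exact: df.
exact: (IH (i :: s)).
Qed.

Lemma Ck_le k f : Ck k.+1 f -> Ck k f.
Proof.
elim: k f => [f []//|k IH f [cf df]]; split=> // i.
by have [di Ci] := df i; split=> //; exact: IH.
Qed.

Lemma is_derivable f x v df : is_derive x v f df -> derivable f x v.
Proof. by case. Qed.

Lemma is_dpart f i x : derivable f x (evec R i) -> is_derive x (evec R i) f (dpart i f x).
Proof. by move=> H; exact: DeriveDef. Qed.

Lemma dpart_val f i x d : is_derive x (evec R i) f d -> dpart i f x = d.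
Proof. by case. Qed.

Lemma is_derive_addf f g x v df dg : is_derive x v f df -> is_derive x v g dg ->
  is_derive x v (fun y => f y + g y) (df + dg).
Proof. by move=> *; exact: is_deriveD. Qed.

Lemma is_derive_mulf f g x v df dg : is_derive x v f df -> is_derive x v g dg ->
  is_derive x v (fun y => f y * g y) (f x * dg + g x * df).
Proof. by move=> *; exact: is_deriveM. Qed.

Lemma is_derive_invf f x v df : f x != 0 -> is_derive x v f df ->
  is_derive x v (fun y => (f y)^-1) (- (f x) ^- 2 * df).
Proof.
move=> f0 [dv <-]; apply: DeriveDef; first exact: derivableV.
by rewrite deriveV.
Qed.

Lemma is_derive_cstf (c : R) x v : is_derive x v (fun=> c) 0.
Proof. exact: is_derive_cst. Qed.

Lemma dpart_cst i (c : R) : dpart i (fun=> c) = (fun _ : V => 0).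
Proof. by apply: funext => x; apply: dpart_val; exact: is_derive_cstf. Qed.

Lemma Ck_cst k (c : R) : Ck k (fun=> c).
Proof.
elim: k c => [|k IH] c; (split; first by exact: cst_continuous) => // i; split.
  by move=> x; exact: (is_derivable (is_derive_cstf _ _ _)).
by rewrite dpart_cst.
Qed.

Lemma dpartD f g i : (forall x, derivable f x (evec R i)) ->
  (forall x, derivable g x (evec R i)) ->
  dpart i (fun y => f y + g y) = (fun y => dpart i f y + dpart i g y).
Proof.
by move=> df dg; apply: funext => x; apply: dpart_val; apply: is_derive_addf; exact: is_dpart.
Qed.

Lemma dpartM f g i : (forall x, derivable f x (evec R i)) ->
  (forall x, derivable g x (evec R i)) ->
  dpart i (fun y => f y * g y) = (fun y => f y * dpart i g y + g y * dpart i f y).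
Proof.
by move=> df dg; apply: funext => x; apply: dpart_val; apply: is_derive_mulf; exact: is_dpart.
Qed.

Lemma dpartV f i : (forall x, f x != 0) -> (forall x, derivable f x (evec R i)) ->
  dpart i (fun y => (f y)^-1) = (fun y => -1 * ((f y)^-1 * (f y)^-1) * dpart i f y).
Proof.
move=> f0 df; apply: funext => x; apply: dpart_val.
have := is_derive_invf (f0 x) (is_dpart (df x)).
by rewrite -exprVn expr2 mulN1r.
Qed.

Lemma Ck_add k f g : Ck k f -> Ck k g -> Ck k (fun x => f x + g x).
Proof.
elim: k f g => [|k IH] f g [cf df] [cg dg];
  (split; first by [move=> x; exact: (cvgD (cf x) (cg x))]) => // i.
have [df1 df2] := df i; have [dg1 dg2] := dg i; split.
  by move=> x; exact: (is_derivable (is_derive_addf (is_dpart (df1 x)) (is_dpart (dg1 x)))).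
by rewrite dpartD//; exact: IH.
Qed.

Lemma Ck_mul k f g : Ck k f -> Ck k g -> Ck k (fun x => f x * g x).
Proof.
elim: k f g => [|k IH] f g Cf Cg;
  (split; first by [move=> x; exact: (cvgM (Ck_cont Cf x) (Ck_cont Cg x))]) => // i.
case: (Cf) => cf /(_ i)[df1 df2]; case: (Cg) => cg /(_ i)[dg1 dg2]; split.
  by move=> x; exact: (is_derivable (is_derive_mulf (is_dpart (df1 x)) (is_dpart (dg1 x)))).
by rewrite dpartM//; apply: Ck_add; apply: IH => //; exact: Ck_le.
Qed.

Lemma Ck_inv k f : (forall x, f x != 0) -> Ck k f -> Ck k (fun x => (f x)^-1).
Proof.
move=> f0; elim: k => [|k IH] Cf;
  (split; first by [move=> x; exact: (cvgV (f0 x) (Ck_cont Cf x))]) => // i.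
case: (Cf) => cf /(_ i)[df1 df2]; split.
  by move=> x; exact: (is_derivable (is_derive_invf (f0 x) (is_dpart (df1 x)))).
rewrite dpartV//; apply: Ck_mul => //; apply: Ck_mul; first exact: Ck_cst.
by apply: Ck_mul; apply: IH; exact: Ck_le.
Qed.

Lemma smooth_cst (c : R) : smooth (fun=> c).
Proof. by move=> k; exact: Ck_cst. Qed.

Lemma smooth_add f g : smooth f -> smooth g -> smooth (fun x => f x + g x).
Proof. by move=> sf sg k; exact: Ck_add. Qed.

Lemma smooth_mul f g : smooth f -> smooth g -> smooth (fun x => f x * g x).
Proof. by move=> sf sg k; exact: Ck_mul. Qed.

Lemma smooth_scale (c : R) f : smooth f -> smooth (fun x => c * f x).
Proof. by move=> sf; apply: smooth_mul => //; exact: smooth_cst. Qed.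

Lemma smooth_opp f : smooth f -> smooth (fun x => - f x).
Proof.
move=> /(smooth_scale (-1)); congr smooth; apply: funext => x; exact: mulN1r.
Qed.

Lemma smooth_sub f g : smooth f -> smooth g -> smooth (fun x => f x - g x).
Proof. by move=> sf sg; apply: smooth_add => //; exact: smooth_opp. Qed.

Lemma smooth_inv f : (forall x, f x != 0) -> smooth f -> smooth (fun x => (f x)^-1).
Proof. by move=> f0 sf k; exact: Ck_inv. Qed.

Lemma smooth_prod (J : Type) (s : seq J) (f : J -> V -> R) :
  (forall k, smooth (f k)) -> smooth (fun x => \prod_(k <- s) f k x).
Proof.
move=> sf; elim: s => [|k s IH].
  by have := smooth_cst 1; congr smooth; apply: funext => x; rewrite big_nil.
have := smooth_mul (sf k) IH; congr smooth; apply: funext => x; exact/esym/big_cons.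
Qed.

(* [i == j] as a direction in [R]: derivatives in a direction [evec R j] of a function
   of the [i]-th coordinate. *)
Lemma is_derive_coord (phi : R -> R) i j x (d : R) :
  is_derive (x ord0 i) 1 phi d ->
  is_derive x (evec R j) (fun y => phi (y ord0 i)) ((i == j)%:R * d).
Proof.
move=> [dphi vphi]; have [<-|ij] := eqVneq i j.
  rewrite mul1r; have E : (fun h : R => h^-1 *: (((fun y : V => phi (y ord0 i)) \o shift x) (h *: evec R i) - phi (x ord0 i)))
     = (fun h : R => h^-1 *: ((phi \o shift (x ord0 i)) (h *: (1 : R)) - phi (x ord0 i))).
    by apply: funext => h; rewrite /= !mxE !eqxx.
  by apply: DeriveDef; [rewrite /derivable E|rewrite /derive E].
rewrite mul0r; have E : (fun h : R => h^-1 *: (((fun y : V => phi (y ord0 i)) \o shift x) (h *: evec R j) - phi (x ord0 i)))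
     = (fun h : R => 0).
  by apply: funext => h; rewrite /= !mxE (negbTE ij) andbF mulr0 add0r subrr scaler0.
apply: DeriveDef; first by rewrite /derivable E; exact: is_cvg_cst.
by rewrite /derive E; exact: lim_cst.
Qed.

Lemma is_derive_coordE i j x : is_derive x (evec R j) (fun y : V => y ord0 i) (i == j)%:R.
Proof.
by have := is_derive_coord (phi := id) j (is_derive_id (x ord0 i) (1 : R)); rewrite mulr1.
Qed.

Lemma dpart_coord i j : dpart j (fun y : V => y ord0 i) = (fun=> (i == j)%:R).
Proof. by apply: funext => x; apply: dpart_val; exact: is_derive_coordE. Qed.

Lemma smooth_coord i : smooth (fun y : V => y ord0 i).
Proof.
case=> [|k]; (split; first by [move=> x; exact: coord_continuous]) => // j; split.
  by move=> x; exact: (is_derivable (is_derive_coordE _ _ _)).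
by rewrite dpart_coord; exact: Ck_cst.
Qed.

End Smooth.
Arguments smooth_cont {R n f} _.
Arguments smooth_derivable {R n f} i x _.
Arguments smooth_dpart {R n f} i _.
Arguments smooth_dparts {R n f} s _.

(** * The flat exponential *)

Section FlatExponential.
Variable R : realType.
Implicit Types (k : nat) (t : R).

(** The powers of 1/t make the family closed under differentiation up to linear combinations, so
    smoothness of all members follows by one induction. *)
Definition flatexp k t : R := if 0 < t then t^-1 ^+ k * expR (- t^-1) else 0.

Lemma flatexp_le0 k t : t <= 0 -> flatexp k t = 0.
Proof. by rewrite /flatexp ltNge => ->. Qed.

Lemma flatexp_gt0 k t : 0 < t -> 0 < flatexp k t.
Proof. by move=> t0; rewrite /flatexp t0 mulr_gt0 ?exprn_gt0 ?invr_gt0 ?expR_gt0. Qed.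

Lemma flatexp_ge0 k t : 0 <= flatexp k t.
Proof.
by have [t0|t0] := leP t 0; [rewrite flatexp_le0|apply/ltW/flatexp_gt0].
Qed.

(** From e^y >= y^(k+1)/(k+1)! at y = 1/t. A linear bound is enough, since the difference quotient
    at 0 is again a member of the family. *)
Lemma flatexp_lin k t : flatexp k t <= (k.+1)`!%:R * `|t|.
Proof.
have [t0|t0] := leP t 0; first by rewrite flatexp_le0// mulr_ge0.
rewrite gtr0_norm// /flatexp t0 expRN; set y := t^-1.
have y0 : 0 < y by rewrite invr_gt0.
have H : y ^+ k.+1 / (k.+1)`!%:R <= expR y.
  by apply: le_trans (expR_ge1Dxn k (ltW y0)); rewrite lerDr.
rewrite ler_pdivrMr ?expR_gt0// -[t]invrK -/y.
apply: le_trans (ler_wpM2l _ H); last by rewrite mulr_ge0// invr_ge0 ltW.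
have F0 : (k.+1)`!%:R != 0 :> R by rewrite pnatr_eq0 -lt0n fact_gt0.
rewrite exprS le_eqVlt; apply/orP; left; apply/eqP.
field.
by rewrite F0 gt_eqF.
Qed.

Lemma flatexp_cvg0 k : flatexp k t @[t --> (0 : R)] --> (0 : R).
Proof.
apply/cvgr0Pnorm_lt => e e0.
have e1 : 0 < e / (k.+1)`!%:R by rewrite divr_gt0// ltr0n fact_gt0.
apply/nbhs_normP; exists (e / (k.+1)`!%:R) => //= t; rewrite /ball_/= sub0r normrN => te.
rewrite ger0_norm ?flatexp_ge0//.
apply: le_lt_trans (flatexp_lin k t) _.
by rewrite mulrC -ltr_pdivlMr ?ltr0n ?fact_gt0.
Qed.

Lemma is_derive_flatexp k t : is_derive t 1 (flatexp k)
  (- k%:R * flatexp k.+1 t + flatexp k.+2 t).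
Proof.
have [t0|t0|->] := ltgtP t 0.
- rewrite !flatexp_le0 ?(ltW t0)// mulr0 addr0.
  apply: (@near_eq_is_derive _ _ _ (cst 0)).
  apply/nbhs_normP; exists (- t); rewrite /= ?oppr_gt0// => s.
  by rewrite /ball_/= ltr_distl => /andP[? ?]; rewrite flatexp_le0//; lra.
- have tn0 : t != 0 by rewrite gt_eqF.
  have dV : is_derive t 1 (fun s : R => s^-1) (- t ^- 2).
    have := @is_deriveV R id t 1 1 tn0 (is_derive_id t 1).
    by rewrite /GRing.scale/= mulr1.
  have dE : is_derive t 1 (fun s => expR (- s^-1)) (t ^- 2 * expR (- t^-1)).
    have := @is_derive1_comp R expR (fun s => - s^-1) t _ _ (is_derive_expR (- t^-1)) (is_deriveN dV).
    by rewrite opprK mulrC.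
  have dX : is_derive t 1 (fun s : R => s^-1 ^+ k) (- k%:R * t^-1 ^+ k.+1).
    elim: (k) => [|j IH]; first by rewrite oppr0 mul0r; exact: (@is_derive_cst R R^o R^o 1 t 1).
    rewrite (_ : (fun s : R => _) = (fun s => s^-1) * (fun s => s^-1 ^+ j)); last first.
      by apply: funext => s; rewrite exprS.
    apply: (is_derive_eq (is_deriveM dV IH)); rewrite /GRing.scale/= -exprVn [j.+1%:R]mulrS !exprS; ring.
  have H : is_derive t 1 (fun s => s^-1 ^+ k * expR (- s^-1))
      (- k%:R * flatexp k.+1 t + flatexp k.+2 t).
    apply: (is_derive_eq (is_deriveM dX dE)).
    rewrite /flatexp t0 -!exprVn /GRing.scale/= !exprS; ring.
  apply: near_eq_is_derive H; apply/nbhs_normP; exists t => //= s.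
  by rewrite /ball_/= ltr_distl => /andP[? ?]; rewrite /flatexp ifT//; lra.
(* At 0 the difference quotient of [flatexp k] is exactly [flatexp k.+1], which tends to 0. *)
- have E : (fun h : R => h^-1 *: ((flatexp k \o shift 0) (h *: 1) - flatexp k 0)) = flatexp k.+1.
    apply: funext => h; rewrite /= addr0 (@flatexp_le0 k 0)// subr0 /GRing.scale/= mulr1.
    rewrite /flatexp; case: ifP => _; last by rewrite mulr0.
    by rewrite exprS mulrA.
  rewrite !flatexp_le0// mulr0 addr0.
  have C : flatexp k.+1 h @[h --> 0^'] --> (0 : R).
    exact: cvg_trans (cvg_app _ (cvg_within _)) (flatexp_cvg0 k.+1).
  apply: DeriveDef; first by rewrite /derivable E; apply/cvg_ex; exists 0.
  by rewrite /derive E; apply/cvg_lim.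
Qed.

End FlatExponential.

(** * Smooth steps and bumps on cubes *)

Section Bumps.
Variables (R : realType) (n : nat).
Local Notation V := (Rn R n).
Implicit Types (f g : V -> R) (x c : V).

Lemma continuous_flatexp k : continuous (@flatexp R k).
Proof.
move=> t; apply: differentiable_continuous; apply/derivable1_diffP.
by have [] := is_derive_flatexp k t.
Qed.

Lemma smooth_flatexp k (a b : R) i : smooth (fun x : V => flatexp k (a * x ord0 i + b)).
Proof.
move=> N; elim: N k => [|N IH] k.
  split=> // x; apply: (continuous_comp (f := fun x : V => a * x ord0 i + b)).
    apply: smooth_cont; apply: smooth_add; last exact: smooth_cst.
    by apply: smooth_scale; exact: smooth_coord.
  exact: continuous_flatexp.
have D x j : is_derive x (evec R j) (fun x : V => flatexp k (a * x ord0 i + b))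
    ((i == j)%:R * (a * (- k%:R * flatexp k.+1 (a * x ord0 i + b)
       + flatexp k.+2 (a * x ord0 i + b)))).
  apply: (is_derive_coord (phi := fun t => flatexp k (a * t + b))).
  have dA : is_derive (x ord0 i) 1 (fun t : R => a * t + b) a.
    apply: (is_derive_eq (is_deriveD (is_deriveZ a (is_derive_id (x ord0 i) 1))
      (@is_derive_cst R R^o R^o b _ 1))).
    by rewrite addr0 /GRing.scale/= mulr1.
  have := @is_derive1_comp R (flatexp k) (fun t => a * t + b) (x ord0 i) _ _
    (is_derive_flatexp k (a * x ord0 i + b)) dA.
  by rewrite mulrC.
split.
  exact: (Ck_cont (IH k)).
move=> j; split; first by move=> x; exact: (is_derivable (D x j)).
have -> : dpart j (fun x : V => flatexp k (a * x ord0 i + b)) =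
   (fun x => (i == j)%:R * (a * (- k%:R * flatexp k.+1 (a * x ord0 i + b)
       + flatexp k.+2 (a * x ord0 i + b)))).
  by apply: funext => x; exact: dpart_val (D x j).
apply: Ck_mul; first exact: Ck_cst.
apply: Ck_mul; first exact: Ck_cst.
by apply: Ck_add => //; apply: Ck_mul => //; exact: Ck_cst.
Qed.

Definition step01 (t : R) : R := flatexp 0 t / (flatexp 0 t + flatexp 0 (1 - t)).

Lemma step01_den (t : R) : 0 < flatexp 0 t + flatexp 0 (1 - t).
Proof.
have [t0|t0] := leP t 0.
  by rewrite ltr_wpDl ?flatexp_ge0// flatexp_gt0; lra.
by rewrite ltr_pwDl ?flatexp_ge0// flatexp_gt0.
Qed.

Lemma step01_ge0 t : 0 <= step01 t.
Proof. by rewrite divr_ge0 ?flatexp_ge0// ltW// step01_den. Qed.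

Lemma step01_le1 t : step01 t <= 1.
Proof. by rewrite ler_pdivrMr ?step01_den// mul1r lerDl flatexp_ge0. Qed.

Lemma step01_eq0 t : t <= 0 -> step01 t = 0.
Proof. by move=> t0; rewrite /step01 flatexp_le0// mul0r. Qed.

Lemma step01_eq1 t : 1 <= t -> step01 t = 1.
Proof.
move=> t1; have := step01_den t; rewrite /step01 (@flatexp_le0 _ 0 (1 - t)); last by lra.
by rewrite addr0 => t0; rewrite divff// gt_eqF.
Qed.

Lemma smooth_step01 (a b : R) i : smooth (fun x : V => step01 (a * x ord0 i + b)).
Proof.
have S1 := @smooth_flatexp 0 a b i; have S2 := @smooth_flatexp 0 (- a) (1 - b) i.
have -> : (fun x : V => step01 (a * x ord0 i + b)) = (fun x : V => flatexp 0 (a * x ord0 i + b)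
   * (flatexp 0 (a * x ord0 i + b) + flatexp 0 (- a * x ord0 i + (1 - b)))^-1).
  apply: funext => x; rewrite /step01.
  by have -> : - a * x ord0 i + (1 - b) = 1 - (a * x ord0 i + b) by ring.
apply: smooth_mul => //; apply: smooth_inv; last exact: smooth_add.
move=> x; have := step01_den (a * x ord0 i + b).
have -> : 1 - (a * x ord0 i + b) = - a * x ord0 i + (1 - b) by ring.
by move=> ?; rewrite gt_eqF.
Qed.

Definition boxbump c (r1 r2 : R) x : R :=
  \prod_(i < n) (step01 ((r2 - (x ord0 i - c ord0 i)) / (r2 - r1)) *
                 step01 ((r2 + (x ord0 i - c ord0 i)) / (r2 - r1))).

Lemma smooth_boxbump c r1 r2 : smooth (boxbump c r1 r2).
Proof.
apply: smooth_prod => i; apply: smooth_mul.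
  have := smooth_step01 (- (r2 - r1)^-1) ((r2 + c ord0 i) / (r2 - r1)) i.
  by congr smooth; apply: funext => x; congr step01; ring.
have := smooth_step01 ((r2 - r1)^-1) ((r2 - c ord0 i) / (r2 - r1)) i.
by congr smooth; apply: funext => x; congr step01; ring.
Qed.

Lemma boxbump_ge0 c r1 r2 x : 0 <= boxbump c r1 r2 x.
Proof. by apply: prodr_ge0 => i _; rewrite mulr_ge0 ?step01_ge0. Qed.

Lemma boxbump_le1 c r1 r2 x : boxbump c r1 r2 x <= 1.
Proof.
apply: prodr_ile1 => i _; rewrite mulr_ge0 ?step01_ge0//=.
by rewrite mulr_ile1 ?step01_ge0 ?step01_le1.
Qed.

Lemma boxbump_eq1 c r1 r2 x : r1 < r2 -> `|x - c| <= r1 -> boxbump c r1 r2 x = 1.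
Proof.
move=> r12 xc; rewrite /boxbump big1// => i _.
have : `|x ord0 i - c ord0 i| <= r1.
  by apply: le_trans xc; have := ler_coord_norm (x - c) i; rewrite !mxE.
rewrite ler_norml => /andP[h1 h2].
by rewrite !step01_eq1 ?mulr1// ler_pdivlMr ?subr_gt0//; lra.
Qed.

Lemma boxbump_eq0 c r1 r2 x : 0 < r2 -> r1 < r2 -> r2 <= `|x - c| -> boxbump c r1 r2 x = 0.
Proof.
move=> r20 r12 xc.
have [i xi] : exists i, r2 <= `|x ord0 i - c ord0 i|.
  apply: contrapT => H; have : `|x - c| < r2; last by rewrite ltNge xc.
  apply: rV_norm_lt => // i; rewrite ltNge !mxE; apply/negP => xi; apply: H; by exists i.
rewrite /boxbump (bigD1 i)//=; suff -> : forall u v w : R, u = 0 \/ v = 0 -> u * v * w = 0.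
- by [].
- have := xi; rewrite ler_normr => /orP[h|h]; [left|right].
    by apply: step01_eq0; rewrite pmulr_lle0 ?invr_gt0 ?subr_gt0//; lra.
  by apply: step01_eq0; rewrite pmulr_lle0 ?invr_gt0 ?subr_gt0//; lra.
- by move=> u v w [->|->]; rewrite ?mulr0 ?mul0r.
Qed.

End Bumps.

(** * Test functions and smooth cutoffs *)

Section CompactSupport.
Variables (R : realType) (n : nat).
Local Notation V := (Rn R n).
Implicit Types (f g : V -> R) (x c : V) (O K : set V).

Lemma fsupp_closed f : closed (fsupp f).
Proof. exact: closed_closure. Qed.

Lemma fsupp_out f x : ~ fsupp f x -> f x = 0.
Proof.
by move=> xf; apply: contrapT => /eqP fx; apply: xf; apply: subset_closure.
Qed.

Lemma fsupp_sub f (A : set V) : closed A -> (forall x, ~ A x -> f x = 0) -> fsupp f `<=` A.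
Proof.
move=> cA fA x fx; apply: cA => B /fx[y [/= fy By]]; exists y; split=> //.
by apply: contrapT => /fA; exact/eqP.
Qed.

Lemma Cc_intro O f (A : set V) : smooth f -> compact A -> A `<=` O ->
  (forall x, ~ A x -> f x = 0) -> Cc_inf O f.
Proof.
move=> /smoothP[df cf] kA AO fA.
have cA : closed A by apply: compact_closed => //; exact: norm_hausdorff.
have fS := fsupp_sub cA fA; split=> //; split=> //; split.
  exact: subclosed_compact (@fsupp_closed f) kA fS.
exact: subset_trans fS AO.
Qed.

Lemma Cc_smooth O f : Cc_inf O f -> smooth f.
Proof. by case=> ? [? _]; exact/smoothP. Qed.

Lemma Cc_compact O f : Cc_inf O f -> compact (fsupp f).
Proof. by case=> ? [? []]. Qed.

Lemma Cc_supp O f : Cc_inf O f -> fsupp f `<=` O.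
Proof. by case=> ? [? []]. Qed.

Lemma Cc_sub O O' f : O `<=` O' -> Cc_inf O f -> Cc_inf O' f.
Proof. by move=> OO' [? [? [? fO]]]; do 3 split=> //; exact: subset_trans OO'. Qed.

Lemma Cc_mul O f g : smooth g -> Cc_inf O f -> Cc_inf O (fun x => f x * g x).
Proof.
move=> sg Cf; apply: Cc_intro (Cc_compact Cf) (Cc_supp Cf) _.
  by apply: smooth_mul => //; exact: Cc_smooth Cf.
by move=> x /fsupp_out ->; rewrite mul0r.
Qed.

Lemma Cc_mull O f g : smooth g -> Cc_inf O f -> Cc_inf O (fun x => g x * f x).
Proof.
by move=> sg /(Cc_mul sg); congr Cc_inf; apply: funext => x; rewrite mulrC.
Qed.

Lemma Cc_lin O (a : R) f g : Cc_inf O f -> Cc_inf O g -> Cc_inf O (fun x => a * f x + g x).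
Proof.
move=> Cf Cg; apply: (@Cc_intro _ _ (fsupp f `|` fsupp g)).
- by apply: smooth_add (Cc_smooth Cg); apply: smooth_scale; exact: Cc_smooth Cf.
- by apply: compactU; [exact: Cc_compact Cf|exact: Cc_compact Cg].
- by rewrite subUset; split; [exact: Cc_supp|exact: Cc_supp].
- by move=> x /not_orP[/fsupp_out -> /fsupp_out ->]; rewrite mulr0 addr0.
Qed.

Lemma Cc0 O : Cc_inf O (fun=> 0).
Proof. by apply: (@Cc_intro _ _ set0) => //; [exact: smooth_cst|exact: compact0]. Qed.

Lemma Cc_add O f g : Cc_inf O f -> Cc_inf O g -> Cc_inf O (fun x => f x + g x).
Proof.
by move=> Cf /(Cc_lin 1 Cf); congr Cc_inf; apply: funext => x; rewrite mul1r.
Qed.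

Lemma Cc_scale O (a : R) f : Cc_inf O f -> Cc_inf O (fun x => a * f x).
Proof. by apply: Cc_mull; exact: smooth_cst. Qed.

Lemma Cc_sub2 O f g : Cc_inf O f -> Cc_inf O g -> Cc_inf O (fun x => f x - g x).
Proof.
by move=> Cf Cg; have := Cc_lin (-1) Cg Cf; congr Cc_inf; apply: funext => x; ring.
Qed.

Lemma Cc_sum O (J : Type) (s : seq J) (f : J -> V -> R) :
  (forall k, Cc_inf O (f k)) -> Cc_inf O (fun x => \sum_(k <- s) f k x).
Proof.
move=> Cf; elim: s => [|k s IH].
  by have := Cc0 O; congr Cc_inf; apply: funext => x; rewrite big_nil.
have := Cc_add (Cf k) IH; congr Cc_inf; apply: funext => x; exact/esym/big_cons.
Qed.

Lemma dpart_out f i x : ~ fsupp f x -> dpart i f x = 0.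
Proof.
move=> xf; rewrite /dpart (@near_eq_derive _ _ _ _ (cst 0)); first exact: derive_cst.
have oC : open (~` fsupp f) by apply: closed_openC; exact: fsupp_closed.
have := open_nbhs_nbhs (conj oC xf); apply: filterS => y; exact: fsupp_out.
Qed.

Lemma Cc_dpart O f i : Cc_inf O f -> Cc_inf O (dpart i f).
Proof.
move=> Cf; apply: Cc_intro (Cc_compact Cf) (Cc_supp Cf) _.
  exact/smooth_dpart/(Cc_smooth Cf).
by move=> x; exact: dpart_out.
Qed.

Lemma Cc_bounded O f : Cc_inf O f -> exists2 M : R, 0 < M & forall x, `|f x| <= M.
Proof.
move=> Cf; have cf := smooth_cont (Cc_smooth Cf).
have /compact_bounded[M [Mr HM]] : compact (f @` fsupp f).
  apply: continuous_compact (Cc_compact Cf) => x.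
  exact: continuous_subspaceT cf x.
exists (`|M| + 1); first by rewrite ltr_wpDl.
move=> x; have [xf|xf] := pselect (fsupp f x); last by rewrite fsupp_out// normr0 addr_ge0.
by apply: (HM (`|M| + 1)); [rewrite (le_lt_trans (ler_norm M))// ltrDl|exists x].
Qed.

Lemma continuous_dist c : continuous (fun x : V => `|x - c|).
Proof.
move=> x; apply: (@continuous_comp _ _ _ (fun y : V => y - c) (fun y => `|y|)).
  exact: (cvgB cvg_id (cvg_cst _)).
exact: norm_continuous.
Qed.

Lemma compact_cball c (r : R) : compact [set x | `|x - c| <= r].
Proof.
apply: bounded_closed_compact.
  exists (`|c| + r); split=> [|M cM x /= xc]; first exact: num_real.
  by rewrite -(subrK c x) (le_trans (ler_normD _ _))//; lra.
have -> : [set x | `|x - c| <= r] = (fun x => `|x - c|) @^-1` [set t | t <= r] by [].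
by apply: preimage_closed (@closed_le R r) => x _; exact: continuous_dist.
Qed.

Lemma open_ballr c (r : R) : open [set x | `|x - c| < r].
Proof.
have -> : [set x | `|x - c| < r] = (fun x => `|x - c|) @^-1` [set t | t < r] by [].
by apply: open_comp (@open_lt R r) => x _; exact: continuous_dist.
Qed.

Lemma compact_finite_cover K (r : V -> R) : compact K -> (forall x, K x -> 0 < r x) ->
  exists s : seq V, (forall c, c \in s -> K c) /\
    forall x, K x -> exists2 c, c \in s & `|x - c| < r c.
Proof.
rewrite compact_cover => kK r0.
have [||s sK Ks] := kK V K (fun c => [set x | `|x - c| < r c]).
- by move=> c _; exact: open_ballr.
- by move=> x Kx; exists x => //=; rewrite subrr normr0 r0.
exists (finmap.enum_fset s); split=> [c /sK|x /Ks[c /= cs xc]]; first by rewrite inE.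
by exists c.
Qed.

Lemma open_ball_sub O x : open O -> O x ->
  exists2 r : R, 0 < r & forall y, `|y - x| <= r -> O y.
Proof.
move=> oO Ox; have /nbhs_normP[e /= e0 He] : nbhs x O by exact: open_nbhs_nbhs.
exists (e / 2); first by rewrite divr_gt0.
by move=> y yx; apply: He; rewrite /ball_/= distrC (le_lt_trans yx)//; lra.
Qed.

Lemma prod1B_ge0 (s : seq V) (b : V -> V -> R) x : (forall c x, 0 <= b c x <= 1) ->
  0 <= \prod_(c <- s) (1 - b c x) <= 1.
Proof.
move=> b01; have H c : 0 <= 1 - b c x <= 1 by have /andP[] := b01 c x; lra.
by rewrite prodr_ge0 ?prodr_ile1//= => c _; have /andP[] := H c.
Qed.

Lemma prod1B_eq0 (s : seq V) (b : V -> V -> R) x c : c \in s -> b c x = 1 ->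
  \prod_(d <- s) (1 - b d x) = 0.
Proof.
by move=> cs bc; apply/eqP; rewrite prodf_seq_eq0; apply/hasP; exists c => //=; rewrite bc subrr.
Qed.

(** Bumps are glued as 1 - prod (1 - b_c), which is 1 where any bump is 1 and 0 where all vanish.
    The value 1 on a whole neighbourhood [W] is what the defining identity of J and K requires of a
    locally constant function. *)
Lemma cutoff_exists K O : compact K -> open O -> K `<=` O ->
  exists chi : V -> R, [/\ Cc_inf O chi, forall x, 0 <= chi x <= 1 &
    exists W, [/\ open W, K `<=` W & forall x, W x -> chi x = 1]].
Proof.
move=> kK oO KO.
have exr x : exists r : R, K x -> 0 < r /\ forall y, `|y - x| <= r -> O y.
  have [/KO Ox|nK] := pselect (K x); last by exists 1.
  by have [r r0 Hr] := open_ball_sub oO Ox; exists r.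
pose r x := projT1 (cid (exr x)).
have r0 x : K x -> 0 < r x by rewrite /r; case: cid => /= q H /H[].
have rO x y : K x -> `|y - x| <= r x -> O y.
  by rewrite /r; case: cid => /= q H /H[_]; exact.
have [s [sK Ks]] := compact_finite_cover kK (fun x Kx => divr_gt0 (r0 x Kx) (ltr0n R 2)).
pose b c x := boxbump c (r c / 2) (r c) x.
have b01 c x : 0 <= b c x <= 1 by rewrite boxbump_ge0 boxbump_le1.
have r2 c : c \in s -> r c / 2 < r c by move=> /sK/r0; lra.
exists (fun x => 1 - \prod_(c <- s) (1 - b c x)); split.
- pose A := \bigcup_(c in [set` s]) [set x | `|x - c| <= r c].
  apply: (@Cc_intro _ _ A).
  + apply: smooth_sub; first exact: smooth_cst.
    apply: (@smooth_prod _ _ V s (fun c x => 1 - b c x)) => c.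
    apply: smooth_sub; [exact: smooth_cst|exact: smooth_boxbump].
  + by rewrite /A bigcup_seq; apply: bigsetU_compact => c _; exact: compact_cball.
  + by move=> x [c /= cs xc]; exact: rO (sK _ cs) xc.
  + move=> x xA; rewrite big1_seq ?subrr// => c /andP[_ cs].
    rewrite /b boxbump_eq0 ?subr0//; [exact/r0/sK|exact: r2|].
    by rewrite leNgt; apply/negP => /ltW xc; apply: xA; exists c.
- by move=> x; have /andP[] := prod1B_ge0 s x b01; lra.
- exists (\bigcup_(c in [set` s]) [set x | `|x - c| < r c / 2]); split.
  + by apply: bigcup_open => c _; exact: open_ballr.
  + by move=> x /Ks[c cs xc]; exists c.
  + move=> x [c /= cs xc]; rewrite (prod1B_eq0 cs) ?subr0//.
    by rewrite /b boxbump_eq1 ?r2// ltW.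
Qed.

End CompactSupport.

(** * Partitions of unity of small mesh *)

Section Partition.
Variables (R : realType) (n : nat).
Local Notation V := (Rn R n).

Lemma sum_prod1B (psi : nat -> R) N :
  \sum_(l < N) psi l * \prod_(k < l) (1 - psi k) = 1 - \prod_(k < N) (1 - psi k).
Proof.
elim: N => [|N IH]; first by rewrite !big_ord0 subrr.
by rewrite !big_ord_recr/= IH; ring.
Qed.

(** [phi' l] is 1 near the support of [phi l], so that 1 - phi'_l and phi_l have disjoint supports,
    while phi'_l(x) phi_l(y) lives within distance [e] of the diagonal. *)
Lemma partition_exists (K : set V) (e : R) : compact K -> 0 < e ->
  exists (N : nat) (phi phi' : 'I_N -> V -> R),
    [/\ forall l, smooth (phi l) /\ smooth (phi' l),
        forall l x, 0 <= phi l x /\ 0 <= phi' l x <= 1,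
        forall x, \sum_l phi l x <= 1 /\ (K x -> \sum_l phi l x = 1),
        forall l, exists W, [/\ open W, fsupp (phi l) `<=` W & forall x, W x -> phi' l x = 1] &
        forall l x y, phi l y != 0 -> phi' l x != 0 -> `|x - y| <= e].
Proof.
(* [phi l] lives in the ball of radius 2r and [phi' l] in the one of radius 4r around the same
   centre, so the distances add up to 6r = e. *)
move=> kK e0; pose r := e / 6; have r0 : 0 < r by rewrite divr_gt0.
have [s [sK Ks]] := @compact_finite_cover _ _ K (fun=> r) kK (fun _ _ => r0).
pose c (l : nat) : V := nth 0 s l.
pose psi l x := boxbump (c l) r (2 * r) x.
have r12 : r < 2 * r by lra.
have r34 : 3 * r < 4 * r by lra.
have psi01 l x : 0 <= psi l x <= 1 by rewrite boxbump_ge0 boxbump_le1.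
have psi01' l x : 0 <= 1 - psi l x <= 1 by have /andP[] := psi01 l x; lra.
have P01 (A : seq nat) x : 0 <= \prod_(k <- A) (1 - psi k x) <= 1.
  by rewrite prodr_ge0 ?prodr_ile1//= => l _; have /andP[] := psi01' l x.
have out l x : 2 * r < `|x - c l| -> psi l x = 0.
  by move=> H; rewrite /psi boxbump_eq0 ?ltW//; lra.
pose phi l x := psi l x * \prod_(k < l) (1 - psi k x).
have out' l x : phi l x != 0 -> `|x - c l| <= 2 * r.
  by apply: contraNT; rewrite -ltNge => /out; rewrite /phi => ->; rewrite mul0r.
exists (size s), (fun l => phi l), (fun l => boxbump (c l) (3 * r) (4 * r)); split.
- move=> l; split; last exact: smooth_boxbump.
  apply: smooth_mul; first exact: smooth_boxbump.
  apply: (@smooth_prod _ _ 'I_l (index_enum _) (fun (k : 'I_l) x => 1 - psi k x)) => k.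
  by apply: smooth_sub; [exact: smooth_cst|exact: smooth_boxbump].
- move=> l x; rewrite boxbump_ge0 boxbump_le1; split=> //.
  rewrite mulr_ge0 ?boxbump_ge0// prodr_ge0// => k _.
  by have /andP[] := psi01' k x.
- move=> x; rewrite (sum_prod1B (fun l => psi l x)); split.
    have : 0 <= \prod_(k < size s) (1 - psi k x).
      by apply: prodr_ge0 => k _; have /andP[] := psi01' k x.
    lra.
  move=> /Ks[d ds xd]; have ls : (index d s < size s)%N by rewrite index_mem.
  rewrite (bigD1 (Ordinal ls))//= /psi boxbump_eq1 ?subrr ?mul0r ?subr0//.
  by rewrite /c nth_index// ltW.
- move=> l; exists [set x | `|x - c l| < 3 * r]; split; first exact: open_ballr.
    apply: (@subset_trans _ [set x | `|x - c l| <= 2 * r]); last by move=> x /=; lra.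
    apply: fsupp_sub.
      by apply: compact_closed; [exact: norm_hausdorff|exact: compact_cball].
    by move=> x xc; apply: contrapT => /eqP/out'.
  by move=> x /= xc; rewrite boxbump_eq1// ltW.
- move=> l x y /out' yl xl.
  have xc : `|x - c l| < 4 * r.
    by apply: contraNT xl; rewrite -leNgt => H; rewrite boxbump_eq0//; lra.
  rewrite (_ : x - y = (x - c l) - (y - c l)); last by rewrite opprB addrA subrK.
  by apply: le_trans (ler_normB _ _) _; rewrite /r in xc yl *; lra.
Qed.

End Partition.

(** * Mean value bounds and symmetry of second derivatives *)

Section Taylor.
Variables (R : realType) (n : nat).
Local Notation V := (Rn R n).
Implicit Types (f g u : V -> R) (x y : V).

Lemma is_derive_slice f x i (t : R) : derivable f (x + t *: evec R i) (evec R i) ->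
  is_derive t 1 (fun s : R => f (x + s *: evec R i)) (dpart i f (x + t *: evec R i)).
Proof.
move=> df; have E : (fun h : R => h^-1 *: (((fun s : R => f (x + s *: evec R i)) \o shift t) (h *: (1 : R)) - f (x + t *: evec R i)))
  = (fun h : R => h^-1 *: ((f \o shift (x + t *: evec R i)) (h *: evec R i) - f (x + t *: evec R i))).
  apply: funext => h /=; congr (_ *: (f _ - _)).
  by rewrite /GRing.scale/= mulr1 -/(GRing.scale _ _) scalerDl addrCA addrA.
by apply: DeriveDef; [rewrite /derivable E|rewrite /derive E].
Qed.

Lemma mvt_coord f i x (h : R) : (forall x, derivable f x (evec R i)) ->
  exists2 xi : R, `|xi| <= `|h| & f (x + h *: evec R i) - f x = h * dpart i f (x + xi *: evec R i).
Proof.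
move=> df; pose g (s : R) := f (x + s *: evec R i).
have dg (s : R) : is_derive s 1 g (dpart i f (x + s *: evec R i)) by exact: is_derive_slice.
have cg : continuous g.
  by move=> s; apply/differentiable_continuous/derivable1_diffP; have [] := dg s.
have g0 : g 0 = f x by rewrite /g scale0r addr0.
have [h0|h0] := leP 0 h.
  have [xi] := MVT_segment h0 (fun s _ => dg s) (continuous_subspaceT cg).
  rewrite in_itv/= => /andP[x0 xh] E; exists xi; first by rewrite !ger0_norm.
  by rewrite -g0 -/(g h) E subr0 mulrC.
have [xi] := MVT_segment (ltW h0) (fun s _ => dg s) (continuous_subspaceT cg).
rewrite in_itv/= => /andP[x0 xh] E; exists xi; first by rewrite !ler0_norm ?lerN2// ltW.
by rewrite -g0 -/(g h) -opprB E; ring.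
Qed.

Definition mixrow x y (k : nat) : V := \row_j (if (j < k)%N then x ord0 j else y ord0 j).

Lemma mixrowS x y (k : 'I_n) :
  mixrow x y k.+1 = mixrow x y k + (x ord0 k - y ord0 k) *: evec R k.
Proof.
apply/rowP => j; rewrite !mxE eqxx/= ltnS.
have [->|jk] := eqVneq j k; first by rewrite leqnn ltnn/=; ring.
by rewrite leq_eqVlt (inj_eq val_inj) (negbTE jk)/= mulr0 addr0.
Qed.

(* Telescoping along the coordinate path from [y] to [x], which stays in the box of
   radius [|x - y|] around [y]. *)
Lemma box_lipschitz f x y (M : R) : (forall i z, derivable f z (evec R i)) -> 0 <= M ->
  (forall i z, `|z - y| <= `|x - y| -> `|dpart i f z| <= M) ->
  `|f x - f y| <= n%:R * M * `|x - y|.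
Proof.
move=> df M0 HM.
have step k : (k <= n)%N -> `|f (mixrow x y k) - f y| <= k%:R * M * `|x - y|.
  elim: k => [_|k IH kn].
    rewrite (_ : mixrow x y 0 = y) ?subrr ?normr0 ?mul0r//.
    by apply/rowP => j; rewrite mxE ltn0.
  pose i := Ordinal kn; rewrite (mixrowS x y i) /=.
  have [xi xih E] := mvt_coord (mixrow x y k) (x ord0 i - y ord0 i) (df i).
  have hn : `|x ord0 i - y ord0 i| <= `|x - y|.
    by have := ler_coord_norm (x - y) i; rewrite !mxE.
  have -> : f (mixrow x y k + (x ord0 i - y ord0 i) *: evec R i) - f y =
    (x ord0 i - y ord0 i) * dpart i f (mixrow x y k + xi *: evec R i) +
    (f (mixrow x y k) - f y) by rewrite -E; ring.
  apply: le_trans (ler_normD _ _) _.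
  have -> : k.+1%:R * M * `|x - y| = `|x - y| * M + k%:R * M * `|x - y|.
    by rewrite -natr1; ring.
  apply: lerD; last by apply: IH; exact: ltnW.
  rewrite normrM ler_pM// HM// rV_norm_le// => j; rewrite !mxE eqxx/=.
  have hj : `|x ord0 j - y ord0 j| <= `|x - y|.
    by have := ler_coord_norm (x - y) j; rewrite !mxE.
  have [->|ji] := eqVneq j i.
    rewrite ltnn mulr1 addrAC subrr add0r; exact: le_trans xih hn.
  rewrite mulr0 addr0; case: ifP => // _; by rewrite subrr normr0.
have := step n (leqnn n); congr (`|f _ - _| <= _).
by apply/rowP => j; rewrite mxE ltn_ord.
Qed.

(** One integration raises the order of vanishing at [y] by one. Iterating this over the partial
    derivatives gives the Taylor remainders below without integrating along segments. *)
Lemma growth_le f y (M : R) p : (forall i z, derivable f z (evec R i)) -> 0 <= M ->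
  f y = 0 -> (forall i z, `|dpart i f z| <= M * `|z - y| ^+ p) ->
  forall x, `|f x| <= n%:R * M * `|x - y| ^+ p.+1.
Proof.
move=> df M0 fy HM x; rewrite -[f x]subr0 -fy exprSr mulrA -[_ * M * _]mulrA.
apply: box_lipschitz => //; first by rewrite mulr_ge0// exprn_ge0.
move=> i z zx; apply: le_trans (HM i z) _.
by rewrite ler_wpM2l// lerXn2r// nnegrE.
Qed.

(* Two applications of the mean value theorem to the mixed second difference. *)
Lemma mixed_difference u x i j (h : R) : smooth u -> exists2 z, `|z - x| <= 2 * `|h| &
  u (x + h *: evec R i + h *: evec R j) - u (x + h *: evec R i) - u (x + h *: evec R j) + u x
  = h * h * dpart j (dpart i u) z.
Proof.
move=> su; pose f y := u (y + h *: evec R j) - u y.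
have dshift y : is_derive y (evec R i) (fun z => u (z + h *: evec R j)) (dpart i u (y + h *: evec R j)).
  have df := smooth_derivable i (y + h *: evec R j) su.
  have E : (fun t : R => t^-1 *: (((fun z => u (z + h *: evec R j)) \o shift y) (t *: evec R i) - u (y + h *: evec R j)))
    = (fun t : R => t^-1 *: ((u \o shift (y + h *: evec R j)) (t *: evec R i) - u (y + h *: evec R j))).
    by apply: funext => t /=; rewrite addrA.
  by apply: DeriveDef; [rewrite /derivable E|rewrite /derive E].
have dfy y : is_derive y (evec R i) f (dpart i u (y + h *: evec R j) - dpart i u y).
  by apply: is_deriveB; apply: is_dpart; exact: smooth_derivable.
have [xi xih E] := mvt_coord x h (fun y => is_derivable (dfy y)).
have [eta etah E'] := mvt_coord (x + xi *: evec R i) h (fun y => smooth_derivable j y (smooth_dpart i su)).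
exists (x + xi *: evec R i + eta *: evec R j).
  rewrite addrAC [x + _]addrC addrK; apply: le_trans (ler_normD _ _) _.
  have ev (k : 'I_n) (t : R) : `|t *: evec R k| <= `|t|.
    rewrite normrZ ler_piMr// rV_norm_le// => l; rewrite mxE eqxx/=.
    by case: (l == k); rewrite ?normr1 ?normr0.
  have := ev i xi; have := ev j eta; lra.
rewrite -mulrA -E' -(dpart_val (dfy (x + xi *: evec R i))) -E /f.
ring.
Qed.

(** [D h] divided by h^2 is a value of [P] and also a value of [Q], both taken near [x]; one [h]
    below the two continuity radii suffices. *)
Lemma eq_near_values (P Q : V -> R) (D : R -> R) x :
  {for x, continuous P} -> {for x, continuous Q} ->
  (forall h, exists2 z, `|z - x| <= 2 * `|h| & D h = h * h * P z) ->
  (forall h, exists2 z, `|z - x| <= 2 * `|h| & D h = h * h * Q z) -> P x = Q x.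
Proof.
move=> cP cQ HP HQ; apply/eqP; rewrite -subr_eq0 -normr_le0.
apply/ler_addgt0Pr => e e0; rewrite add0r.
have e2 : 0 < e / 2 by rewrite divr_gt0.
have cont (F : V -> R) : {for x, continuous F} -> exists2 r : R, 0 < r &
    forall z, `|z - x| < r -> `|F z - F x| < e / 2.
  move=> /cvgrPdist_lt/(_ _ e2)/nbhs_normP[r /= r0 Hr].
  by exists r => // z zx; rewrite distrC; apply: Hr; rewrite /ball_/= distrC.
have [r1 r10 H1] := cont _ cP; have [r2 r20 H2] := cont _ cQ.
pose h := Num.min r1 r2 / 3; have h0 : 0 < h by rewrite divr_gt0// lt_min r10.
have [hr1 hr2] : 2 * `|h| < r1 /\ 2 * `|h| < r2.
  have : Num.min r1 r2 <= r1 /\ Num.min r1 r2 <= r2 by rewrite !ge_min !lexx orbT.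
  have m0 : 0 < Num.min r1 r2 by rewrite lt_min r10.
  by rewrite gtr0_norm// /h => -[? ?]; split; lra.
have [z1 zh1 E1] := HP h; have [z2 zh2 E2] := HQ h.
have E : P z1 = Q z2.
  have hh : h * h != 0 by rewrite mulf_neq0 ?gt_eqF.
  by apply: (mulfI hh); rewrite -E1 -E2.
have := H1 z1 (le_lt_trans zh1 hr1); rewrite E distrC => K1.
have K2 := H2 z2 (le_lt_trans zh2 hr2).
apply: le_trans (ler_distD (Q z2) _ _) _.
by rewrite [leRHS](splitr e) lerD// ltW.
Qed.

Lemma dpartC u i j : smooth u -> dpart j (dpart i u) = dpart i (dpart j u).
Proof.
move=> su; apply: funext => x.
apply: (@eq_near_values _ _ (fun h => u (x + h *: evec R i + h *: evec R j)
  - u (x + h *: evec R i) - u (x + h *: evec R j) + u x)).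
- exact: (smooth_cont (smooth_dpart j (smooth_dpart i su))).
- exact: (smooth_cont (smooth_dpart i (smooth_dpart j su))).
- by move=> h; exact: mixed_difference.
- move=> h; have [z zx E] := mixed_difference x j i h su; exists z => //.
  by rewrite -E (addrAC x) (addrAC (u _)).
Qed.

End Taylor.

(** * Taylor polynomials of order one and two *)

Section TaylorRemainder.
Variables (R : realType) (n : nat).
Local Notation V := (Rn R n).
Implicit Types (f g u : V -> R) (x y : V).

Lemma is_derive_sumf (J : Type) (s : seq J) (h : J -> V -> R) (dh : J -> R) x v :
  (forall k, is_derive x v (h k) (dh k)) ->
  is_derive x v (fun y => \sum_(k <- s) h k y) (\sum_(k <- s) dh k).
Proof.
move=> H; elim: s => [|k s IH].
  rewrite big_nil (_ : (fun y => _) = (fun=> 0)); first exact: is_derive_cstf.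
  by apply: funext => y; rewrite big_nil.
rewrite big_cons (_ : (fun y => _) = (fun y => h k y + \sum_(k <- s) h k y)).
  exact: is_derive_addf.
by apply: funext => z; rewrite big_cons.
Qed.

Lemma is_derive_shiftcoord (c : R) i k x :
  is_derive x (evec R k) (fun z : V => z ord0 i - c) (i == k)%:R.
Proof.
have := is_derive_addf (is_derive_coordE i k x) (is_derive_cstf (- c) x (evec R k)).
by rewrite addr0.
Qed.

Lemma is_derive_scalef (c : R) f x v d : is_derive x v f d ->
  is_derive x v (fun z => c * f z) (c * d).
Proof.
by move=> /(is_derive_mulf (is_derive_cstf c x v)); rewrite mulr0 addr0.
Qed.

Lemma sum_delta (k : 'I_n) (F : 'I_n -> R) : \sum_i F i * (i == k)%:R = F k.
Proof.
rewrite (bigD1 k)//= eqxx mulr1 big1 ?addr0// => i ik.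
by rewrite (negbTE ik) mulr0.
Qed.

Definition taylor1 u y x : R := u y + \sum_(i < n) dpart i u y * (x ord0 i - y ord0 i).

Definition taylor2 u y x : R := taylor1 u y x +
  2^-1 * \sum_(i < n) \sum_(j < n)
    dpart j (dpart i u) y * ((x ord0 i - y ord0 i) * (x ord0 j - y ord0 j)).

Lemma is_derive_taylor1 u y k z : is_derive z (evec R k) (taylor1 u y) (dpart k u y).
Proof.
have -> : dpart k u y = 0 + \sum_(i < n) dpart i u y * (i == k)%:R.
  by rewrite add0r sum_delta.
apply: (is_derive_addf (is_derive_cstf (u y) z (evec R k))).
by apply: is_derive_sumf => i; apply: is_derive_scalef; exact: is_derive_shiftcoord.
Qed.

(** The derivative of the quadratic part gives two sums, equal by symmetry of second derivatives,
    which cancels the factor 1/2. The second order remainder thus reduces to the first order one of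
    the partial derivatives. *)
Lemma is_derive_taylor2 u y k z : smooth u ->
  is_derive z (evec R k) (taylor2 u y) (taylor1 (dpart k u) y z).
Proof.
move=> su; have -> : taylor1 (dpart k u) y z = dpart k u y + 2^-1 *
    \sum_(i < n) \sum_(j < n) dpart j (dpart i u) y *
      ((z ord0 i - y ord0 i) * (j == k)%:R + (z ord0 j - y ord0 j) * (i == k)%:R).
  rewrite /taylor1; congr (_ + _).
  have E1 : \sum_(i < n) \sum_(j < n) dpart j (dpart i u) y * ((z ord0 i - y ord0 i) * (j == k)%:R)
     = \sum_(i < n) dpart i (dpart k u) y * (z ord0 i - y ord0 i).
    apply: eq_bigr => i _; under eq_bigr do rewrite mulrA.
    by rewrite sum_delta (dpartC k i)//.
  have E2 : \sum_(i < n) \sum_(j < n) dpart j (dpart i u) y * ((z ord0 j - y ord0 j) * (i == k)%:R)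
     = \sum_(i < n) dpart i (dpart k u) y * (z ord0 i - y ord0 i).
    rewrite exchange_big; apply: eq_bigr => j _; under eq_bigr do rewrite mulrA.
    by rewrite sum_delta.
  under [X in _ = 2^-1 * X]eq_bigr => i _.
    under eq_bigr => j _ do rewrite mulrDr.
    rewrite big_split/=; over.
  by rewrite big_split/= E1 E2; field.
apply: (is_derive_addf (is_derive_taylor1 u y k z)).
apply: is_derive_scalef; apply: is_derive_sumf => i; apply: is_derive_sumf => j.
by apply: is_derive_scalef; apply: is_derive_mulf; exact: is_derive_shiftcoord.
Qed.

Lemma taylor1_le u y (M : R) : smooth u -> 0 <= M ->
  (forall i j x, `|dpart j (dpart i u) x| <= M) ->
  forall x, `|u x - taylor1 u y x| <= n%:R * (n%:R * M) * `|x - y| ^+ 2.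
Proof.
move=> su M0 HM; have d k z : is_derive z (evec R k) (fun x => u x - taylor1 u y x)
    (dpart k u z - dpart k u y).
  apply: is_deriveB; last exact: is_derive_taylor1.
  by apply: is_dpart; exact: smooth_derivable.
apply: growth_le.
- by move=> i z; exact: (is_derivable (d i z)).
- by rewrite mulr_ge0.
- by rewrite /taylor1 big1 ?addr0 ?subrr// => i _; rewrite subrr mulr0.
- move=> i z; rewrite (dpart_val (d i z)) expr1; apply: box_lipschitz => //.
  by move=> j w; apply: smooth_derivable; exact: smooth_dpart.
Qed.

Lemma taylor2_le u y (M : R) : smooth u -> 0 <= M ->
  (forall i j k x, `|dpart k (dpart j (dpart i u)) x| <= M) ->
  forall x, `|u x - taylor2 u y x| <= n%:R * (n%:R * (n%:R * M)) * `|x - y| ^+ 3.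
Proof.
move=> su M0 HM; have d k z : is_derive z (evec R k) (fun x => u x - taylor2 u y x)
    (dpart k u z - taylor1 (dpart k u) y z).
  apply: is_deriveB; last exact: is_derive_taylor2.
  by apply: is_dpart; exact: smooth_derivable.
apply: growth_le.
- by move=> i z; exact: (is_derivable (d i z)).
- by rewrite !mulr_ge0.
- rewrite /taylor2 /taylor1 big1 => [|i _]; last by rewrite subrr mulr0.
  rewrite big1 ?mulr0 ?addr0 ?subrr// => i _; rewrite big1// => j _.
  by rewrite subrr !mul0r mulr0.
- move=> i z; rewrite (dpart_val (d i z)); apply: taylor1_le => //.
  exact: smooth_dpart.
Qed.

End TaylorRemainder.

(** * Riesz representation *)

Lemma Cc_subspace (R : realType) n (U : set (Rn R n)) : lin_subspace (Cc_inf U).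
Proof. by split; [exact: Cc0|move=> a f g; exact: Cc_lin]. Qed.

Record pos_functional (R : realType) (n : nat) (U : set (Rn R n)) := PosFunctional {
  pf_fun :> (Rn R n -> R) -> R;
  pf_lin : lin_on (Cc_inf U) pf_fun;
  pf_pos : forall f, Cc_inf U f -> (forall x, 0 <= f x) -> 0 <= pf_fun f }.

(** * The outer measure of a positive functional *)

Section RieszOuterMeasure.
Variables (R : realType) (n : nat) (U : set (Rn R n)).
Local Notation V := (Rn R n).
Implicit Types (L : pos_functional U) (f : V -> R) (g : nat -> V -> R) (A : set V).

Lemma pf_mono L f1 f2 : Cc_inf U f1 -> Cc_inf U f2 -> (forall x, f1 x <= f2 x) -> L f1 <= L f2.
Proof.
move=> C1 C2 f12; rewrite -subr_ge0 -(lin_onB (@pf_lin _ _ _ L))//.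
by apply: pf_pos => [|x]; [exact: Cc_sub2|rewrite subr_ge0].
Qed.

(** As in the Daniell integral, [g] increases to a function that is at least 1 on the part of [A] in
    [U]; points outside [U] cost nothing. Sequences of test functions, instead of open sets, let
    covers be added and multiplied by smooth functions. *)
Definition rcover A g := [/\ forall k, Cc_inf U (g k), forall k x, 0 <= g k x <= g k.+1 x &
  forall x, A x -> U x -> forall e : R, 0 < e -> exists k, 1 - e < g k x].

Definition rbound L A (c : R) := exists g, rcover A g /\ forall k, L (g k) <= c.

Definition router L A : \bar R := ereal_inf [set c%:E | c in rbound L A].

Lemma rcover_mono A g : rcover A g -> forall j k x, (j <= k)%N -> g j x <= g k x.
Proof.
move=> [_ Hg _] j k x; elim: k => [|k IH]; first by rewrite leqn0 => /eqP ->.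
rewrite leq_eqVlt => /predU1P[->//|/IH /le_trans]; apply.
by have /andP[] := Hg k x.
Qed.

Lemma rcover_ge0 A g : rcover A g -> forall k x, 0 <= g k x.
Proof. by move=> [_ Hg _] k x; have /andP[] := Hg k x. Qed.

Lemma rbound_ge0 L A c : rbound L A c -> 0 <= c.
Proof.
move=> [g [Hg Hc]]; apply: le_trans (Hc 0%N); apply: pf_pos; first by case: Hg.
by move=> x; exact: rcover_ge0 Hg _ _.
Qed.

Lemma router_lb L A c : rbound L A c -> (router L A <= c%:E)%E.
Proof. by move=> H; apply: ereal_inf_lbound; exists c. Qed.

Lemma router_ge0 L A : (0 <= router L A)%E.
Proof. by apply: le_ereal_inf_tmp => _ [c /rbound_ge0 c0 <-]; rewrite lee_fin. Qed.

Lemma rcover0 A : A `&` U `<=` set0 -> rcover A (fun _ _ => 0).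
Proof.
move=> AU; split=> [k|k x|x Ax Ux]; [exact: Cc0|by rewrite lexx|].
by have := AU x (conj Ax Ux).
Qed.

Lemma router_null L A : A `&` U `<=` set0 -> router L A = 0%E.
Proof.
move=> AU; apply/le_anti; rewrite router_ge0 andbT; apply: router_lb.
exists (fun _ _ => 0); split=> [|k]; first exact: rcover0.
by rewrite (lin_on0 (Cc_subspace U) (@pf_lin _ _ _ L)).
Qed.

Lemma router_adherent L A (e : R) : (router L A < +oo)%E -> 0 < e ->
  exists2 c, rbound L A c & (c%:E <= router L A + e%:E)%E.
Proof.
move=> Aoo e0; have fA : router L A \is a fin_num by rewrite ge0_fin_numE// router_ge0.
by have [_ [c Hc <-] /ltW ce] := lb_ereal_inf_adherent e0 fA; exists c.
Qed.

Lemma router_sigma_subadditive L A (F : (set V)^nat) : subset_sigma_subadditive (router L) A F.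
Proof.
move=> AF; have [[i ioo]|] := pselect (exists i, router L (F i) = +oo%E).
  by rewrite (eseries_pinfty _ _ ioo) ?leey// => k _; rewrite gt_eqF// (lt_le_trans _ (router_ge0 _ _)).
rewrite -forallNE => Foo.
apply/lee_addgt0Pr => e e0.
apply: le_trans (epsilon_trick _ _ (ltW e0)); last by move=> k; exact: router_ge0.
pose t k := (router L (F k) + (e / (2 ^ k.+1)%:R)%:E)%E.
have t0 k : (0 <= t k)%E by rewrite adde_ge0 ?router_ge0// lee_fin divr_ge0// ltW.
have ex k : exists c, rbound L (F k) c /\ (c%:E <= t k)%E.
  have [||c Hc ce] := @router_adherent L (F k) (e / (2 ^ k.+1)%:R).
  - by rewrite ltey; apply/eqP/Foo.
  - by rewrite divr_gt0// ltr0n expn_gt0.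
  by exists c.
pose c k := projT1 (cid (ex k)).
have Hc k : rbound L (F k) (c k) by rewrite /c; case: cid => ? [].
have ct k : ((c k)%:E <= t k)%E by rewrite /c; case: cid => ? [].
pose g k := projT1 (cid (Hc k)).
have gC k : rcover (F k) (g k) by rewrite /g; case: cid => ? [].
have gL k j : L (g k j) <= c k by rewrite /g; case: cid => ? [].
have [|too] := boolP ((\sum_(k <oo) t k)%E == +oo%E); first by move=> /eqP ->; rewrite leey.
have tfin : (\sum_(k <oo) t k)%E \is a fin_num.
  by rewrite ge0_fin_numE ?ltey// nneseries_ge0.
rewrite -(fineK tfin); apply: router_lb.
(* Diagonal choice: the N-th terms of the first N covers, which is again increasing in N. *)
exists (fun N x => \sum_(k < N) g k N x); split.
  split.
  - by move=> N; apply: Cc_sum => k; have [] := gC k.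
  - move=> N x; rewrite sumr_ge0/=; last by move=> k _; exact: rcover_ge0 (gC k) _ _.
    rewrite big_ord_recr/= ler_wpDr ?(rcover_ge0 (gC N))//.
    by apply: ler_sum => k _; exact: (rcover_mono (gC k)).
  - move=> x Ax Ux d d0; have [k _ Fkx] := AF x Ax.
    have [_ _ /(_ x Fkx Ux d d0)[j jd]] := gC k.
    exists (maxn k.+1 j); apply: lt_le_trans jd _.
    rewrite (bigD1 (Ordinal (leq_maxl k.+1 j)))//= ler_wpDr//.
      by apply: sumr_ge0 => i _; exact: rcover_ge0 (gC i) _ _.
    by apply: (rcover_mono (gC k)); exact: leq_maxr.
move=> N.
have -> : L (fun x => \sum_(k < N) g k N x) = \sum_(k < N) L (g k N).
  transitivity (L (fun x => \sum_(k < N) 1 * g k N x)).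
    by congr (pf_fun L); apply: funext => x; apply: eq_bigr => k _; rewrite mul1r.
  rewrite (lin_on_sum (Cc_subspace U) (@pf_lin _ _ _ L) _ (fun=> 1) (f := fun k : 'I_N => g k N)).
    by apply: eq_bigr => k _; rewrite mul1r.
  by move=> k; have [] := gC k.
rewrite -lee_fin fineK// -sumEFin.
apply: (@le_trans _ _ (\sum_(0 <= k < N) t k)%E); last by apply: nneseries_lim_ge => k _ _; exact: t0.
rewrite big_mkord; apply: lee_sum => k _; apply: le_trans (ct k).
by rewrite lee_fin.
Qed.

HB.instance Definition _ L := isSubsetOuterMeasure.Build R V (router L)
  (router_null L (@subIsetl _ _ _)) (router_ge0 L) (@router_sigma_subadditive L).

End RieszOuterMeasure.

(** * Measurability of half-spaces *)

Section RieszMeasure.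
Variables (R : realType) (n : nat) (U : set (Rn R n)).
Local Notation V := (Rn R n).
Implicit Types (L : pos_functional U) (A X : set V) (a b : R) (i : 'I_n) (x : V).

(* [1 - (1 - flatexp 0 t) ^ k] increases to the indicator of [t > 0]. *)
Definition halfspace_approx (a b : R) (i : 'I_n) (k : nat) (x : V) : R :=
  1 - \prod_(j < k) (1 - flatexp 0 (a * x ord0 i + b)).

Lemma flatexp0_le1 (t : R) : flatexp 0 t <= 1.
Proof.
have [t0|t0] := leP t 0; first by rewrite flatexp_le0.
by rewrite /flatexp t0 expr0 mul1r -expR0 ler_expR oppr_le0 invr_ge0 ltW.
Qed.

Lemma halfspace_approxE a b i k x :
  halfspace_approx a b i k x = 1 - (1 - flatexp 0 (a * x ord0 i + b)) ^+ k.
Proof. by rewrite /halfspace_approx prodr_const card_ord. Qed.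

Lemma smooth_halfspace_approx a b i k : smooth (halfspace_approx a b i k).
Proof.
apply: smooth_sub; first exact: smooth_cst.
apply: (@smooth_prod _ _ 'I_k (index_enum _) (fun j x => 1 - flatexp 0 (a * x ord0 i + b))) => j.
by apply: smooth_sub; [exact: smooth_cst|exact: smooth_flatexp].
Qed.

Lemma halfspace_approx01 a b i k x : 0 <= halfspace_approx a b i k x <= 1.
Proof.
rewrite halfspace_approxE; set t := flatexp _ _.
have t1 : 0 <= 1 - t by rewrite subr_ge0 flatexp0_le1.
have t2 : 1 - t <= 1 by rewrite lerBlDr lerDl flatexp_ge0.
by rewrite subr_ge0 exprn_ile1//= lerBlDr lerDl exprn_ge0.
Qed.

Lemma halfspace_approx_mono a b i k x :
  halfspace_approx a b i k x <= halfspace_approx a b i k.+1 x.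
Proof.
rewrite !halfspace_approxE lerD2l lerN2 exprS; set t := flatexp _ _.
have t1 : 0 <= 1 - t by rewrite subr_ge0 flatexp0_le1.
by rewrite ler_piMl ?exprn_ge0// lerBlDr lerDl flatexp_ge0.
Qed.

Lemma halfspace_approx_cvg a b i x (e : R) : 0 < a * x ord0 i + b -> 0 < e ->
  exists k, 1 - e < halfspace_approx a b i k x.
Proof.
move=> xp e0; pose t := 1 - flatexp 0 (a * x ord0 i + b).
have t1 : `|t| < 1.
  rewrite ger0_norm; last by rewrite subr_ge0 flatexp0_le1.
  by rewrite ltrBlDr ltrDl flatexp_gt0.
have /cvgr0Pnorm_lt/(_ _ e0)[N _ HN] := cvg_expr t1.
exists N; rewrite halfspace_approxE -/t ltrD2l ltrN2.
by apply: le_lt_trans (ler_norm _) _; apply: HN => /=.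
Qed.

(** A cover [g] of [X] splits as g chi + g (1 - chi) with chi increasing to the indicator of the
    half-space. One index is sent to infinity at a time, because g_k (1 - chi_k) need not increase
    in k. *)
Lemma caratheodory_halfspace L a b i :
  (router L).-caratheodory [set x : V | 0 < a * x ord0 i + b].
Proof.
apply: le_caratheodory_measurable => X; set O := [set x | _].
apply: le_ereal_inf_tmp => _ [c [g [gC gL]] <-].
have [Cg g01 gX] := gC; pose chi := halfspace_approx a b i.
have chi0 k x : 0 <= chi k x by have /andP[] := halfspace_approx01 a b i k x.
have chi1 k x : 0 <= 1 - chi k x.
  by rewrite subr_ge0; have /andP[] := halfspace_approx01 a b i k x.
have sc k : smooth (chi k) by exact: smooth_halfspace_approx.
have sc1 k : smooth (fun x => 1 - chi k x) by apply: smooth_sub => //; exact: smooth_cst.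
have Cgc j k : Cc_inf U (fun x => g j x * chi k x) by exact: Cc_mul.
have Cgc1 j k : Cc_inf U (fun x => g j x * (1 - chi k x)) by exact: Cc_mul.
have g0 k x : 0 <= g k x by exact: rcover_ge0 gC _ _.
have gm := rcover_mono gC.
have split j k : L (fun x => g k x * chi j x) + L (fun x => g k x * (1 - chi j x)) = L (g k).
  rewrite -(lin_onD (@pf_lin _ _ _ L))//; congr (pf_fun L); apply: funext => x; ring.
(* With [j] fixed, [chi j] vanishes off [O], so g_k (1 - chi_j) covers the outer part. Comparing
   both parts at the index max(j, k) bounds their sum by [c]. *)
have Hsub j : (router L (X `&` ~` O) <= (c - L (fun x => g j x * chi j x)%R)%:E)%E.
  apply: router_lb; exists (fun k x => g k x * (1 - chi j x)); split.
    split=> // [k x|x [Xx nOx] Ux e e0].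
      rewrite mulr_ge0//= ler_wpM2r//; exact: gm.
    have -> : chi j x = 0.
      have /negP := nOx; rewrite -leNgt /chi halfspace_approxE => h.
      by rewrite flatexp_le0// subr0 expr1n subrr.
    by rewrite subr0; have [k Hk] := gX x Xx Ux e e0; exists k; rewrite mulr1.
  move=> k; rewrite lerBrDl.
  have mono p q : (p <= q)%N -> L (fun x => g p x * chi j x) <= L (fun x => g q x * chi j x).
    by move=> pq; apply: pf_mono => // x; rewrite ler_wpM2r// gm.
  have mono1 p q : (p <= q)%N -> L (fun x => g p x * (1 - chi j x)) <= L (fun x => g q x * (1 - chi j x)).
    by move=> pq; apply: pf_mono => // x; rewrite ler_wpM2r// gm.
  have h := gL (maxn j k); rewrite -(split j) in h; apply: le_trans h.
  by apply: lerD; [apply: mono; exact: leq_maxl|apply: mono1; exact: leq_maxr].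
have Hfin : router L (X `&` ~` O) \is a fin_num.
  rewrite ge0_fin_numE ?router_ge0//; apply: le_lt_trans (Hsub 0%N) _; exact: ltry.
rewrite -[X in (_ + X <= _)%E](fineK Hfin) -leeBrDr// -EFinB; apply: router_lb.
exists (fun k x => g k x * chi k x); split.
  split=> // [k x|x [Xx Ox] Ux e e0].
    rewrite mulr_ge0//= ler_pM//; [exact: gm|exact: halfspace_approx_mono].
  (* With d = min(e/2, 1) one has (1 - d)^2 > 1 - e, and d <= 1 keeps the factors nonnegative. *)
  have e2 : 0 < Num.min (e / 2) 1 by rewrite lt_min divr_gt0//=.
  have [k1 H1] := gX x Xx Ux _ e2; have [k2 H2] := halfspace_approx_cvg Ox e2.
  exists (maxn k1 k2).
  have H3 : g k1 x <= g (maxn k1 k2) x by apply: gm; exact: leq_maxl.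
  have H4 : chi k2 x <= chi (maxn k1 k2) x.
    move: (leq_maxr k1 k2); move: (maxn _ _) => j; elim: j => [|j IH].
      by rewrite leqn0 => /eqP ->.
    rewrite leq_eqVlt => /predU1P[->//|/IH /le_trans]; apply.
    exact: halfspace_approx_mono.
  move: e2 H1 H2; set d := Num.min _ _ => e2 H1 H2.
  have d1 : d <= e / 2 /\ d <= 1 by rewrite /d !ge_min !lexx orbT.
  have H5 : (1 - d) * (1 - d) <= g (maxn k1 k2) x * chi (maxn k1 k2) x.
    by apply: ler_pM; rewrite ?subr_ge0 ?d1.2//; apply/ltW; [exact: lt_le_trans H3|exact: lt_le_trans H4].
  apply: lt_le_trans H5; nra.
by move=> k; rewrite lerBrDr -lerBrDl -lee_fin fineK//; exact: Hsub.
Qed.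

End RieszMeasure.

Section BorelGeneration.
Variables (R : realType) (n : nat).
Local Notation V := (Rn R n).

(* Balls of the maximum norm are finite intersections of half-spaces. *)
Lemma halfspaces_generate (M : set (set V)) : sigma_algebra [set: V] M ->
  (forall a b i, M [set x : V | 0 < a * x ord0 i + b]) ->
  <<s @open V >> `<=` M.
Proof.
move=> sM MH; apply: smallest_sub => // O oO.
have [Mset0 MD Mbig] := sM.
have MC A : M A -> M (~` A) by move=> /MD; rewrite setTD.
have MI A B : M A -> M B -> M (A `&` B).
  move=> MA MB; rewrite -[A]setCK -[B]setCK -setCU; apply: (MC _).
  rewrite -bigcup2E; apply: (Mbig _) => -[|[|k]] /=; [exact: MC|exact: MC|by []].
have MT : M setT by rewrite -setC0; exact: MC.
have Mball (c : V) (r : R) : 0 < r -> M [set x | `|x - c| < r].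
  move=> r0.
  have Mi (i : 'I_n) : M [set x : V | `|x ord0 i - c ord0 i| < r].
    have := MI _ _ (MH 1 (r - c ord0 i) i) (MH (-1) (r + c ord0 i) i).
    congr M; apply/seteqP; split=> x /=; rewrite ltr_distl => h.
      by apply/andP; split; case: h; lra.
    by move/andP: h => [? ?]; split; lra.
  have -> : [set x | `|x - c| < r] =
      \big[setI/setT]_(i <- enum 'I_n) [set x : V | `|x ord0 i - c ord0 i| < r].
    rewrite -bigcap_seq; apply/seteqP; split=> x /=.
      move=> xc i _ /=; apply: le_lt_trans xc.
      by have := ler_coord_norm (x - c) i; rewrite !mxE.
    by move=> xc; apply: rV_norm_lt => // i; rewrite !mxE; apply: xc; rewrite /= mem_enum.
  by elim/big_ind : _.
have -> : O = \bigcup_k \bigcup_l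
    (if `[< [set x : V | `|x - rV_rat R n k| < l.+1%:R^-1] `<=` O >]
     then [set x : V | `|x - rV_rat R n k| < l.+1%:R^-1] else set0).
  apply/seteqP; split=> x; last first.
    by move=> [k _ [l _]]; case: ifPn => // /asboolP; apply.
  move=> Ox; have [r r0 Hr] := open_ball_sub oO Ox.
  have r2 : 0 < r / 2 by rewrite divr_gt0.
  have [l _ /(_ l (leqnn l)) /= lr] := near_infty_natSinv_lt (PosNum r2).
  have l0 : 0 < l.+1%:R^-1 :> R by rewrite invr_gt0.
  have [k kx] := rV_rat_dense x l0.
  exists k => //; exists l => //; rewrite ifT; first by rewrite /= distrC.
  apply/asboolP => y /= yk; apply: Hr.
  rewrite -(subrKA (rV_rat R n k)); apply: le_trans (ler_normD _ _) _.
  rewrite [leRHS](splitr r) lerD//; apply/ltW; exact: lt_trans lr.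
apply: (Mbig _) => k; apply: (Mbig _) => l; case: ifPn => // _.
by apply: Mball; rewrite invr_gt0.
Qed.

End BorelGeneration.

Section RieszBorelMeasure.
Variables (R : realType) (n : nat) (U : set (Rn R n)).
Local Notation V := (Rn R n).

Lemma borel_caratheodory (L : pos_functional U) :
  <<s @open V >> `<=` (router L).-caratheodory.
Proof.
apply: halfspaces_generate; last by move=> a b i; exact: caratheodory_halfspace.
exact: (@sigma_algebra_measurable _ (caratheodory_type (router L))).
Qed.

Definition riesz_measure (L : pos_functional U) : set (Bor R n) -> \bar R := router L.

Let riesz0 (L : pos_functional U) : riesz_measure L set0 = 0%E.
Proof. by apply: router_null; rewrite set0I. Qed.

Let riesz_ge0 (L : pos_functional U) A : (0 <= riesz_measure L A)%E.
Proof. exact: router_ge0. Qed.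

Let riesz_sigma_additive (L : pos_functional U) : semi_sigma_additive (riesz_measure L).
Proof.
move=> F mF tF mUF; apply: (@caratheodory_measure_sigma_additive R V (router L)) => //.
  by move=> i; exact: (@borel_caratheodory L (F i) (mF i)).
exact: (@borel_caratheodory L _ mUF).
Qed.

HB.instance Definition _ (L : pos_functional U) := isMeasure.Build _ _ _ (riesz_measure L)
  (riesz0 L) (riesz_ge0 L) (@riesz_sigma_additive L).

End RieszBorelMeasure.

(** * Slicing by level sets *)

Section Levels.
Variable R : realType.

(** Open on the left, so that 0 belongs to no level and the level sets of a test function stay
    inside its support, where the measure is finite. *)
Definition in_level (h y : R) (i : nat) : bool := (i%:R * h < y) && (y <= i.+1%:R * h).

Lemma level_sum (h y : R) (N : nat) (F : nat -> R) : 0 < h -> 0 <= y <= N%:R * h ->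
  (y = 0 /\ \sum_(i < N) F i * (in_level h y i)%:R = 0) \/
  exists k, [/\ 0 < y, (k < N)%N, in_level h y k & \sum_(i < N) F i * (in_level h y i)%:R = F k].
Proof.
move=> h0 /andP[y0 yN]; have [->|yn0] := eqVneq y 0.
  left; split=> //; rewrite big1// => i _; rewrite /in_level ltNge mulr_ge0//; last exact: ltW.
  by rewrite mulr0.
right; have yp : 0 < y by rewrite lt_neqAle eq_sym yn0.
have [k kN yk] : exists2 k, (k < N)%N & in_level h y k.
  elim: N yN => [|N IH] yN; first by move: yN; rewrite mul0r leNgt yp.
  have [yN'|yN'] := leP y (N%:R * h); last by exists N => //; rewrite /in_level yN' yN.
  by have [k kN yk] := IH yN'; exists k => //; exact: ltnW.
exists k; split=> //; rewrite (bigD1 (Ordinal kN))//= yk mulr1 big1 ?addr0// => i ik.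
rewrite (_ : in_level h y i = false) ?mulr0//; apply/negP => /andP[i1 i2].
case/andP: yk => k1 k2.
have ki : (i : nat) != k by apply: contraNneq ik => ik; apply/eqP/val_inj.
have := lt_le_trans i1 k2; have := lt_le_trans k1 i2.
rewrite !ltr_pM2r// !ltr_nat !ltnS => ki1 ik1.
by move: ki; rewrite eqn_leq ki1 ik1.
Qed.

End Levels.

Section ContinuousMeasurable.
Variables (R : realType) (n : nat).
Local Notation V := (Rn R n).

Lemma open_borel (O : set V) : open O -> measurable (O : set (Bor R n)).
Proof. by move=> oO; exact: sub_sigma_algebra. Qed.

Lemma compact_borel (F : set V) : compact F -> measurable (F : set (Bor R n)).
Proof.
move=> kF; rewrite -[F]setCK; apply: measurableC; apply: open_borel.
by apply: closed_openC; apply: compact_closed => //; exact: norm_hausdorff.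
Qed.

Lemma continuous_borel (f : V -> R) : continuous f ->
  measurable_fun [set: Bor R n] (f : Bor R n -> R).
Proof.
move=> cf; apply: (measurability _ (RGenOpens.measurableE R)) => _ [_ [a [b ->]] <-].
rewrite setTI; apply: open_borel; apply: open_comp; last exact: interval_open.
by move=> x _; exact: cf.
Qed.

End ContinuousMeasurable.

(** * Monotone limits and densities of positive functionals *)

Section Representation.
Variables (R : realType) (n : nat) (U : set (Rn R n)).
Local Notation V := (Rn R n).
Implicit Types (L : pos_functional U) (f : V -> R).
Hypothesis oU : open U.

(* Dini: on the compact support the increasing sequence [g] eventually exceeds [f - e]. *)
Lemma pf_dini L f (g : nat -> V -> R) (c : R) : Cc_inf U f -> (forall x, 0 <= f x) ->
  (forall k, Cc_inf U (g k)) -> (forall k x, 0 <= g k x <= g k.+1 x) ->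
  (forall x (e : R), 0 < e -> exists k, f x - e < g k x) ->
  (forall k, L (g k) <= c) -> L f <= c.
Proof.
move=> Cf f0 Cg g01 gf gL.
have gm j k x : (j <= k)%N -> g j x <= g k x.
  elim: k => [|k IH]; first by rewrite leqn0 => /eqP ->.
  rewrite leq_eqVlt => /predU1P[->//|/IH /le_trans]; apply.
  by have /andP[] := g01 k x.
have [chi [Cchi chi01 [W [oW fW chiW]]]] := cutoff_exists (Cc_compact Cf) oU (Cc_supp Cf).
have Lchi : 0 <= L chi by apply: pf_pos => // x; have /andP[] := chi01 x.
have key e : 0 < e -> L f <= c + e * L chi.
  move=> e0; have := Cc_compact Cf; rewrite compact_cover.
  move=> /(_ _ [set: nat] (fun k => [set x | 0 < g k x - f x + e])) [| |s _ Hs].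
  - move=> k _.
    have cgf : continuous (fun x => g k x - f x + e).
      apply: smooth_cont; apply: smooth_add; last exact: smooth_cst.
      by apply: smooth_sub; [exact: Cc_smooth (Cg k)|exact: Cc_smooth Cf].
    have -> : [set x | 0 < g k x - f x + e] = (fun x => g k x - f x + e) @^-1` [set t | 0 < t] by [].
    by apply: open_comp (@open_gt R 0) => x _; exact: cgf.
  - by move=> x _; have [k Hk] := gf x e e0; exists k => //=; lra.
  pose k := \max_(j <- finmap.enum_fset s) j.
  have fk x : f x <= 1 * g k x + e * chi x.
    have [xf|/fsupp_out ->] := pselect (fsupp f x); last first.
      rewrite addr_ge0// ?mul1r; first by have /andP[] := g01 k x.
      by have /andP[c0 _] := chi01 x; rewrite mulr_ge0// ltW.
    have [j /= js xj] := Hs x xf.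
    have jk : (j <= k)%N by exact: leq_bigmax_seq.
    by have := gm _ _ x jk; rewrite chiW ?mulr1; [lra|exact: fW].
  have Ceg := Cc_scale e Cchi.
  apply: le_trans (pf_mono L Cf (Cc_lin 1 (Cg k) Ceg) fk) _.
  rewrite (@pf_lin _ _ _ L)// mul1r (lin_onZ (Cc_subspace U) (@pf_lin _ _ _ L))//.
  by rewrite lerD2r.
apply/ler_addgt0Pr => e e0.
have L1 : 0 < L chi + 1 by lra.
apply: le_trans (key (e / (L chi + 1)) (divr_gt0 e0 L1)) _.
by rewrite lerD2l mulrAC ler_pdivrMr// ler_pM2l//; lra.
Qed.

Section Density.
Variables (L : pos_functional U) (f : V -> R).
Hypotheses (sf : smooth f) (f0 : forall x, 0 <= f x).

Let Lf (g : V -> R) := L (fun x => f x * g x).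

Let Lf_lin : lin_on (Cc_inf U) Lf.
Proof.
move=> a g h Cg Ch; rewrite /Lf -(@pf_lin _ _ _ L)//; try exact: Cc_mull.
by congr (pf_fun L); apply: funext => x; ring.
Qed.

Let Lf_pos g : Cc_inf U g -> (forall x, 0 <= g x) -> 0 <= Lf g.
Proof.
by move=> Cg g0; apply: pf_pos => [|x]; [exact: Cc_mull|rewrite mulr_ge0].
Qed.

Definition pf_mul : pos_functional U := PosFunctional Lf_lin Lf_pos.

(** If [g] covers [A], so does f g / s, because f / s > 1 on [A]. This yields the lower estimate of
    [L f] by level sums without restricting [f] to its level sets. *)
Lemma router_density (A : set V) (s : R) : 0 <= s -> (forall x, A x -> s < f x) ->
  (s%:E * router L A <= router pf_mul A)%E.
Proof.
rewrite le_eqVlt => /predU1P[<- _|s0 sA]; first by rewrite mul0e router_ge0.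
apply: le_ereal_inf_tmp => _ [c [g [gC gL]] <-].
rewrite -lee_pdivlMl// -EFinM; apply: router_lb.
exists (fun k x => s^-1 * (f x * g k x)); split; last first.
  move=> k; rewrite (lin_onZ (Cc_subspace U) (@pf_lin _ _ _ L)).
    by rewrite ler_pM2l ?invr_gt0//; exact: gL.
  by apply: Cc_mull => //; case: gC.
have [Cg g01 gA] := gC; split.
- by move=> k; apply: Cc_scale; exact: Cc_mull.
- move=> k x; have /andP[g0 g1] := g01 k x.
  rewrite !mulr_ge0 ?invr_ge0 ?(ltW s0)//= ler_pM2l ?invr_gt0//.
  by rewrite ler_wpM2l.
- move=> x Ax Ux e e0; have [k Hk] := gA x Ax Ux e e0; exists k.
  apply: lt_le_trans Hk _; have /andP[g0 _] := g01 k x.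
  rewrite mulrA ler_peMl// mulrC ler_pdivlMr// mul1r ltW//; exact: sA.
Qed.

End Density.

End Representation.

(** * Integral representation of positive functionals *)

Section RieszRepresentation.
Variables (R : realType) (n : nat) (U : set (Rn R n)).
Local Notation V := (Rn R n).
Local Notation T := (Bor R n).
Implicit Types (L : pos_functional U) (f : V -> R).
Hypothesis oU : open U.

Lemma router_le1 L (A : set V) chi : Cc_inf U chi -> (forall x, 0 <= chi x) ->
  (forall x, A x -> U x -> chi x = 1) -> (router L A <= (L chi)%:E)%E.
Proof.
move=> Cchi chi0 chi1; apply: router_lb; exists (fun=> chi); split=> //; split=> //.
  by move=> k x; rewrite chi0 lexx.
by move=> x Ax Ux e e0; exists 0%N; rewrite chi1//; lra.
Qed.

Definition level_set f (h : R) (i : nat) : set V := [set x | in_level h (f x) i].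

Lemma measurable_level f h i : continuous f -> measurable (level_set f h i : set T).
Proof.
move=> cf; have := continuous_borel cf measurableT (measurable_itv `](i%:R * h), (i.+1%:R * h)]).
rewrite setTI; congr measurable; apply/seteqP; split=> x /=; by rewrite in_itv.
Qed.

Lemma integral_levels (mu : {measure set T -> \bar R}) f h N (F : nat -> R) :
  continuous f -> (forall i, 0 <= F i) ->
  (\int[mu]_(x in [set: T]) (\sum_(i < N) F i * (in_level h (f x) i)%:R)%:E)%E
  = (\sum_(i < N) (F i)%:E * mu (level_set f h i))%E.
Proof.
move=> cf F0; have indE i x : (in_level h (f x) i)%:R = \1_(level_set f h i) x :> R.
  by rewrite indicE; congr (_%:R); congr nat_of_bool; apply/idP/idP; rewrite inE.
have m1 i : measurable_fun [set: T] (\1_(level_set f h i) : T -> R).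
  exact: measurable_indic (measurable_level h i cf).
transitivity (\int[mu]_(x in [set: T]) (\sum_(i < N) (F i * \1_(level_set f h i) x)%:E))%E.
  by apply: eq_integral => x _; rewrite sumEFin; congr EFin; apply: eq_bigr => i _; rewrite indE.
rewrite ge0_integral_sum//; last 2 first.
- by move=> i; apply/measurable_EFinP; apply: measurable_funM.
- by move=> i x _; rewrite lee_fin mulr_ge0// indicE.
apply: eq_bigr => i _; under eq_integral => x _ do rewrite EFinM.
have i0 x : [set: T] x -> (0 <= (\1_(level_set f h i) x)%:E :> \bar R)%E.
  by move=> _; rewrite lee_fin indicE.
have im : measurable_fun [set: T] (fun x => (\1_(level_set f h i) x)%:E : \bar R).
  exact/measurable_EFinP.
rewrite (ge0_integralZl_EFin mu measurableT i0 im (F0 i)).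
by rewrite (integral_indic mu measurableT (measurable_level h i cf)) setIT.
Qed.

Section Nonnegative.
Variables (L : pos_functional U) (f : V -> R).
Hypotheses (Cf : Cc_inf U f) (f0 : forall x, 0 <= f x).

Let mu : {measure set T -> \bar R} := riesz_measure L.

(** Both the integral and [L f] lie between the lower level sum [S] and S + (M / N) L(chi), and the
    gap closes as N grows. *)
Lemma riesz_integral_ge0 : (\int[mu]_(x in [set: T]) (f x)%:E)%E = (L f)%:E.
Proof.
have sf := Cc_smooth Cf; have cf := smooth_cont sf.
have [M M0 fM] := Cc_bounded Cf.
have [chi [Cchi chi01 [W [oW fW chiW]]]] := cutoff_exists (Cc_compact Cf) oU (Cc_supp Cf).
have chi0 x : 0 <= chi x by have /andP[] := chi01 x.
have chi1 x : fsupp f x -> chi x = 1 by move=> xf; exact/chiW/fW.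
have fchi : (fun x => f x * chi x) = f.
  apply: funext => x; have [xf|xf] := pselect (fsupp f x); first by rewrite chi1// mulr1.
  by rewrite (fsupp_out xf) mul0r.
have msupp : measurable (fsupp f : set T) := compact_borel (Cc_compact Cf).
pose muf : {measure set T -> \bar R} := riesz_measure (pf_mul L sf f0).
have mu_supp : (mu (fsupp f) <= (L chi)%:E)%E.
  by apply: router_le1 => // x xf _; exact: chi1.
have muf_supp : (muf (fsupp f) <= (L f)%:E)%E.
  have := router_le1 (pf_mul L sf f0) Cchi chi0 (fun x xf (_ : U x) => chi1 x xf).
  by rewrite [X in (_ <= X%:E)%E]/= fchi.
have Lchi0 : 0 <= L chi by exact: pf_pos.
have Lf0 : 0 <= L f by exact: pf_pos.
have level_supp h i : 0 < h -> level_set f h i `<=` fsupp f.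
  move=> h0 x /andP[fx _]; apply: contrapT => /fsupp_out fx0; move: fx.
  by rewrite fx0 ltNge mulr_ge0// ltW.
have muL h i : 0 < h -> mu (level_set f h i) \is a fin_num.
  move=> h0; rewrite ge0_fin_numE//; apply: le_lt_trans (ltry (L chi)).
  apply: le_trans mu_supp; apply: le_measure; rewrite ?inE//.
    exact: measurable_level.
  exact: level_supp.
have mlev (F : nat -> R) h N :
    measurable_fun [set: T] (fun x => (\sum_(i < N) F i * (in_level h (f x) i)%:R)%:E).
  apply/measurable_EFinP; apply: measurable_sum => i; apply: measurable_funM => //.
  have := measurable_indic (R := R) (measurable_level h i cf) (D := [set: T]).
  congr measurable_fun; apply: funext => x; rewrite indicE; congr (_%:R).
  by congr nat_of_bool; apply/idP/idP; rewrite inE.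
have mf : measurable_fun [set: T] (fun x => (f x)%:E).
  by apply/measurable_EFinP; exact: (continuous_borel cf).
have key (N : nat) : (0 < N)%N -> exists S : R,
   [/\ (S%:E <= \int[mu]_(x in [set: T]) (f x)%:E)%E,
       (\int[mu]_(x in [set: T]) (f x)%:E <= (S + M / N%:R * L chi)%:E)%E,
       S <= L f & L f <= S + M / N%:R * L chi].
  move=> N0; pose h := M / N%:R; have h0 : 0 < h by rewrite divr_gt0// ltr0n.
  have yN x : 0 <= f x <= N%:R * h.
    rewrite f0/= /h mulrC divfK ?pnatr_eq0 -?lt0n//.
    by apply: le_trans (fM x); exact: ler_norm.
  pose mi i := fine (mu (level_set f h i)).
  have miE i : mu (level_set f h i) = (mi i)%:E by rewrite fineK// muL.
  have mi0 i : 0 <= mi i by rewrite fine_ge0.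
  pose S := \sum_(i < N) i%:R * h * mi i.
  have F0 i : 0 <= i%:R * h by rewrite mulr_ge0// ltW.
  have lsum F x := level_sum F h0 (yN x).
  have sum_mi : \sum_(i < N) mi i <= L chi.
    rewrite -lee_fin; apply: le_trans mu_supp.
    have -> : mu (fsupp f) = (\int[mu]_(x in [set: T]) (\1_(fsupp f) x)%:E)%E.
      by rewrite integral_indic// setIT.
    rewrite -sumEFin; have := integral_levels mu h N cf (fun=> ler01).
    under eq_bigr do rewrite mul1e miE; move=> <-.
    apply: ge0_le_integral => //.
    - by move=> x _; rewrite lee_fin sumr_ge0// => i _; rewrite mulr_ge0.
    - exact: (mlev (fun=> 1)).
    - by apply/measurable_EFinP; exact: measurable_indic.
    - move=> x _; rewrite lee_fin; have [[_ ->]|[k [fx kN yk ->]]] := lsum (fun=> 1) x.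
        by rewrite indicE.
      by rewrite indicE mem_set//; apply: level_supp yk.
  have Shi : \sum_(i < N) i.+1%:R * h * mi i <= S + h * L chi.
    apply: (@le_trans _ _ (S + h * \sum_(i < N) mi i)); last by rewrite lerD2l ler_pM2l.
    rewrite mulr_sumr -big_split/=; apply: ler_sum => i _.
    by rewrite -natr1 !mulrDl mul1r.
  exists S; split.
  - rewrite /S -sumEFin; under eq_bigr do rewrite EFinM -miE.
    rewrite -(integral_levels mu h N cf F0).
    apply: ge0_le_integral => //.
    + by move=> x _; rewrite lee_fin sumr_ge0// => i _; rewrite mulr_ge0.
    + exact: (mlev (fun i => i%:R * h)).
    + move=> x _; rewrite lee_fin.
      have [[-> ->]//|[k [_ _ /andP[/ltW yk _] ->]]] := lsum (fun i => i%:R * h) x.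
      exact: yk.
  - apply: (@le_trans _ _ (\sum_(i < N) i.+1%:R * h * mi i)%:E); last by rewrite lee_fin.
    rewrite -sumEFin; under eq_bigr do rewrite EFinM -miE.
    have F1 i : 0 <= i.+1%:R * h by rewrite mulr_ge0// ltW.
    rewrite -(integral_levels mu h N cf F1).
    apply: ge0_le_integral => //.
    + by move=> x _; rewrite lee_fin.
    + exact: (mlev (fun i => i.+1%:R * h)).
    + move=> x _; rewrite lee_fin.
      have [[-> ->]//|[k [_ _ /andP[_ yk] ->]]] := lsum (fun i => i.+1%:R * h) x.
      exact: yk.
  (* On each level [f] exceeds i h, so the lower sum is at most the mass that the functional with
     density [f] gives to the levels; these are disjoint parts of the support, of total mass at most
     L(f chi) = L(f). *)
  - rewrite -lee_fin; apply: le_trans muf_supp.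
    have -> : muf (fsupp f) = (\int[muf]_(x in [set: T]) (\1_(fsupp f) x)%:E)%E.
      by rewrite integral_indic// setIT.
    apply: (@le_trans _ _ (\sum_(i < N) 1%:E * muf (level_set f h i))%E).
      rewrite -sumEFin; apply: lee_sum => i _; rewrite mul1e EFinM -miE.
      by apply: router_density => // x /andP[].
    rewrite -(integral_levels muf h N cf (fun=> ler01)).
    apply: ge0_le_integral => //.
    + by move=> x _; rewrite lee_fin sumr_ge0// => i _; rewrite mulr_ge0.
    + exact: (mlev (fun=> 1)).
    + by apply/measurable_EFinP; exact: measurable_indic.
    + move=> x _; rewrite lee_fin; have [[_ ->]|[k [fx kN yk ->]]] := lsum (fun=> 1) x.
        by rewrite indicE.
      by rewrite indicE mem_set//; apply: level_supp yk.
  (* Nearly optimal covers of the levels, weighted by (i+1) h, increase beyond [f], and Dini bounds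
     [L f] by the upper level sum. Dividing [e] by [C] keeps the weighted sum of the cover errors
     below [e]. *)
  - apply: le_trans Shi; apply/ler_addgt0Pr => e e0.
    pose C := \sum_(i < N) i.+1%:R * h + 1.
    have C0 : 0 < C by rewrite ltr_wpDl// sumr_ge0// => i _; rewrite mulr_ge0// ltW.
    have d0 : 0 < e / C by rewrite divr_gt0.
    have ex i : exists c, rbound L (level_set f h i) c /\ c <= mi i + e / C.
      have [|c Hc ce] := @router_adherent _ _ _ L (level_set f h i) (e / C) _ d0.
        by rewrite -ge0_fin_numE ?router_ge0//; exact: muL.
      by exists c; split=> //; rewrite -lee_fin EFinD -miE.
    pose c i := projT1 (cid (ex i)).
    have Hc i : rbound L (level_set f h i) (c i) by rewrite /c; case: cid => ? [].
    have ce i : c i <= mi i + e / C by rewrite /c; case: cid => ? [].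
    pose g i := projT1 (cid (Hc i)).
    have gC i : rcover U (level_set f h i) (g i) by rewrite /g; case: cid => ? [].
    have gL i k : L (g i k) <= c i by rewrite /g; case: cid => ? [].
    have F1 i : 0 < i.+1%:R * h by rewrite mulr_gt0// ltr0n.
    have Cg i k : Cc_inf U (g i k) by have [] := gC i.
    have g0 i k x : 0 <= g i k x by exact: rcover_ge0 (gC i) _ _.
    apply: (@pf_dini _ _ _ oU L f (fun k x => \sum_(i < N) (i.+1%:R * h) * g i k x)) => //.
    + by move=> k; apply: Cc_sum => i; exact: Cc_scale.
    + move=> k x; rewrite sumr_ge0/=; last by move=> i _; rewrite mulr_ge0// ltW.
      by apply: ler_sum => i _; rewrite ler_pM2l//; apply: (rcover_mono (gC i)).
    + move=> x d dd; have [[fx _]|[i [fx iN yi _]]] := lsum (fun=> 1) x.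
        exists 0%N; rewrite fx; apply: (@lt_le_trans _ _ 0); first by lra.
        by apply: sumr_ge0 => i _; rewrite mulr_ge0// ltW.
      have Ux : U x by apply: (Cc_supp Cf); exact: level_supp yi.
      have [_ _ /(_ x yi Ux _ (divr_gt0 dd (F1 i)))[k Hk]] := gC i.
      exists k; apply: (@lt_le_trans _ _ (i.+1%:R * h * g i k x)).
        have /andP[_ yi2] := yi; apply: le_lt_trans (_ : i.+1%:R * h - d < _); first by lra.
        rewrite -ltr_pdivrMl// mulrBr mulVf ?gt_eqF// mulrC//.
      rewrite (bigD1 (Ordinal iN))//= lerDl; apply: sumr_ge0 => j _.
      by rewrite mulr_ge0// ltW.
    + move=> k; rewrite (lin_on_sum (Cc_subspace U) (@pf_lin _ _ _ L) _
        (fun i : 'I_N => i.+1%:R * h) (f := fun i : 'I_N => g i k)) => [|i]; last exact: Cg.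
      apply: (@le_trans _ _ (\sum_(i < N) (i.+1%:R * h * mi i + i.+1%:R * h * (e / C)))).
        apply: ler_sum => i _; rewrite -mulrDr ler_pM2l//; exact: le_trans (gL i k) (ce i).
      rewrite big_split/= lerD2l -mulr_suml mulrCA ger_pMr// ler_pdivrMr// mul1r.
      by rewrite lerDl.
have Ifin : (\int[mu]_(x in [set: T]) (f x)%:E)%E \is a fin_num.
  rewrite ge0_fin_numE; last by apply: integral_ge0 => x _; rewrite lee_fin.
  by have [S [_ h _ _]] := key 1%N (ltn0Sn 0); apply: le_lt_trans h (ltry _).
rewrite -(fineK Ifin); congr EFin; set I := fine _.
apply/eqP; rewrite -subr_eq0 -normr_le0; apply/ler_addgt0Pr => e e0; rewrite add0r.
have e1 : 0 < e / (M * L chi + 1) by rewrite divr_gt0// ltr_wpDl// mulr_ge0// ltW.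
have [N _ /(_ N (leqnn N)) /= HN] := near_infty_natSinv_lt (PosNum e1).
have [S [h1 h2 h3 h4]] := key N.+1 (ltn0Sn N).
move: h1 h2; rewrite -(fineK Ifin) !lee_fin -/I => h1 h2.
have small : M / N.+1%:R * L chi <= e.
  rewrite mulrAC; move: HN; rewrite ltr_pdivlMr; last by rewrite ltr_wpDl// mulr_ge0// ltW.
  rewrite mulrC => HN; apply: le_trans (ltW HN); rewrite mulrDl mul1r.
  by rewrite lerDl invr_ge0.
by move: small; set q := M / _ * _ in h2 h4 *; rewrite ler_norml => ?; apply/andP; split; lra.
Qed.

End Nonnegative.

End RieszRepresentation.

(** * Radon property and approximation of compact sets *)

Section RieszRadon.
Variables (R : realType) (n : nat) (U : set (Rn R n)).
Local Notation V := (Rn R n).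
Local Notation T := (Bor R n).
Implicit Types (L : pos_functional U) (f : V -> R).
Hypothesis oU : open U.

Lemma riesz_radon L : radon_on U (riesz_measure L).
Proof.
split; first by apply: router_null; rewrite setICl.
move=> F kF FU; have [chi [Cchi chi01 [W [oW FW chiW]]]] := cutoff_exists kF oU FU.
apply: le_lt_trans (ltry (L chi)); apply: router_le1 => // x.
  by have /andP[] := chi01 x.
by move=> /FW/chiW.
Qed.

Lemma Cc_integrable (mu : {measure set T -> \bar R}) f :
  radon_on U mu -> Cc_inf U f -> mu.-integrable [set: T] (fun x => (f x)%:E).
Proof.
move=> [_ muU] Cf; have [M M0 fM] := Cc_bounded Cf.
have mS : measurable (fsupp f : set T) := compact_borel (Cc_compact Cf).
have := muU _ (Cc_compact Cf) (Cc_supp Cf) => Sfin.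
have iS : mu.-integrable [set: T] (fun x => (M * \1_(fsupp f) x)%:E).
  under eq_fun do rewrite EFinM; apply: integrableZl => //; apply/integrableP; split.
    by apply/measurable_EFinP; exact: measurable_indic.
  under eq_integral => x _ do rewrite gee0_abs ?lee_fin//.
  by rewrite integral_indic// setIT.
apply: le_integrable iS => //.
  by apply/measurable_EFinP; exact: (continuous_borel (smooth_cont (Cc_smooth Cf))).
move=> x _; rewrite /= lee_fin indicE.
have [xf|xf] := pselect (fsupp f x); first by rewrite mem_set// mulr1 (le_trans (fM x))// ler_norm.
by rewrite (fsupp_out xf) normr0.
Qed.

Lemma integral_Cc (mu : {measure set T -> \bar R}) f : Cc_inf U f ->
  (\int[mu]_(x in (U : set T)) (f x)%:E = \int[mu]_(x in [set: T]) (f x)%:E)%E.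
Proof.
move=> Cf; rewrite integral_mkcond; apply: eq_integral => x _.
rewrite patchE; case: ifPn => // xU; rewrite (@fsupp_out _ _ f)// => /(Cc_supp Cf) Ux.
by rewrite mem_set in xU.
Qed.

Lemma riesz_integral L f : Cc_inf U f ->
  (\int[riesz_measure L]_(x in (U : set T)) (f x)%:E)%E = (L f)%:E.
Proof.
move=> Cf; rewrite integral_Cc//.
have [M M0 fM] := Cc_bounded Cf.
have [chi [Cchi chi01 [W [oW fW chiW]]]] := cutoff_exists (Cc_compact Cf) oU (Cc_supp Cf).
have chi0 x : 0 <= chi x by have /andP[] := chi01 x.
(* The signed case reduces to two nonnegative functions, f + M chi and M chi. *)
have CM : Cc_inf U (fun x => M * chi x) by exact: Cc_scale.
have CfM : Cc_inf U (fun x => f x + M * chi x) by exact: Cc_add.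
have M0' x : 0 <= M * chi x by rewrite mulr_ge0// ltW.
have fM0 x : 0 <= f x + M * chi x.
  have [xf|/fsupp_out ->] := pselect (fsupp f x); last by rewrite add0r.
  by rewrite chiW ?mulr1; [have := fM x; rewrite ler_norml => /andP[]; lra|exact: fW].
have E : (\int[riesz_measure L]_(x in [set: T]) (f x)%:E)%E =
    (\int[riesz_measure L]_(x in [set: T]) ((f x + M * chi x)%:E - (M * chi x)%:E))%E.
  by apply: eq_integral => x _; rewrite -EFinB addrK.
rewrite E integralB_EFin//; [|exact: Cc_integrable (riesz_radon L) _..].
rewrite !riesz_integral_ge0// -EFinB (lin_onD (@pf_lin _ _ _ L))//.
by rewrite addrK.
Qed.

(** The sequence is chosen before the measure, so relations between several measures can be passed
    from test functions to compact sets along one common sequence. *)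
Lemma compact_approx (F : set V) : compact F -> F `<=` U ->
  exists c : nat -> V -> R, [/\ forall k, Cc_inf U (c k), forall k x, 0 <= c k x &
    forall mu : {measure set T -> \bar R}, radon_on U mu ->
      (fun k => fine (\int[mu]_(x in (U : set T)) (c k x)%:E)%E) @ \oo --> fine (mu F)].
Proof.
move=> kF FU; have [chi [Cchi chi01 [W [oW FW chiW]]]] := cutoff_exists kF oU FU.
pose O k := \bigcup_(y in F) [set x : V | `|x - y| < k.+1%:R^-1].
have oO k : open (O k) by apply: bigcup_open => y _; exact: open_ballr.
have FO k : F `<=` O k by move=> y Fy; exists y => //=; rewrite subrr normr0 invr_gt0.
have ex k : exists eta : V -> R, [/\ smooth eta, forall x, 0 <= eta x <= 1,
    forall x, F x -> eta x = 1 & forall x, ~ O k x -> eta x = 0].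
  have [eta [Ceta eta01 [W' [oW' FW' eW']]]] := cutoff_exists kF (oO k) (@FO k).
  exists eta; split=> //; [exact: Cc_smooth Ceta|by move=> x /FW'/eW'|].
  by move=> x Ox; apply: fsupp_out => /(Cc_supp Ceta).
pose eta k := projT1 (cid (ex k)).
have se k : smooth (eta k) by rewrite /eta; case: cid => ? [].
have e01 k x : 0 <= eta k x <= 1 by rewrite /eta; case: cid => ? [].
have e1 k x : F x -> eta k x = 1 by move: x; rewrite /eta; case: cid => ? [].
have e0 k x : ~ O k x -> eta k x = 0 by move: x; rewrite /eta; case: cid => ? [].
have Cc k : Cc_inf U (fun x => chi x * eta k x) by exact: Cc_mul.
have chi0 x : 0 <= chi x by have /andP[] := chi01 x.
have c0 k x : 0 <= chi x * eta k x by rewrite mulr_ge0//; have /andP[] := e01 k x.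
exists (fun k x => chi x * eta k x); split=> // mu Rmu.
have mF : measurable (F : set T) by exact: compact_borel.
have -> : fine (mu F) = fine (\int[mu]_(x in [set: T]) (\1_F x)%:E)%E.
  by rewrite integral_indic// setIT.
have ptw (x : T) : (fun k => (chi x * eta k x)%:E) @ \oo --> (\1_F x)%:E.
  rewrite indicE; have [Fx|nFx] := pselect (F x).
    rewrite mem_set//; apply: cvg_near_cst; exists 0%N => // k _.
    by rewrite e1// mulr1 chiW//; exact: FW.
  rewrite memNset//; have oFC : open (~` F).
    by apply: closed_openC; apply: compact_closed => //; exact: norm_hausdorff.
  have [r r0 Hr] := open_ball_sub oFC nFx.
  have [N _ HN] := near_infty_natSinv_lt (PosNum r0).
  apply: cvg_near_cst; exists N => // k Nk; rewrite e0 ?mulr0// => -[y Fy xy].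
  apply: (Hr y) Fy; rewrite distrC; apply: ltW; apply: lt_trans xy _; exact: HN.
have mc k : measurable_fun [set: T] (fun x : T => (chi x * eta k x)%:E).
  by apply/measurable_EFinP; exact: (continuous_borel (smooth_cont (Cc_smooth (Cc k)))).
have m1 : measurable_fun [set: T] (fun x : T => (\1_F x)%:E : \bar R).
  by apply/measurable_EFinP; exact: measurable_indic.
have dom (x : T) k : (`|(chi x * eta k x)%:E| <= (chi x)%:E)%E.
  by rewrite abse_EFin lee_fin ger0_norm// ler_piMr//; have /andP[] := e01 k x.
have [_ _ D] := dominated_convergence measurableT mc m1 (aeW _ (fun x _ => ptw x))
  (Cc_integrable Rmu Cchi) (aeW _ (fun x k _ => dom x k)).
under eq_fun do rewrite integral_Cc//.
apply: fine_cvg; rewrite fineK; first exact: D.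
by rewrite integral_indic// setIT ge0_fin_numE//; exact: Rmu.2.
Qed.

End RieszRadon.

(** * Neighbourhoods for the Euclidean distance *)

Section Neighbourhood.
Variables (R : realType) (n : nat).
Local Notation V := (Rn R n).
Local Notation T := (Bor R n).
Implicit Types (x y z : V) (S U : set V) (d : R) (i j : 'I_n).

(** The squared Euclidean distance. Being a polynomial, it becomes a finite-rank kernel once
    multiplied by test functions of [x] and [y]. *)
Definition wdist x y : R := \sum_(i < n) (x ord0 i - y ord0 i) * (x ord0 i - y ord0 i).

Lemma wdist_ge0 x y : 0 <= wdist x y.
Proof. by apply: sumr_ge0 => i _; rewrite -expr2 sqr_ge0. Qed.

Lemma wdist_norm x y : `|x - y| * `|x - y| <= wdist x y.
Proof.
have H i : `|(x - y) ord0 i| ^+ 2 <= wdist x y.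
  rewrite real_normK ?num_real// !mxE /wdist (bigD1 i)//= expr2 lerDl.
  by apply: sumr_ge0 => j _; rewrite -expr2 sqr_ge0.
have [->|xy0] := eqVneq `|x - y| 0; first by rewrite mulr0 wdist_ge0.
rewrite -expr2 -(sqr_sqrtr (wdist_ge0 x y)) ler_sqr ?nnegrE ?sqrtr_ge0//.
apply: rV_norm_le; first exact: sqrtr_ge0.
by move=> i; rewrite -ler_sqr ?nnegrE ?sqrtr_ge0// sqr_sqrtr ?wdist_ge0.
Qed.

Lemma wdist_coord i j x y :
  `|(x ord0 i - y ord0 i) * (x ord0 j - y ord0 j)| <= wdist x y.
Proof.
apply: le_trans (wdist_norm x y); rewrite normrM.
by apply: ler_pM => //; [have := ler_coord_norm (x - y) i|have := ler_coord_norm (x - y) j];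
  rewrite !mxE.
Qed.

Lemma enorm_le d x y : 0 <= d -> (enorm (x - y) <= d) = (wdist x y <= d * d).
Proof.
move=> d0; have -> : enorm (x - y) = Num.sqrt (wdist x y).
  by rewrite /enorm; congr Num.sqrt; apply: eq_bigr => i _; rewrite !mxE expr2.
by rewrite -{1}(ger0_norm d0) -sqrtr_sqr ler_sqrt ?sqr_ge0// expr2.
Qed.

Lemma wdistC x y : wdist x y = wdist y x.
Proof. by apply: eq_bigr => i _; ring. Qed.

Lemma wdist_xx x : wdist x x = 0.
Proof. by rewrite /wdist big1// => i _; rewrite subrr mul0r. Qed.

Lemma wdist_eq0 x y : wdist x y = 0 -> x = y.
Proof.
move=> xy0; have := wdist_norm x y; rewrite xy0 -expr2 => H.
have : `|x - y| ^+ 2 = 0 by apply/eqP; rewrite eq_le H sqr_ge0.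
by move/eqP; rewrite sqrf_eq0 normr_eq0 subr_eq0 => /eqP.
Qed.

Lemma wdist_ray y z (t : R) : wdist (y + t *: (z - y)) y = t * t * wdist z y.
Proof. by rewrite /wdist mulr_sumr; apply: eq_bigr => i _; rewrite !mxE; ring. Qed.

Lemma wdist_continuous y : continuous (fun x => wdist x y).
Proof.
apply: continuous_sumR => i x.
have c : continuous (fun x : V => x ord0 i - y ord0 i).
  by move=> z; exact: (cvgB (smooth_cont (@smooth_coord R n i) z) (cvg_cst (y ord0 i))).
exact: (cvgM (c x) (c x)).
Qed.

Lemma wdist_compact y d : compact [set x | wdist x y <= d * d].
Proof.
apply: (@subclosed_compact _ _ [set x | `|x - y| <= `|d|]); last 1 first.
- move=> x /= xd; rewrite -ler_sqr ?nnegrE// !expr2 -normrM -(expr2 d) ger0_norm ?sqr_ge0//.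
  exact: le_trans (wdist_norm x y) _.
- have -> : [set x | wdist x y <= d * d] = (fun x : V => wdist x y) @^-1` [set t | t <= d * d] by [].
  by apply: preimage_closed (@closed_le R _) => x _; exact: wdist_continuous.
- exact: compact_cball.
Qed.

Definition thick d S : set V := [set x | exists2 y, S y & wdist x y <= d * d].

Lemma sub_thick d S : S `<=` thick d S.
Proof. by move=> x Sx; exists x => //; rewrite wdist_xx -expr2 sqr_ge0. Qed.

Lemma thickS d S1 S2 : S1 `<=` S2 -> thick d S1 `<=` thick d S2.
Proof. by move=> S12 x [y /S12 Sy xy]; exists y. Qed.

Lemma thick_compact d S : compact S -> compact (thick d S).
Proof.
move=> kS.
have -> : thick d S = (fun p : V * V => p.1 + p.2) @` (S `*` [set z | wdist z 0 <= d * d]).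
  apply/seteqP; split=> [x [y Sy xy]|x [[y z] [/= Sy z0] <-]].
    exists (y, x - y) => /=; last by rewrite addrC subrK.
    split=> //=; congr (_ <= _): xy; apply: eq_bigr => i _; rewrite !mxE; ring.
  exists y => //; congr (_ <= _): z0; apply: eq_bigr => i _; rewrite !mxE; ring.
apply: continuous_compact; last by apply: compact_setX => //; exact: wdist_compact.
exact/continuous_subspaceT/add_continuous.
Qed.

(* A point outside [U] and closest to [y] is in the boundary of [U]. *)
Lemma thick_sub U d S : open U -> 0 < d -> S `<=` Udelta U d -> thick d S `<=` U.
Proof.
move=> oU d0 SU x [y /SU[Uy [r [dr Hr]]] xy]; apply: contrapT => nUx.
pose A := [set z | wdist z y <= d * d] `&` ~` U.
have kA : compact A.
  apply: compact_closedI; first exact: wdist_compact.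
  exact: open_closedC.
have [z] := @EVT_min_rV R n (fun x : V => wdist x y) A (ex_intro _ x (conj xy nUx)) kA
  (continuous_subspaceT (@wdist_continuous y)).
rewrite inE => -[/= zy nUz] zmin.
have zy0 : 0 < wdist z y.
  rewrite lt_neqAle wdist_ge0 andbT eq_sym; apply/eqP => /wdist_eq0 zE.
  by apply: nUz; rewrite zE.
(* Points of the segment before [z] are strictly closer to [y], so by minimality they lie in [U];
   hence [z] is a limit of points of [U]. *)
have rU t : 0 <= t -> t < 1 -> U (y + t *: (z - y)).
  move=> t0 t1; apply: contrapT => nU.
  have tt1 : t * t < 1 by nra.
  have := zmin (y + t *: (z - y)); rewrite inE wdist_ray => H.
  have : A (y + t *: (z - y)).
    split=> //=; rewrite wdist_ray; apply: le_trans zy.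
    by rewrite ler_piMl ?wdist_ge0// ltW.
  by move/H; apply/negP; rewrite -ltNge gtr_pMl.
have clz : closure U z.
  move=> B /nbhs_normP[e /= e0 HB].
  have rayE (s : R) : z - (y + s *: (z - y)) = (1 - s) *: (z - y).
    by rewrite scalerBl scale1r opprD addrA.
  pose t := 1 - Num.min 1 (e / (2 * (1 + `|z - y|))).
  have m0 : 0 < Num.min 1 (e / (2 * (1 + `|z - y|))).
    by rewrite lt_min ltr01 divr_gt0// mulr_gt0// ltr_wpDr.
  have m1 : Num.min 1 (e / (2 * (1 + `|z - y|))) <= 1 by rewrite ge_min lexx.
  exists (y + t *: (z - y)); split; first by apply: rU; rewrite /t; lra.
  apply: HB => /=.
  rewrite rayE.
  rewrite normrZ /t opprB addrC subrK ger0_norm; last exact: ltW.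
  have : Num.min 1 (e / (2 * (1 + `|z - y|))) <= e / (2 * (1 + `|z - y|)).
    by rewrite ge_min lexx orbT.
  move/(ler_wpM2r (normr_ge0 (z - y))) => /le_lt_trans; apply.
  have p0 : 0 < 2 * (1 + `|z - y|) by rewrite mulr_gt0// ltr_wpDr.
  by rewrite mulrAC ltr_pdivrMr// ltr_pM2l//; have := normr_ge0 (z - y); lra.
have := Hr z (conj clz nUz); apply/negP; rewrite -ltNge; apply: le_lt_trans dr.
by rewrite enorm_le ?(ltW d0)// wdistC.
Qed.

Lemma Udelta_sub U d : Udelta U d `<=` U.
Proof. by move=> x []. Qed.

Definition near_ind d x y : R := if enorm (x - y) <= d then 1 else 0.

Lemma near_indE d x y : 0 <= d -> near_ind d x y = if wdist x y <= d * d then 1 else 0.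
Proof. by move=> d0; rewrite /near_ind enorm_le. Qed.

End Neighbourhood.

(** * Uniform convergence of products with all derivatives *)

Section UniformProducts.
Variables (R : realType) (n : nat).
Local Notation V := (Rn R n).
Implicit Types (f g p : V -> R) (x : V) (s : seq 'I_n).

Lemma dparts_rcons s i f : dparts (rcons s i) f = dparts s (dpart i f).
Proof. by elim: s => //= j s ->. Qed.

Lemma dparts_add s f g : smooth f -> smooth g ->
  dparts s (fun x => f x + g x) = (fun x => dparts s f x + dparts s g x).
Proof.
move=> sf sg; elim: s => //= i s ->; rewrite dpartD// => x; apply: smooth_derivable.
  exact: smooth_dparts.
exact: smooth_dparts.
Qed.

Lemma dparts_scale s (c : R) f : smooth f ->
  dparts s (fun x => c * f x) = (fun x => c * dparts s f x).
Proof.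
move=> sf; elim: s => //= i s ->; rewrite dpartM.
- by apply: funext => x; rewrite dpart_cst mulr0 addr0.
- by move=> x; exact: is_derivable (is_derive_cstf _ _ _).
- by move=> x; apply: smooth_derivable; exact: smooth_dparts.
Qed.

Lemma dparts_sub s f g : smooth f -> smooth g ->
  dparts s (fun x => f x - g x) = (fun x => dparts s f x - dparts s g x).
Proof.
move=> sf sg; have -> : (fun x => f x - g x) = (fun x => f x + (-1) * g x).
  by apply: funext => x; rewrite mulN1r.
rewrite dparts_add//; last exact: smooth_scale.
by rewrite dparts_scale//; apply: funext => x; rewrite mulN1r.
Qed.

Lemma unif_dpart (fk : nat -> V -> R) f i : unif_all_deriv fk f ->
  unif_all_deriv (fun k => dpart i (fk k)) (dpart i f).
Proof.
move=> H s e e0; have [N HN] := H (rcons s i) e e0.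
by exists N => k Nk x; rewrite -!dparts_rcons; exact: HN.
Qed.

(** Induction from the innermost derivative, with [p] and the functions generalized: the product
    rule leaves two products of the same shape. The common compact set [A] bounds the
    multipliers. *)
Lemma unif_mul (A : set V) (fk : nat -> V -> R) f p : compact A -> smooth p -> smooth f ->
  (forall k, smooth (fk k)) -> (forall k, fsupp (fk k) `<=` A) -> fsupp f `<=` A ->
  unif_all_deriv fk f -> unif_all_deriv (fun k x => p x * fk k x) (fun x => p x * f x).
Proof.
move=> kA + + + + + + s; elim/last_ind: s p fk f => [|s i IH] p fk f sp sf sfk fkA fA H e e0.
  have /compact_bounded[M [Mr HM]] : compact (p @` A).
    by apply: continuous_compact kA => x; exact: (continuous_subspaceT (smooth_cont sp)).
  have M0 : 0 < `|M| + 1 by rewrite ltr_wpDl.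
  have [N HN] := H [::] (e / (`|M| + 1)) (divr_gt0 e0 M0).
  exists N => k Nk x; rewrite /= -mulrBr normrM.
  have [Ax|Ax] := pselect (A x); last first.
    have -> : f x = 0 by apply: fsupp_out => /fA.
    have -> : fk k x = 0 by apply: fsupp_out => /fkA.
    by rewrite subrr normr0 mulr0.
  apply: (@le_lt_trans _ _ ((`|M| + 1) * `|fk k x - f x|)).
    apply: ler_wpM2r => //; apply: (HM (`|M| + 1)); last by exists x.
    by rewrite (le_lt_trans (ler_norm M))// ltrDl.
  by rewrite mulrC -ltr_pdivlMr//; exact: HN.
have d1 h : smooth h -> dpart i (fun x => p x * h x) =
    (fun x => p x * dpart i h x + dpart i p x * h x).
  move=> sh; rewrite dpartM; try by move=> x; exact: smooth_derivable.
  by apply: funext => x; rewrite (mulrC (h x)).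
have sub (h : V -> R) : smooth h -> fsupp (dpart i h) `<=` fsupp h.
  by move=> sh; apply: fsupp_sub; [exact: fsupp_closed|exact: dpart_out].
have e2 : 0 < e / 2 by rewrite divr_gt0.
have sdp : smooth (dpart i p) by exact: smooth_dpart.
have sdk k : smooth (dpart i (fk k)) by exact: smooth_dpart.
have [N1 H1] := IH p (fun k => dpart i (fk k)) (dpart i f) sp (smooth_dpart i sf)
  sdk (fun k => subset_trans (sub _ (sfk k)) (fkA k)) (subset_trans (sub _ sf) fA) (unif_dpart i H) _ e2.
have [N2 H2] := IH (dpart i p) fk f sdp sf sfk fkA fA H _ e2.
exists (maxn N1 N2) => k; rewrite geq_max => /andP[/H1{}H1 /H2{}H2] x.
rewrite !dparts_rcons !d1// !dparts_add; try by apply: smooth_mul => //; exact: smooth_dpart.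
rewrite opprD addrACA (splitr e); apply: le_lt_trans (ler_normD _ _) _.
by apply: ltrD; [exact: H1|exact: H2].
Qed.

End UniformProducts.

(** * The form on finite-rank kernels and the Beurling-Deny expansion *)

Section BeurlingDeny.
Variables (R : realType) (n : nat) (U : set (Rn R n)).
Variables (m : {measure set (Bor R n) -> \bar R}).
Variables (D : set (Rn R n -> R)) (E : (Rn R n -> R) -> (Rn R n -> R) -> R).
Variable J : {measure set (Bor R n * Bor R n) -> \bar R}.
Variable K : {measure set (Bor R n) -> \bar R}.
Local Notation V := (Rn R n).
Local Notation T := (Bor R n).
Implicit Types (F G : V -> V -> R) (a b chi u v : V -> R) (x y : V) (i j : 'I_n).
Hypothesis oU : open U.
Hypothesis SD : semi_dirichlet m D E.
Hypothesis CD : forall f, Cc_inf U f -> D f.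
Hypothesis JK : jump_kill U E J K.

(* [teval F r]: [F] is a finite sum of functions [a x * b y] and [r] is the
   corresponding value of [- E]. *)
Definition teval F (r : R) := exists (I : finType) (a b : I -> V -> R),
  [/\ forall k, Cc_inf U (a k), forall k, Cc_inf U (b k),
      forall x y, F x y = \sum_k a k x * b k y & r = - \sum_k E (a k) (b k)].

Definition tensor F := exists r, teval F r.

Let Dsub : lin_subspace D.
Proof. by case: SD => _ [D0 [Dl _]]; split. Qed.

Lemma form_bilin : bilin_on (Cc_inf U) E.
Proof.
case: SD => _ [_ [_ [_ [El _]]]].
by split=> h Ch c f g Cf Cg; have [] := El c f g h (CD Cf) (CD Cg) (CD Ch).
Qed.

Lemma teval_ge0 F r : teval F r -> (forall x y, 0 <= F x y) -> (forall x, F x x = 0) -> 0 <= r.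
Proof.
move=> [I [a [b [Ca Cb FE ->]]]] F0 Fd; rewrite oppr_ge0.
apply: (semi_dirichlet_sum_le0 SD) => [k|k|k|y|x].
- exact/CD.
- exact/CD.
- exact/smooth_cont/(Cc_smooth (Cb k)).
- have ex k : exists M : R, forall x, `|a k x| <= M.
    by have [M _ HM] := Cc_bounded (Ca k); exists M.
  pose M k := projT1 (cid (ex k)).
  have HM k x : `|a k x| <= M k by rewrite /M; case: cid.
  exists (\sum_k M k * `|b k y|) => x; rewrite -FE F0/= FE.
  apply: ler_sum => k _; apply: le_trans (ler_norm _) _.
  by rewrite normrM ler_wpM2r.
- by rewrite -FE.
Qed.

Lemma teval_lin c F G r s : teval F r -> teval G s ->
  teval (fun x y => c * F x y + G x y) (c * r + s).
Proof.
move=> [I [a [b [Ca Cb FE ->]]]] [I' [a' [b' [Ca' Cb' GE ->]]]].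
exists (I + I')%type, (fun k => match k with inl i => fun x => c * a i x | inr i => a' i end),
  (fun k => match k with inl i => b i | inr i => b' i end); split.
- by case=> i //; exact: Cc_scale.
- by case.
- move=> x y; rewrite big_sumType/= FE GE mulr_sumr; congr (_ + _).
  by apply: eq_bigr => k _; rewrite mulrA.
- rewrite big_sumType/= mulrN mulr_sumr opprD; congr (- _ - _).
  by apply: eq_bigr => k _; rewrite (lin_onZ (Cc_subspace U) (form_bilin.1 _ (Cb k))).
Qed.

Lemma teval_ext F G r : (forall x y, F x y = G x y) -> teval F r -> teval G r.
Proof. by move=> FG [I [a [b [Ca Cb FE ->]]]]; exists I, a, b; split=> // x y; rewrite -FG. Qed.

(** The difference of two decompositions represents the zero kernel, which is nonnegative and
    vanishes on the diagonal, so positivity applies in both directions. *)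
Lemma teval_uniq F r s : teval F r -> teval F s -> r = s.
Proof.
have key t t' : teval F t -> teval F t' -> t <= t'.
  move=> h h'; have : 0 <= -1 * t + t'.
    by apply: (teval_ge0 (teval_lin (-1) h h')) => [x y|x]; rewrite mulN1r addNr.
  lra.
by move=> Hr Hs; apply/le_anti; rewrite !key.
Qed.

Definition tform F : R := xget 0 [set r | teval F r].

Lemma tformP F : tensor F -> teval F (tform F).
Proof. by move=> [r Hr]; rewrite /tform; apply: (@xgetPex _ 0 [set r | teval F r]); exists r. Qed.

Lemma tformE F r : teval F r -> tform F = r.
Proof. by move=> H; apply: (teval_uniq (tformP (ex_intro _ r H)) H). Qed.

Lemma tensor_lin c F G : tensor F -> tensor G -> tensor (fun x y => c * F x y + G x y).
Proof. by move=> [r Hr] [s Hs]; exists (c * r + s); exact: teval_lin. Qed.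

Lemma tform_lin c F G : tensor F -> tensor G ->
  tform (fun x y => c * F x y + G x y) = c * tform F + tform G.
Proof. by move=> TF TG; apply: tformE; apply: teval_lin; exact: tformP. Qed.

Lemma tensor_ext F G : tensor F -> (forall x y, F x y = G x y) -> tensor G.
Proof. by move=> [r Hr] FG; exists r; exact: teval_ext Hr. Qed.

Lemma tform_mono F G : tensor F -> tensor G -> (forall x y, F x y <= G x y) ->
  (forall x, F x x = G x x) -> tform F <= tform G.
Proof.
move=> TF TG FG FGd; rewrite -subr_ge0.
have H := teval_lin (-1) (tformP TF) (tformP TG).
have -> : tform G - tform F = -1 * tform F + tform G by ring.
by apply: (teval_ge0 H) => [x y|x]; rewrite mulN1r addrC ?subr_ge0// FGd subrr.
Qed.

Lemma teval_prod a b : Cc_inf U a -> Cc_inf U b -> teval (fun x y => a x * b y) (- E a b).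
Proof.
by move=> Ca Cb; exists unit, (fun=> a), (fun=> b); split=> // *; rewrite big_const card_unit/= addr0.
Qed.

Lemma tensor_prod a b : Cc_inf U a -> Cc_inf U b -> tensor (fun x y => a x * b y).
Proof. by move=> Ca Cb; exists (- E a b); exact: teval_prod. Qed.

Lemma tform_prod a b : Cc_inf U a -> Cc_inf U b -> tform (fun x y => a x * b y) = - E a b.
Proof. by move=> Ca Cb; apply: tformE; exact: teval_prod. Qed.

Lemma tensor_mul F (p q : V -> R) : smooth p -> smooth q -> tensor F ->
  tensor (fun x y => F x y * (p x * q y)).
Proof.
move=> sp sq [r [I [a [b [Ca Cb FE _]]]]]; eexists; exists I, (fun k x => a k x * p x),
  (fun k y => b k y * q y); split; last by reflexivity.
- by move=> k; exact: Cc_mul.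
- by move=> k; exact: Cc_mul.
- by move=> x y; rewrite FE mulr_suml; apply: eq_bigr => k _; ring.
Qed.

Lemma tensor_add F G : tensor F -> tensor G -> tensor (fun x y => F x y + G x y).
Proof. by move=> TF TG; apply: (tensor_ext (tensor_lin 1 TF TG)) => x y; rewrite mul1r. Qed.

Lemma tensor0 : tensor (fun _ _ => 0).
Proof.
have C0 := @Cc0 R n U.
by apply: (tensor_ext (tensor_prod C0 C0)) => x y; rewrite mul0r.
Qed.

Lemma tensor_scale c F : tensor F -> tensor (fun x y => c * F x y).
Proof. by move=> TF; apply: (tensor_ext (tensor_lin c TF tensor0)) => x y; rewrite addr0. Qed.

Lemma tform0 : tform (fun _ _ => 0) = 0.
Proof.
have H := tform_lin 1 tensor0 tensor0.
have E0 : (fun _ _ : V => 1 * 0 + 0 : R) = (fun _ _ => 0).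
  by apply: funext => x; apply: funext => y; rewrite mulr0 addr0.
by rewrite E0 in H; lra.
Qed.

Lemma tform_scale c F : tensor F -> tform (fun x y => c * F x y) = c * tform F.
Proof.
move=> TF; rewrite -[RHS]addr0 -tform0 -(tform_lin c TF tensor0); congr tform.
by apply: funext => x; apply: funext => y; rewrite addr0.
Qed.

Lemma tform_add F G : tensor F -> tensor G ->
  tform (fun x y => F x y + G x y) = tform F + tform G.
Proof.
move=> TF TG; rewrite -[tform F]mul1r -(tform_lin 1 TF TG); congr tform.
by apply: funext => x; apply: funext => y; rewrite mul1r.
Qed.

Lemma tensor_sum (I : Type) (s : seq I) (F : I -> V -> V -> R) :
  (forall k, tensor (F k)) -> tensor (fun x y => \sum_(k <- s) F k x y).
Proof.
move=> TF; elim: s => [|k s IH].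
  by apply: (tensor_ext tensor0) => x y; rewrite big_nil.
by apply: (tensor_ext (tensor_add (TF k) IH)) => x y; rewrite big_cons.
Qed.

Lemma tform_sum (I : Type) (s : seq I) (F : I -> V -> V -> R) :
  (forall k, tensor (F k)) -> tform (fun x y => \sum_(k <- s) F k x y) = \sum_(k <- s) tform (F k).
Proof.
move=> TF; elim: s => [|k s IH].
  rewrite big_nil -[RHS]tform0; congr tform; apply: funext => x; apply: funext => y; exact: big_nil.
rewrite big_cons -IH -tform_add//; last exact: tensor_sum.
by congr tform; apply: funext => x; apply: funext => y; exact: big_cons.
Qed.

Lemma tensor_diff F i : tensor F -> tensor (fun x y => F x y * (x ord0 i - y ord0 i)).
Proof.
move=> TF; have s1 := @smooth_cst R n 1; have sc := @smooth_coord R n i.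
apply: (tensor_ext (tensor_lin (-1) (tensor_mul s1 sc TF) (tensor_mul sc s1 TF))) => x y.
ring.
Qed.

Lemma tensor_supp F : tensor F -> exists S : set V, compact S /\
  forall x y, F x y != 0 -> S x /\ S y.
Proof.
move=> [r [I [a [b [Ca Cb FE _]]]]].
exists (\big[setU/set0]_(k <- enum I) (fsupp (a k) `|` fsupp (b k))); split.
  by apply: bigsetU_compact => k _; apply: compactU; [exact: Cc_compact (Ca k)|exact: Cc_compact (Cb k)].
move=> x y; rewrite FE => Fxy.
have [k kx ky] : exists2 k, a k x != 0 & b k y != 0.
  apply: contrapT => H; move/eqP: Fxy; apply; apply: big1 => k _.
  apply/eqP/negPn/negP; rewrite mulf_eq0 negb_or => /andP[k1 k2]; apply: H; by exists k.
rewrite -bigcup_seq; split; exists k => /=; rewrite ?mem_enum//.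
  by left; exact: subset_closure.
by right; exact: subset_closure.
Qed.

(** * Integration of kernels against the jumping measure *)

Definition measurable2 F := measurable_fun [set: T * T] (fun p : T * T => F p.1 p.2).
Definition Jable F := J.-integrable (offdiag U) (fun p => (F p.1 p.2)%:E).
Definition Jint F : R := Rintegral J (offdiag U) (fun p => F p.1 p.2).

Lemma measurable2_prod a b : continuous a -> continuous b -> measurable2 (fun x y => a x * b y).
Proof.
move=> ca cb; apply: measurable_funM.
  exact: (measurableT_comp (continuous_borel ca) measurable_fst).
exact: (measurableT_comp (continuous_borel cb) measurable_snd).
Qed.

Lemma measurable2_fst a : continuous a -> measurable2 (fun x _ => a x).
Proof. by move=> ca; exact: (measurableT_comp (continuous_borel ca) measurable_fst). Qed.

Lemma measurable2_snd a : continuous a -> measurable2 (fun _ y => a y).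
Proof. by move=> ca; exact: (measurableT_comp (continuous_borel ca) measurable_snd). Qed.

Lemma measurable2_diff i : measurable2 (fun x y => x ord0 i - y ord0 i).
Proof.
have ci : continuous (fun x : V => x ord0 i) by exact/smooth_cont/smooth_coord.
exact: measurable_funB (measurable2_fst ci) (measurable2_snd ci).
Qed.

(** Measurability refers to the product of the Borel sigma-algebras, so x <> y is expressed through
    the coordinate differences. *)
Lemma measurable_offdiag : measurable (offdiag U).
Proof.
have mU : measurable (U : set T) by exact: open_borel.
have -> : offdiag U = ([set p : T * T | U p.1] `&` [set p | U p.2]) `&`
    \big[setU/set0]_(i <- enum 'I_n) [set p : T * T | p.1 ord0 i - p.2 ord0 i != 0].
  apply/seteqP; split=> -[x y].
    move=> [/= Ux [Uy xy]]; split=> //.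
    have [i xi] : exists i, x ord0 i - y ord0 i != 0.
      apply: contrapT => H; apply: xy; apply/rowP => i; apply/eqP; rewrite -subr_eq0.
      by apply: contrapT => /negP xi; apply: H; exists i.
    by rewrite -bigcup_seq; exists i => //=; rewrite mem_enum.
  rewrite -bigcup_seq => -[[/= Ux Uy] [i _ /= xi]]; split=> //; split=> //.
  by move=> /= xy; move: xi; rewrite xy subrr eqxx.
apply: measurableI; first apply: measurableI.
- by rewrite -[X in measurable X]setTI; exact: measurable_fst.
- by rewrite -[X in measurable X]setTI; exact: measurable_snd.
- apply: bigsetU_measurable => i _.
  have := measurable2_diff i measurableT (measurableC (measurable_set1 (0 : R))).
  rewrite setTI; congr measurable; apply/seteqP; split=> p /= /eqP//.
Qed.

Local Hint Resolve measurable_offdiag : core.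

Lemma Jable_le F G : measurable2 F -> Jable G -> (forall x y, `|F x y| <= G x y) -> Jable F.
Proof.
move=> mF JG FG; apply: le_integrable JG => //.
  by apply/measurable_EFinP; exact: measurable_funTS mF.
by move=> p _; rewrite /= lee_fin (le_trans (FG _ _))// ler_norm.
Qed.

Lemma Jable_lin c F G : Jable F -> Jable G -> Jable (fun x y => c * F x y + G x y).
Proof.
move=> JF JG; rewrite /Jable; under eq_fun do rewrite EFinD EFinM.
by apply: integrableD => //; exact: integrableZl.
Qed.

Lemma Jint_lin c F G : Jable F -> Jable G ->
  Jint (fun x y => c * F x y + G x y) = c * Jint F + Jint G.
Proof.
move=> JF JG; rewrite /Jint RintegralD//; first by rewrite RintegralZl.
exact: (integrableZl measurable_offdiag c JF).
Qed.

Lemma Jable0 : Jable (fun _ _ => 0).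
Proof. exact: integrable0. Qed.

Lemma Jint0 : Jint (fun _ _ => 0) = 0.
Proof. by rewrite /Jint /Rintegral integral0. Qed.

Lemma Jable_ext F G : Jable F -> (forall x y, F x y = G x y) -> Jable G.
Proof.
by move=> JF FG; have -> : G = F by apply: funext => x; apply: funext => y.
Qed.

Lemma Jint_ext F G : (forall x y, F x y = G x y) -> Jint F = Jint G.
Proof. by move=> FG; congr Jint; apply: funext => x; apply: funext => y. Qed.

Lemma Jable_scale c F : Jable F -> Jable (fun x y => c * F x y).
Proof. by move=> JF; apply: (Jable_ext (Jable_lin c JF Jable0)) => x y; rewrite addr0. Qed.

Lemma Jint_scale c F : Jable F -> Jint (fun x y => c * F x y) = c * Jint F.
Proof.
by move=> JF; rewrite -[RHS]addr0 -Jint0 -Jint_lin//; [apply: Jint_ext => x y; rewrite addr0|exact: Jable0].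
Qed.

Lemma Jable_add F G : Jable F -> Jable G -> Jable (fun x y => F x y + G x y).
Proof. by move=> JF JG; apply: (Jable_ext (Jable_lin 1 JF JG)) => x y; rewrite mul1r. Qed.

Lemma Jint_add F G : Jable F -> Jable G -> Jint (fun x y => F x y + G x y) = Jint F + Jint G.
Proof.
by move=> JF JG; rewrite -[Jint F]mul1r -Jint_lin//; apply: Jint_ext => x y; rewrite mul1r.
Qed.

Lemma Jable_sub F G : Jable F -> Jable G -> Jable (fun x y => F x y - G x y).
Proof.
by move=> JF JG; apply: (Jable_ext (Jable_lin (-1) JG JF)) => x y; rewrite mulN1r addrC.
Qed.

Lemma Jable_sum (I : Type) (s : seq I) (F : I -> V -> V -> R) :
  (forall k, Jable (F k)) -> Jable (fun x y => \sum_(k <- s) F k x y).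
Proof.
move=> JF; elim: s => [|k s IH].
  by apply: (Jable_ext Jable0) => x y; rewrite big_nil.
by apply: (Jable_ext (Jable_add (JF k) IH)) => x y; rewrite big_cons.
Qed.

Lemma Jint_sum (I : Type) (s : seq I) (F : I -> V -> V -> R) :
  (forall k, Jable (F k)) -> Jint (fun x y => \sum_(k <- s) F k x y) = \sum_(k <- s) Jint (F k).
Proof.
move=> JF; elim: s => [|k s IH].
  by rewrite big_nil -[RHS]Jint0; apply: Jint_ext => x y; rewrite big_nil.
rewrite big_cons -IH -Jint_add//; last exact: Jable_sum.
by apply: Jint_ext => x y; rewrite big_cons.
Qed.

Lemma Jint_mono F G : Jable F -> Jable G -> (forall x y, F x y <= G x y) -> Jint F <= Jint G.
Proof. by move=> JF JG FG; apply: le_Rintegral. Qed.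

Lemma Jint_norm F G : Jable F -> Jable G -> (forall x y, `|F x y| <= G x y) -> `|Jint F| <= Jint G.
Proof.
move=> JF JG FG; rewrite ler_norml; apply/andP; split.
  rewrite -mulN1r -Jint_scale//; apply: Jint_mono => //; first exact: Jable_scale.
  by move=> x y; rewrite mulN1r; have := FG x y; rewrite ler_norml => /andP[].
by apply: Jint_mono => // x y; exact: le_trans (ler_norm _) (FG x y).
Qed.

Lemma JintE F : Jable F -> (\int[J]_(p in offdiag U) (F p.1 p.2)%:E)%E = (Jint F)%:E.
Proof. by move=> JF; rewrite /Jint /Rintegral fineK//; exact: integrable_fin_num. Qed.

Lemma Jable_fin F : measurable2 F ->
  (\int[J]_(p in offdiag U) (F p.1 p.2)%:E)%E \is a fin_num -> Jable F.
Proof.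
move=> mF Ffin; have mF' : measurable_fun (offdiag U) (fun p : T * T => F p.1 p.2).
  exact: measurable_funTS mF.
apply/integrableP; split; first exact/measurable_EFinP.
by rewrite integral_fin_num_abs.
Qed.

(** * Comparison of the form with the jumping measure *)

Lemma tensor_measurable2 F : tensor F -> measurable2 F.
Proof.
move=> [r [I [a [b [Ca Cb FE _]]]]].
have -> : F = (fun x y => \sum_k a k x * b k y).
  by apply: funext => x; apply: funext => y.
apply: measurable_sum => k; apply: measurable2_prod.
  exact/smooth_cont/(Cc_smooth (Ca k)).
exact/smooth_cont/(Cc_smooth (Cb k)).
Qed.

(** The defining identity of J and K with locally constant value 0: the killing term and a(y) b(y)
    drop out, which leaves -2 a(x) b(y). *)
Lemma jump_disjoint a b (W : set V) : Cc_inf U a -> Cc_inf U b -> open W ->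
  fsupp b `<=` W -> (forall x, W x -> a x = 0) ->
  Jable (fun x y => a x * b y) /\ - E a b = 2 * Jint (fun x y => a x * b y).
Proof.
move=> Ca Cb oW bW aW; have [_ [_ H]] := JK.
have ab x : a x * b x = 0.
  have [xb|/fsupp_out ->] := pselect (fsupp b x); last by rewrite mulr0.
  by rewrite aW ?mul0r//; exact: bW.
have {H} := H a b Ca Cb (ex_intro _ W (conj oW (conj bW (ex_intro _ 0 aW)))).
rewrite [X in (_ + X)%E]integral0_eq ?adde0; last by move=> x _; rewrite ab.
have E1 : (\int[J]_(p in offdiag U) (2 * (a p.2 - a p.1) * b p.2)%:E =
  \int[J]_(p in offdiag U) ((fun x y => -2 * (a x * b y)) p.1 p.2)%:E)%E.
  by apply: eq_integral => p _; congr EFin; have := ab p.2; lra.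
rewrite E1 => H.
have mab : measurable2 (fun x y => -2 * (a x * b y)).
  apply: measurable_funM => //; apply: measurable2_prod; apply: smooth_cont.
    exact: Cc_smooth Ca.
  exact: Cc_smooth Cb.
(* Integrability comes from the identity itself, since its left-hand side is a real number. *)
have J2 : Jable (fun x y => -2 * (a x * b y)).
  by apply: Jable_fin => //; rewrite -H.
have J1 : Jable (fun x y => a x * b y).
  by apply: (Jable_ext (Jable_scale (- 2^-1) J2)) => x y; field.
split=> //; move: H; rewrite (JintE J2) => -[->].
by rewrite (Jint_scale _ J1); ring.
Qed.

(* [theta x y = \sum_l (1 - phi' l x) * phi l y] for a partition of unity [phi] of
   mesh [e]: each summand is a product with disjoint supports. *)
Lemma theta_exists (S : set V) (e : R) : compact S -> 0 < e ->
  exists theta : V -> V -> R,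
    [/\ forall x y, 0 <= theta x y <= 1,
        forall x y, S y -> e < `|x - y| -> theta x y = 1 &
        forall F, tensor F -> [/\ tensor (fun x y => F x y * theta x y),
          Jable (fun x y => F x y * theta x y) &
          tform (fun x y => F x y * theta x y) = 2 * Jint (fun x y => F x y * theta x y)]].
Proof.
move=> kS e0; have [N [phi [phi' [sphi phi0 phi1 phiW phie]]]] := partition_exists kS e0.
exists (fun x y => \sum_l (1 - phi' l x) * phi l y); split.
- move=> x y; have p0 l : 0 <= 1 - phi' l x <= 1.
    by have [_ /andP[]] := phi0 l x; lra.
  apply/andP; split.
    by apply: sumr_ge0 => l _; rewrite mulr_ge0//; [have /andP[] := p0 l|have [] := phi0 l y].
  apply: le_trans (phi1 y).1; apply: ler_sum => l _.
  by rewrite ler_piMl//; [have [] := phi0 l y|have /andP[] := p0 l].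
- move=> x y Sy xy; transitivity (\sum_l phi l y); last exact: (phi1 y).2.
  apply: eq_bigr => l _.
  have [->|py] := eqVneq (phi l y) 0; first by rewrite mulr0.
  have [->|px] := eqVneq (phi' l x) 0; first by rewrite subr0 mul1r.
  by have := phie l x y py px; rewrite leNgt xy.
- move=> F TF; have s1 := @smooth_cst R n 1.
  have sq l : smooth (fun x => 1 - phi' l x) by apply: smooth_sub => //; exact: (sphi l).2.
  have [r [I [a [b [Ca Cb FE rE]]]]] := TF.
  pose G (q : I * 'I_N) x y := (a q.1 x * (1 - phi' q.2 x)) * (b q.1 y * phi q.2 y).
  have GE x y : F x y * (\sum_l (1 - phi' l x) * phi l y) = \sum_q G q x y.
    rewrite FE big_distrlr/= pair_big/=; apply: eq_bigr => -[k l] _ /=; rewrite /G/=; ring.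
  have CaG q : Cc_inf U (fun x => a q.1 x * (1 - phi' q.2 x)) by exact: Cc_mul.
  have CbG q : Cc_inf U (fun y => b q.1 y * phi q.2 y) by apply: Cc_mul => //; exact: (sphi q.2).1.
  have TG q : tensor (G q) by exact: tensor_prod.
  have HG q : Jable (G q) /\ - E (fun x => a q.1 x * (1 - phi' q.2 x)) (fun y => b q.1 y * phi q.2 y) = 2 * Jint (G q).
    have [W [oW pW W1]] := phiW q.2.
    apply: (@jump_disjoint _ _ W) => //; last by move=> x /W1 ->; rewrite subrr mulr0.
    apply: subset_trans pW; apply: fsupp_sub; first exact: fsupp_closed.
    by move=> x /fsupp_out ->; rewrite mulr0.
  have fE : (fun x y => F x y * \sum_l (1 - phi' l x) * phi l y) = (fun x y => \sum_q G q x y).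
    by apply: funext => x; apply: funext => y.
  rewrite fE; split.
  + exact: tensor_sum.
  + by apply: Jable_sum => // q; exact: (HG q).1.
  + rewrite tform_sum// Jint_sum//; last by move=> q; exact: (HG q).1.
    rewrite mulr_sumr; apply: eq_bigr => q _; rewrite -(HG q).2.
    exact: tform_prod.
Qed.

(* Fatou along mesh tending to [0]. *)
Lemma tensor_Jable F : tensor F -> (forall x y, 0 <= F x y) -> (forall x, F x x = 0) ->
  Jable F /\ 2 * Jint F <= tform F.
Proof.
move=> TF F0 Fd; have [S [kS FS]] := tensor_supp TF.
have i0 (k : nat) : 0 < k.+1%:R^-1 :> R by rewrite invr_gt0.
have ex k := theta_exists kS (i0 k).
pose th k := projT1 (cid (ex k)).
have th01 k x y : 0 <= th k x y <= 1 by rewrite /th; case: cid => ? [].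
have th1 k x y : S y -> k.+1%:R^-1 < `|x - y| -> th k x y = 1.
  by move: x y; rewrite /th; case: cid => ? [].
have thF k : [/\ tensor (fun x y => F x y * th k x y), Jable (fun x y => F x y * th k x y) &
   tform (fun x y => F x y * th k x y) = 2 * Jint (fun x y => F x y * th k x y)].
  by rewrite /th; case: cid => t [H1 H2 H3] /=; exact: H3.
have tle k : 2 * Jint (fun x y => F x y * th k x y) <= tform F.
  have [TFk _ <-] := thF k; apply: tform_mono => // [x y|x]; last by rewrite Fd mul0r.
  by rewrite ler_piMr//; have /andP[] := th01 k x y.
have mF := tensor_measurable2 TF.
have mFo : measurable_fun (offdiag U) (fun p : T * T => (F p.1 p.2)%:E).
  by apply/measurable_EFinP; exact: measurable_funTS mF.
have key : (\int[J]_(p in offdiag U) (F p.1 p.2)%:E <= (2^-1 * tform F)%:E)%E.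
  pose f k (p : T * T) := (F p.1 p.2 * th k p.1 p.2)%:E.
  have mf k : measurable_fun (offdiag U) (f k).
    by apply/measurable_EFinP; apply: measurable_funTS; have [/tensor_measurable2] := thF k.
  have f0 k (p : T * T) : offdiag U p -> (0 <= f k p)%E.
    by move=> _; rewrite lee_fin mulr_ge0//; have /andP[] := th01 k p.1 p.2.
  have lim (p : T * T) : offdiag U p -> f^~ p @ \oo --> (F p.1 p.2)%:E.
    move=> [_ [_ xy]]; have [Sy|nSy] := pselect (S p.2); last first.
      have F00 : F p.1 p.2 = 0 by apply: contrapT => /eqP/FS[].
      by apply: cvg_near_cst; exists 0%N => // k _; rewrite /f F00 mul0r.
    have d0 : 0 < `|p.1 - p.2 : V| by rewrite normr_gt0 subr_eq0; apply/eqP.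
    have [N _ HN] := near_infty_natSinv_lt (PosNum d0).
    by apply: cvg_near_cst; exists N => // k Nk; rewrite /f th1 ?mulr1//; exact: HN.
  have -> : (\int[J]_(p in offdiag U) (F p.1 p.2)%:E
     = \int[J]_(p in offdiag U) limn_einf (f^~ p))%E.
    apply: eq_integral => p /set_mem Op; rewrite is_cvg_limn_einfE; last by apply/cvg_ex; eexists; exact: lim.
    exact/esym/cvg_lim/lim.
  apply: le_trans (fatou J measurable_offdiag mf f0) _.
  rewrite limn_einf_lim; apply: lime_le; first exact: is_cvg_einfs.
  apply: nearW => k; apply: (@le_trans _ _ (\int[J]_(p in offdiag U) f k p)%E).
    by apply: ereal_inf_lbound; exists k => /=.
  have [_ JFk _] := thF k.
  have -> : (\int[J]_(p in offdiag U) f k p = (Jint (fun x y => F x y * th k x y))%:E)%E.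
    exact: (JintE JFk).
  by rewrite lee_fin; have := tle k; lra.
have JF : Jable F.
  apply: Jable_fin => //; rewrite ge0_fin_numE.
    exact: le_lt_trans key (ltry _).
  by apply: integral_ge0 => p _; rewrite lee_fin.
split=> //; move: key; rewrite (JintE JF) lee_fin; lra.
Qed.

(* On [1 - theta] the distance is at most the mesh, so [F] vanishing faster than [G] on
   the diagonal leaves nothing there. *)
Lemma tform_third_order F G : tensor F -> tensor G -> (forall x y, 0 <= G x y) ->
  (forall x, G x x = 0) -> (forall x y, `|F x y| <= `|x - y| * G x y) ->
  Jable F /\ tform F = 2 * Jint F.
Proof.
move=> TF TG G0 Gd FG; have [S [kS FS]] := tensor_supp TF.
have [JG JGt] := tensor_Jable TG G0 Gd.
have [B [Br HB]] := compact_bounded kS.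
pose B' := `|B| + 1; have HB' x : S x -> `|x| <= B'.
  by apply: HB; rewrite (le_lt_trans (ler_norm B))// ltrDl.
have mF := tensor_measurable2 TF.
have JF : Jable F.
  apply: (Jable_le mF (Jable_scale (B' + B') JG)) => x y.
  have [->|Fxy] := eqVneq (F x y) 0.
    by rewrite normr0 mulr_ge0// addr_ge0// addr_ge0.
  have [Sx Sy] := FS x y Fxy; apply: le_trans (FG x y) _; rewrite ler_wpM2r//.
  by apply: le_trans (ler_normB _ _) _; rewrite lerD// HB'.
split=> //; have [S' [kS' GS']] := tensor_supp TG.
apply/eqP; rewrite -subr_eq0 -normr_le0; apply/ler_addgt0Pr => d d0; rewrite add0r.
(* The part within distance d / C of the diagonal contributes at most (d / C)(C - 1) to tform F - 2
   int F dJ; the summand 1 keeps [C] positive. *)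
pose C := tform G + 2 * Jint G + 1.
have JG0 : 0 <= Jint G by apply: Rintegral_ge0.
have C0 : 0 < C by rewrite /C; lra.
have e0 : 0 < d / C by rewrite divr_gt0.
have [th [th01 th1 thF]] := theta_exists (compactU kS kS') e0.
have [TFt JFt EFt] := thF F TF; have [TGt JGt' _] := thF G TG.
set e := d / C in e0 th1.
pose F1 x y := F x y - F x y * th x y; pose G1 x y := G x y - G x y * th x y.
have TF1 : tensor F1.
  by apply: (tensor_ext (tensor_lin (-1) TFt TF)) => x y; rewrite /F1; ring.
have TG1 : tensor G1.
  by apply: (tensor_ext (tensor_lin (-1) TGt TG)) => x y; rewrite /G1; ring.
have JF1 : Jable F1 by exact: Jable_sub.
have FG1 x y : `|F1 x y| <= e * G1 x y.
  have -> : F1 x y = (1 - th x y) * F x y by rewrite /F1; ring.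
  have -> : e * G1 x y = (1 - th x y) * (e * G x y) by rewrite /G1; ring.
  have /andP[t0 t1] := th01 x y.
  rewrite normrM ger0_norm ?subr_ge0//.
  have [->|tn1] := eqVneq (1 - th x y) 0; first by rewrite !mul0r.
  rewrite ler_wpM2l ?subr_ge0//; apply: le_trans (FG x y) _.
  have [Gxy|Gxy] := eqVneq (G x y) 0; first by rewrite Gxy !mulr0.
  rewrite ler_wpM2r// leNgt; apply/negP => xy; move: tn1.
  by rewrite th1 ?subrr ?eqxx//; right; exact: (GS' x y Gxy).2.
have G10 x y : 0 <= G1 x y.
  by rewrite /G1 subr_ge0 ler_piMr//; have /andP[] := th01 x y.
have G1G x y : G1 x y <= G x y.
  by rewrite /G1 gerBl mulr_ge0//; have /andP[] := th01 x y.
have F1d x : F1 x x = 0.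
  by apply/eqP; rewrite -normr_le0 (le_trans (FG1 x x))// /G1 Gd; lra.
have h1 : `|tform F1| <= e * tform G.
  (* [tform] is monotone but not an integral, so the bound on its absolute value is obtained from
     the signs 1 and -1 separately. *)
  have h0 (c : R) : `|c| = 1 -> c * tform F1 <= e * tform G.
    move=> c1; rewrite -!tform_scale//.
    apply: tform_mono => [| |x y|x]; try exact: tensor_scale.
      apply: le_trans (ler_norm _) _; rewrite normrM c1 mul1r (le_trans (FG1 x y))//.
      by rewrite ler_wpM2l// ltW.
    by rewrite F1d Gd !mulr0.
  have := h0 1 (normr1 _); have := h0 (-1) (normrN1 _); rewrite mul1r mulN1r => h2 h3.
  by rewrite ler_norml; apply/andP; split; lra.
have h2 : `|Jint F1| <= e * Jint G.
  rewrite -Jint_scale//; apply: (Jint_norm JF1 (Jable_scale e JG)) => x y.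
  by apply: le_trans (FG1 x y) _; rewrite ler_wpM2l// ltW.
have EF : tform F = tform F1 + tform (fun x y => F x y * th x y).
  rewrite -tform_add//; congr tform.
  by apply: funext => x; apply: funext => y; rewrite /F1 subrK.
have EJ : Jint F = Jint F1 + Jint (fun x y => F x y * th x y).
  by rewrite -Jint_add//; apply: Jint_ext => x y; rewrite /F1 subrK.
have -> : tform F - 2 * Jint F = tform F1 - 2 * Jint F1 by rewrite EF EJ EFt; ring.
apply: le_trans (ler_normB _ _) _; rewrite normrM ger0_norm//.
have dC : e * (C - 1) <= d.
  by rewrite /e mulrAC ler_pdivrMr// ler_pM2l//; lra.
apply: le_trans dC; rewrite /C; move: h1 h2; set p := `|_|; set q := `|Jint _| => h1 h2; nra.
Qed.

(** * Second order kernels *)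

Definition dten i j chi v x y : R :=
  chi x * v y * (x ord0 i - y ord0 i) * (x ord0 j - y ord0 j).

Definition wten chi v x y : R := chi x * v y * wdist x y.

Lemma tensor_dten i j chi v : Cc_inf U chi -> Cc_inf U v -> tensor (dten i j chi v).
Proof. by move=> Cchi Cv; do 2 apply: tensor_diff; exact: tensor_prod. Qed.

Lemma wtenE chi v x y : wten chi v x y = \sum_i dten i i chi v x y.
Proof. by rewrite /wten mulr_sumr; apply: eq_bigr => i _; rewrite /dten mulrA. Qed.

Lemma tensor_wten chi v : Cc_inf U chi -> Cc_inf U v -> tensor (wten chi v).
Proof.
move=> Cchi Cv; apply: (tensor_ext (tensor_sum (index_enum _)
  (fun i => tensor_dten i i Cchi Cv))) => x y.
by rewrite wtenE.
Qed.

(** The source of integrability of |x - y|^2 near the diagonal: every later J-integrability claim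
    there is a domination by [wten chi chi] or by such an integrable kernel. *)
Lemma wten_Jable chi v : Cc_inf U chi -> Cc_inf U v -> (forall x, 0 <= chi x) ->
  (forall x, 0 <= v x) -> Jable (wten chi v) /\ 2 * Jint (wten chi v) <= tform (wten chi v).
Proof.
move=> Cchi Cv chi0 v0; apply: tensor_Jable; first exact: tensor_wten.
  by move=> x y; rewrite !mulr_ge0 ?wdist_ge0.
by move=> x; rewrite /wten /wdist big1 ?mulr0// => i _; rewrite subrr mulr0.
Qed.

Lemma dten_le i j chi v (M : R) x y : (forall x, 0 <= chi x) -> (forall y, `|v y| <= M * chi y) ->
  `|dten i j chi v x y| <= M * wten chi chi x y.
Proof.
move=> chi0 vM; rewrite /dten -mulrA normrM normrM ger0_norm//.
have -> : M * wten chi chi x y = (chi x * (M * chi y)) * wdist x y by rewrite /wten; ring.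
by apply: ler_pM => //; [exact: mulr_ge0|exact: ler_wpM2l|exact: wdist_coord].
Qed.

Lemma dten_Jable i j chi v (M : R) : Cc_inf U chi -> Cc_inf U v -> (forall x, 0 <= chi x) ->
  (forall y, `|v y| <= M * chi y) -> Jable (dten i j chi v).
Proof.
move=> Cchi Cv chi0 vM; have [JW _] := wten_Jable Cchi Cchi chi0 chi0.
apply: (Jable_le (tensor_measurable2 (tensor_dten i j Cchi Cv)) (Jable_scale M JW)) => x y.
exact: dten_le.
Qed.

Definition cutoff (A : set V) chi := [/\ Cc_inf U chi, forall x, 0 <= chi x &
  exists W, [/\ open W, A `<=` W & forall x, W x -> chi x = 1]].

Lemma cutoff_ex (A : set V) : compact A -> A `<=` U -> exists chi, cutoff A chi.
Proof.
move=> kA AU; have [chi [Cchi chi01 HW]] := cutoff_exists kA oU AU.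
by exists chi; split=> // x; have /andP[] := chi01 x.
Qed.

Lemma cutoff_sub (A B : set V) chi : A `<=` B -> cutoff B chi -> cutoff A chi.
Proof.
move=> AB [Cchi chi0 [W [oW BW W1]]]; split=> //; exists W; split=> //.
exact: subset_trans BW.
Qed.

Lemma cutoff1 A chi x : cutoff A chi -> A x -> chi x = 1.
Proof. by move=> [_ _ [W [_ AW W1]]] /AW/W1. Qed.

Lemma cutoff_dom A chi v (M : R) : cutoff A chi -> fsupp v `<=` A -> 0 <= M ->
  (forall x, `|v x| <= M) -> forall x, `|v x| <= M * chi x.
Proof.
move=> Hchi vA M0 vM x; have [vx|/fsupp_out ->] := pselect (fsupp v x).
  by rewrite (cutoff1 Hchi) ?mulr1//; exact: vA.
by rewrite normr0 mulr_ge0//; have [_ ->] := Hchi.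
Qed.

(** Kernels that the form sees only through the jumps. Replacing one cutoff by another changes a
    kernel by one of these, which is how independence of the cutoff is checked. *)
Definition jumpy F := [/\ tensor F, Jable F & tform F = 2 * Jint F].

Lemma jumpy_lin c F G : jumpy F -> jumpy G -> jumpy (fun x y => c * F x y + G x y).
Proof.
move=> [TF JF EF] [TG JG EG]; split.
- exact: tensor_lin.
- exact: Jable_lin.
- by rewrite tform_lin// Jint_lin// EF EG; ring.
Qed.

Lemma jumpy_ext F G : jumpy F -> (forall x y, F x y = G x y) -> jumpy G.
Proof. by move=> JF FG; have -> : G = F by apply: funext => x; apply: funext => y. Qed.

Lemma jumpy_disjoint a v : Cc_inf U a -> Cc_inf U v ->
  (exists W, [/\ open W, fsupp v `<=` W & forall x, W x -> a x = 0]) ->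
  jumpy (fun x y => a x * v y).
Proof.
move=> Ca Cv [W [oW vW aW]]; have [Jav Eav] := jump_disjoint Ca Cv oW vW aW.
by split=> //; [exact: tensor_prod|rewrite -Eav; exact: tform_prod].
Qed.

Lemma jumpy_diff i a v : Cc_inf U a -> Cc_inf U v ->
  (exists W, [/\ open W, fsupp v `<=` W & forall x, W x -> a x = 0]) ->
  jumpy (fun x y => a x * v y * (x ord0 i - y ord0 i)).
Proof.
move=> Ca Cv [W [oW vW aW]]; have si := @smooth_coord R n i.
have H1 : jumpy (fun x y => (a x * x ord0 i) * v y).
  apply: jumpy_disjoint => //; first exact: Cc_mul.
  by exists W; split=> // x /aW ->; rewrite mul0r.
have H2 : jumpy (fun x y => a x * (v y * y ord0 i)).
  apply: jumpy_disjoint => //; first exact: Cc_mul.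
  exists W; split=> //; apply: subset_trans vW; apply: fsupp_sub; first exact: fsupp_closed.
  by move=> x /fsupp_out ->; rewrite mul0r.
by apply: (jumpy_ext (jumpy_lin (-1) H2 H1)) => x y; ring.
Qed.

Lemma jumpy_diff2 i j a v : Cc_inf U a -> Cc_inf U v ->
  (exists W, [/\ open W, fsupp v `<=` W & forall x, W x -> a x = 0]) ->
  jumpy (dten i j a v).
Proof.
move=> Ca Cv [W [oW vW aW]]; have sj := @smooth_coord R n j.
have H1 : jumpy (fun x y => (a x * x ord0 j) * v y * (x ord0 i - y ord0 i)).
  apply: jumpy_diff => //; first exact: Cc_mul.
  by exists W; split=> // x /aW ->; rewrite mul0r.
have H2 : jumpy (fun x y => a x * (v y * y ord0 j) * (x ord0 i - y ord0 i)).
  apply: jumpy_diff => //; first exact: Cc_mul.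
  exists W; split=> //; apply: subset_trans vW; apply: fsupp_sub; first exact: fsupp_closed.
  by move=> x /fsupp_out ->; rewrite mul0r.
by apply: (jumpy_ext (jumpy_lin (-1) H2 H1)) => x y; rewrite /dten; ring.
Qed.

Lemma cutoff_diff v chi1 chi2 : cutoff (fsupp v) chi1 -> cutoff (fsupp v) chi2 ->
  Cc_inf U (fun x => chi1 x - chi2 x) /\
  exists W, [/\ open W, fsupp v `<=` W & forall x, W x -> chi1 x - chi2 x = 0].
Proof.
move=> [C1 _ [W1 [oW1 vW1 H1]]] [C2 _ [W2 [oW2 vW2 H2]]]; split; first exact: Cc_sub2.
exists (W1 `&` W2); split; first exact: openI.
  by move=> x vx; split; [exact: vW1|exact: vW2].
by move=> x [/H1 -> /H2 ->]; rewrite subrr.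
Qed.

(* What the jumps leave of the second order part; for a cutoff [chi] of the support of [v]
   it does not depend on [chi]. *)
Definition gval chi i j v : R := tform (dten i j chi v) - 2 * Jint (dten i j chi v).

Lemma cutoff_bound v chi : Cc_inf U v -> cutoff (fsupp v) chi ->
  exists2 M : R, 0 <= M & forall x, `|v x| <= M * chi x.
Proof.
move=> Cv Hchi; have [M M0 vM] := Cc_bounded Cv; exists M; first exact: ltW.
by apply: (cutoff_dom Hchi) => //; exact: ltW.
Qed.

Lemma cutoff_Jable i j v chi : Cc_inf U v -> cutoff (fsupp v) chi -> Jable (dten i j chi v).
Proof.
move=> Cv Hchi; have [M M0 vM] := cutoff_bound Cv Hchi; have [C0 chi0 _] := Hchi.
exact: dten_Jable vM.
Qed.

Lemma gval_indep i j v chi1 chi2 : Cc_inf U v -> cutoff (fsupp v) chi1 ->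
  cutoff (fsupp v) chi2 -> gval chi1 i j v = gval chi2 i j v.
Proof.
move=> Cv H1 H2; have [C12 W12] := cutoff_diff H1 H2.
have [C1 _ _] := H1; have [C2 _ _] := H2.
have [TF JF EF] := jumpy_diff2 i j C12 Cv W12.
have J2 := cutoff_Jable i j Cv H2; have T2 := tensor_dten i j C2 Cv.
have E1 : dten i j chi1 v = (fun x y => dten i j (fun x => chi1 x - chi2 x) v x y + dten i j chi2 v x y).
  by apply: funext => x; apply: funext => y; rewrite /dten; ring.
rewrite /gval E1 tform_add// Jint_add// EF; ring.
Qed.

Lemma gval_lin chi i j c f g : Cc_inf U f -> Cc_inf U g -> cutoff (fsupp f) chi ->
  cutoff (fsupp g) chi ->
  gval chi i j (fun x => c * f x + g x) = c * gval chi i j f + gval chi i j g.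
Proof.
move=> Cf Cg Hf Hg; have [Cchi _ _] := Hf.
have E1 : dten i j chi (fun x => c * f x + g x) =
  (fun x y => c * dten i j chi f x y + dten i j chi g x y).
  by apply: funext => x; apply: funext => y; rewrite /dten; ring.
have Tf := tensor_dten i j Cchi Cf; have Tg := tensor_dten i j Cchi Cg.
have Jf := cutoff_Jable i j Cf Hf; have Jg := cutoff_Jable i j Cg Hg.
rewrite /gval E1 tform_lin// Jint_lin//; ring.
Qed.

Lemma gvalC chi i j v : gval chi i j v = gval chi j i v.
Proof.
have E1 : dten i j chi v = dten j i chi v.
  by apply: funext => x; apply: funext => y; rewrite /dten mulrAC.
by rewrite /gval E1.
Qed.

Lemma gval_psd chi v (xi : 'I_n -> R) : Cc_inf U v -> (forall x, 0 <= v x) ->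
  cutoff (fsupp v) chi -> 0 <= \sum_i \sum_j xi i * xi j * gval chi i j v.
Proof.
move=> Cv v0 Hchi; have [Cchi chi0 _] := Hchi.
pose F x y := \sum_i \sum_j xi i * xi j * dten i j chi v x y.
have T0 i j : tensor (fun x y => xi i * xi j * dten i j chi v x y).
  by apply: tensor_scale; exact: tensor_dten.
have J0 i j : Jable (fun x y => xi i * xi j * dten i j chi v x y).
  by apply: Jable_scale => //; exact: cutoff_Jable.
have T1 i : tensor (fun x y => \sum_j xi i * xi j * dten i j chi v x y).
  by apply: tensor_sum.
have J1 i : Jable (fun x y => \sum_j xi i * xi j * dten i j chi v x y).
  by apply: Jable_sum.
have TF : tensor F by apply: tensor_sum.
have JF : Jable F by apply: Jable_sum.
have -> : \sum_i \sum_j xi i * xi j * gval chi i j v = tform F - 2 * Jint F.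
  rewrite /F tform_sum// Jint_sum// mulr_sumr -sumrB; apply: eq_bigr => i _.
  rewrite tform_sum// Jint_sum// mulr_sumr -sumrB; apply: eq_bigr => j _.
  rewrite (tform_scale _ (tensor_dten i j Cchi Cv)).
  rewrite (Jint_scale _ (cutoff_Jable i j Cv Hchi)).
  by rewrite /gval; ring.
have FE x y : F x y = chi x * v y * (\sum_i xi i * (x ord0 i - y ord0 i)) ^+ 2.
  rewrite expr2 big_distrlr/= mulr_sumr; apply: eq_bigr => i _.
  by rewrite mulr_sumr; apply: eq_bigr => j _; rewrite /dten; ring.
have F0 x y : 0 <= F x y by rewrite FE; apply: mulr_ge0; [exact: mulr_ge0|exact: sqr_ge0].
have Fd x : F x x = 0.
  by rewrite FE big1 ?expr0n ?mulr0// => i _; rewrite subrr mulr0.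
by rewrite subr_ge0; have [_] := tensor_Jable TF F0 Fd.
Qed.

(** By domination by [wten], only the supremum of [v] enters once the cutoff is fixed; this later
    controls the terms with derivatives of g in [psi]. *)
Lemma gval_bound A chi i j v (M : R) : cutoff A chi -> Cc_inf U v -> fsupp v `<=` A -> 0 <= M ->
  (forall x, `|v x| <= M) ->
  `|gval chi i j v| <= M * (tform (wten chi chi) + 2 * Jint (wten chi chi)).
Proof.
move=> Hchi Cv vA M0 vM; have [Cchi chi0 _] := Hchi.
have vMc := cutoff_dom Hchi vA M0 vM.
have [JW JWt] := wten_Jable Cchi Cchi chi0 chi0.
have TW := tensor_wten Cchi Cchi; have Td := tensor_dten i j Cchi Cv.
have Jd := dten_Jable i j Cchi Cv chi0 vMc.
have dle x y := dten_le i j x y chi0 vMc.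
have d0 x : dten i j chi v x x = 0 by rewrite /dten !subrr !mulr0.
have w0 x : wten chi chi x x = 0.
  by rewrite /wten /wdist big1 ?mulr0// => k _; rewrite subrr mulr0.
have h0 (c : R) : `|c| = 1 -> c * tform (dten i j chi v) <= M * tform (wten chi chi).
  move=> c1; rewrite -!tform_scale//.
  apply: tform_mono => [| |x y|x]; try exact: tensor_scale.
    by apply: le_trans (ler_norm _) _; rewrite normrM c1 mul1r.
  by rewrite d0 w0 !mulr0.
have h1 : `|Jint (dten i j chi v)| <= M * Jint (wten chi chi).
  by rewrite -Jint_scale//; apply: (Jint_norm Jd (Jable_scale M JW)).
have := h0 1 (normr1 _); have := h0 (-1) (normrN1 _); rewrite mul1r mulN1r => h2 h3.
move: h1; rewrite /gval !ler_norml => /andP[h4 h5]; apply/andP; split; lra.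
Qed.

(** * Second order expansion of the form *)

Definition lten i chi v x y : R := chi x * v y * (x ord0 i - y ord0 i).

Definition Kint v : R := fine (\int[K]_(x in (U : set T)) (v x)%:E)%E.

Lemma KintE v : Cc_inf U v -> (\int[K]_(x in (U : set T)) (v x)%:E)%E = (Kint v)%:E.
Proof.
move=> Cv; have [_ [rK _]] := JK; have iK := Cc_integrable rK Cv.
by rewrite /Kint fineK// integral_Cc//; exact: (integrable_fin_num measurableT iK).
Qed.

Lemma tensor_lten i chi v : Cc_inf U chi -> Cc_inf U v -> tensor (lten i chi v).
Proof. by move=> Cchi Cv; apply: tensor_diff; exact: tensor_prod. Qed.

(** The defining identity of J and K with locally constant value 1; this is where the killing
    measure enters. *)
Lemma form_cutoff chi v : Cc_inf U v -> cutoff (fsupp v) chi ->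
  Jable (fun x y => (chi y - chi x) * v y) /\
  E chi v = 2 * Jint (fun x y => (chi y - chi x) * v y) + Kint v.
Proof.
move=> Cv Hchi; have [Cchi chi0 [W [oW vW W1]]] := Hchi.
have [_ [rK HJK]] := JK.
have /(HJK chi v Cchi Cv) : exists W', open W' /\ fsupp v `<=` W' /\ exists c : R, forall x, W' x -> chi x = c.
  by exists W; split=> //; split=> //; exists 1.
have -> : (\int[K]_(x in (U : set T)) (chi x * v x)%:E)%E = (Kint v)%:E.
  rewrite -KintE//; apply: eq_integral => x _; congr (_%:E).
  have [vx|/fsupp_out ->] := pselect (fsupp v x); last by rewrite mulr0.
  by rewrite (cutoff1 Hchi vx) mul1r.
move=> HE.
have JF : Jable (fun x y => 2 * (chi y - chi x) * v y).
  apply: Jable_fin.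
    have T1 : tensor (fun x y => chi x * v y) by exact: tensor_prod.
    apply: measurable_funM; last first.
      exact: (measurable2_snd (smooth_cont (Cc_smooth Cv))).
    apply: measurable_funM => //; apply: measurable_funB.
      exact: (measurable2_snd (smooth_cont (Cc_smooth Cchi))).
    exact: (measurable2_fst (smooth_cont (Cc_smooth Cchi))).
  by move: HE; case: (\int[J]_(p in offdiag U) _)%E.
have J2 : Jable (fun x y => (chi y - chi x) * v y).
  apply: (Jable_ext (Jable_scale 2^-1 JF)) => x y.
  by rewrite -mulrA mulKf.
split=> //; move: HE; rewrite (JintE JF) -EFinD => -[->]; congr (_ + _).
rewrite -(Jint_scale _ J2); apply: Jint_ext => x y; by rewrite mulrA.
Qed.

(* Multiplying the second order Taylor polynomial by [chi x] makes it a tensor without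
   changing the order of the remainder, as [u = chi * u]. *)
Lemma form_expansion chi u v : Cc_inf U u -> Cc_inf U v ->
  cutoff (fsupp u `|` fsupp v) chi ->
  let B x y := (u y - u x + \sum_i chi x * dpart i u y * (x ord0 i - y ord0 i)) * v y in
  Jable B /\
  E u v = 2 * Jint B + Kint (fun x => u x * v x)
    - \sum_i tform (lten i chi (fun x => dpart i u x * v x))
    - 2^-1 * \sum_i \sum_j gval chi i j (fun x => dpart j (dpart i u) x * v x).
Proof.
move=> Cu Cv Hchi B; have [Cchi chi0 _] := Hchi.
have su := Cc_smooth Cu; have sv := Cc_smooth Cv.
pose uv x := u x * v x; pose g i x := dpart i u x * v x.
pose h i j x := dpart j (dpart i u) x * v x.
have Cuv : Cc_inf U uv by apply: Cc_mul.
have Cg i : Cc_inf U (g i) by apply: Cc_mull => //; exact: smooth_dpart.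
have Ch i j : Cc_inf U (h i j) by apply: Cc_mull => //; exact/smooth_dpart/smooth_dpart.
have sub (p : V -> R) : fsupp (fun x => p x * v x) `<=` fsupp v.
  apply: fsupp_sub; first exact: fsupp_closed.
  by move=> x /fsupp_out ->; rewrite mulr0.
have Hv : cutoff (fsupp v) chi by apply: cutoff_sub Hchi => x; right.
have Hh i j : cutoff (fsupp (h i j)) chi by apply: cutoff_sub Hv; exact: sub.
have Huv : cutoff (fsupp uv) chi by apply: cutoff_sub Hv; exact: sub.
have chiu x : u x = chi x * u x.
  have [ux|/fsupp_out ->] := pselect (fsupp u x); last by rewrite mulr0.
  by rewrite (cutoff1 Hchi) ?mul1r//; left.
have chiv x : v x = chi x * v x.
  have [vx|/fsupp_out ->] := pselect (fsupp v x); last by rewrite mulr0.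
  by rewrite (cutoff1 Hv vx) mul1r.
pose S2 x y := \sum_i \sum_j dten i j chi (h i j) x y.
pose S1 x y := \sum_i lten i chi (g i) x y.
(* The zeroth and first order parts need not be integrable separately; [A] as a whole is, because
   [F] and [S2] are. *)
pose A x y := u x * v y + (-1) * (chi x * uv y) + (-1) * S1 x y.
pose F x y := A x y + (- 2^-1) * S2 x y.
have TS1 : tensor S1 by apply: tensor_sum => i; exact: tensor_lten.
have TS2i i : tensor (fun x y => \sum_j dten i j chi (h i j) x y).
  by apply: tensor_sum => j; exact: tensor_dten.
have TS2 : tensor S2 by exact: tensor_sum.
have Tu : tensor (fun x y => u x * v y) by exact: tensor_prod.
have Tc : tensor (fun x y => chi x * uv y) by exact: tensor_prod.
have TA1 : tensor (fun x y => u x * v y + (-1) * (chi x * uv y)).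
  by apply: tensor_add => //; exact: tensor_scale.
have TA : tensor A by apply: tensor_add => //; exact: tensor_scale.
have TF : tensor F by apply: tensor_add => //; exact: tensor_scale.
have JS2i i : Jable (fun x y => \sum_j dten i j chi (h i j) x y).
  by apply: Jable_sum => j; exact: cutoff_Jable.
have JS2 : Jable S2 by apply: Jable_sum.
have FE x y : F x y = chi x * (u x - taylor2 u y x) * v y.
  pose Q1 := \sum_i dpart i u y * (x ord0 i - y ord0 i).
  pose Q2 := \sum_i \sum_j dpart j (dpart i u) y *
    ((x ord0 i - y ord0 i) * (x ord0 j - y ord0 j)).
  have E1 : S1 x y = chi x * v y * Q1.
    by rewrite mulr_sumr; apply: eq_bigr => i _; rewrite /lten /g; ring.
  have E2 : S2 x y = chi x * v y * Q2.
    rewrite mulr_sumr; apply: eq_bigr => i _.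
    rewrite mulr_sumr; apply: eq_bigr => j _.
    by rewrite /dten /h; move: (dpart j _ _) => d; ring.
  rewrite /F /A E1 E2 /taylor2 /taylor1 -/Q1 -/Q2 {1}(chiu x) /uv.
  by move: Q1 Q2 {E1 E2} => a b; ring.
have [M3 M30 HM3] : exists2 M : R, 0 <= M &
    forall i j k x, `|dpart k (dpart j (dpart i u)) x| <= M.
  have bd (t : 'I_n * 'I_n * 'I_n) : exists2 M : R, 0 < M &
      forall x, `|dpart t.2 (dpart t.1.2 (dpart t.1.1 u)) x| <= M.
    by apply: (@Cc_bounded _ _ U); do 3 apply: Cc_dpart.
  pose M t := projT1 (cid2 (bd t)).
  have M0 t : 0 <= M t by rewrite /M; case: cid2 => /= ? /ltW.
  exists (\sum_t M t) => [|i j k x]; first exact: sumr_ge0.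
  rewrite (bigD1 (i, j, k))//=; apply: ler_wpDr; first exact: sumr_ge0.
  by rewrite /M; case: cid2 => /= c _; exact.
have [Mv Mv0 HMv] := cutoff_bound Cv Hv.
(* The constant of the cubic Taylor remainder times the bound of [v] by [chi]. Of the three powers
   of |x - y|, one is the gain required by [tform_third_order] and two go into [wdist]. *)
pose C := n%:R * (n%:R * (n%:R * M3)) * Mv.
have C0 : 0 <= C by rewrite !mulr_ge0.
have [JF EF] : Jable F /\ tform F = 2 * Jint F.
  apply: (tform_third_order TF (G := fun x y => C * wten chi chi x y)).
  - exact: tensor_scale (tensor_wten Cchi Cchi).
  - by move=> x y; rewrite !mulr_ge0// ?wdist_ge0.
  - by move=> x; rewrite /wten /wdist big1 ?mulr0// => k _; rewrite subrr mulr0.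
  move=> x y; rewrite FE !normrM (ger0_norm (chi0 x)).
  have h1 := taylor2_le y su M30 HM3 x.
  have h2 := wdist_norm x y.
  have -> : `|x - y| * (C * wten chi chi x y) = chi x *
    (n%:R * (n%:R * (n%:R * M3)) * (`|x - y| * wdist x y)) * (Mv * chi y).
    by rewrite /C /wten; ring.
  apply: ler_pM => //; first by rewrite mulr_ge0.
  apply: ler_wpM2l => //; apply: le_trans h1 _.
  apply: ler_wpM2l; first by rewrite !mulr_ge0.
  by rewrite 2!exprS expr1; apply: ler_wpM2l.
have JA : Jable A.
  apply: (Jable_ext (Jable_lin 2^-1 JS2 JF)) => x y; rewrite /F; ring.
have [JC EC] := form_cutoff Cuv Huv.
(* The term chi(x) (uv)(y) cancels between the two summands: [form_cutoff] accounts for the first,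
   the expansion for the second. *)
have BE x y : B x y = (chi y - chi x) * uv y + (-1) * A x y.
  rewrite /A mulrBl {1}/uv (mulrCA (chi y)) -chiv /B mulrDl mulr_suml.
  have -> : S1 x y = \sum_i chi x * dpart i u y * (x ord0 i - y ord0 i) * v y.
    by apply: eq_bigr => i _; rewrite /lten /g; ring.
  by rewrite /uv; ring.
have JB : Jable B.
  by apply: (Jable_ext (Jable_add JC (Jable_scale (-1) JA))).
split=> //.
have JBE : Jint B = Jint (fun x y => (chi y - chi x) * uv y) - Jint A.
  transitivity (Jint (fun x y => (chi y - chi x) * uv y + (-1) * A x y)).
    exact: Jint_ext.
  by rewrite (Jint_add JC (Jable_scale (-1) JA)) (Jint_scale _ JA) mulN1r.
have JAE : Jint F = Jint A + (- 2^-1) * Jint S2.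
  by rewrite /F (Jint_add JA (Jable_scale (- 2^-1) JS2)) (Jint_scale _ JS2).
have TFE : tform F = - E u v + (-1) * - E chi uv + (-1) * tform S1 + (- 2^-1) * tform S2.
  rewrite /F /A !(tform_add, tform_scale)//; try exact: tensor_scale.
  by rewrite !tform_prod.
have S1E : tform S1 = \sum_i tform (lten i chi (g i)).
  by rewrite tform_sum => // i; exact: tensor_lten.
have S2E : \sum_i \sum_j gval chi i j (h i j) = tform S2 - 2 * Jint S2.
  rewrite tform_sum// Jint_sum// mulr_sumr -sumrB; apply: eq_bigr => i _.
  have Td j : tensor (dten i j chi (h i j)) by exact: tensor_dten.
  have Jd j : Jable (dten i j chi (h i j)) by exact: cutoff_Jable.
  by rewrite tform_sum// Jint_sum// mulr_sumr -sumrB.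
rewrite -/(g _) S2E -S1E JBE.
move: TFE; rewrite EF JAE EC => H.
by move: H; lra.
Qed.

(** * The second order functionals and the measures representing them *)

Definition gform i j v : R := gval (xget (fun=> 0) [set chi | cutoff (fsupp v) chi]) i j v.

(** No test function of [U] need be 1 on all of [U], so the cutoff has to follow the support of [v].
    This lemma trades the chosen cutoff for one common to several functions. *)
Lemma gformE (A : set V) chi i j v : Cc_inf U v -> fsupp v `<=` A -> cutoff A chi ->
  gform i j v = gval chi i j v.
Proof.
move=> Cv vA Hchi; have Hv := cutoff_sub vA Hchi.
apply: gval_indep => //.
exact: (@xgetPex _ (fun=> 0) [set chi | cutoff (fsupp v) chi] (ex_intro _ chi Hv)).
Qed.

Lemma gform_lin i j : lin_on (Cc_inf U) (gform i j).
Proof.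
move=> c f g Cf Cg; pose A := fsupp f `|` fsupp g.
have kA : compact A by apply: compactU; [exact: Cc_compact Cf|exact: Cc_compact Cg].
have AU : A `<=` U by move=> x [/(Cc_supp Cf)|/(Cc_supp Cg)].
have [chi Hchi] := cutoff_ex kA AU.
have fA : fsupp f `<=` A by move=> x; left.
have gA : fsupp g `<=` A by move=> x; right.
have hA : fsupp (fun x => c * f x + g x) `<=` A.
  apply: fsupp_sub; first by apply: closedU; exact: fsupp_closed.
  by move=> x xA; rewrite !fsupp_out ?mulr0 ?addr0// => xg; apply: xA; [right|left].
rewrite (gformE i j (Cc_lin c Cf Cg) hA Hchi) (gformE i j Cf fA Hchi) (gformE i j Cg gA Hchi).
by apply: gval_lin => //; exact: cutoff_sub Hchi.
Qed.

Lemma gformC i j v : gform i j v = gform j i v.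
Proof. exact: gvalC. Qed.

Definition gquad (xi : 'I_n -> R) v : R := \sum_i \sum_j xi i * xi j * gform i j v.

Lemma gquad_lin xi : lin_on (Cc_inf U) (gquad xi).
Proof.
move=> c f g Cf Cg; rewrite /gquad mulr_sumr -big_split; apply: eq_bigr => i _.
rewrite mulr_sumr -big_split; apply: eq_bigr => j _ /=.
by rewrite gform_lin//; ring.
Qed.

Lemma gquad_pos xi v : Cc_inf U v -> (forall x, 0 <= v x) -> 0 <= gquad xi v.
Proof.
move=> Cv v0; have [chi Hchi] := cutoff_ex (Cc_compact Cv) (Cc_supp Cv).
have -> : gquad xi v = \sum_i \sum_j xi i * xi j * gval chi i j v.
  apply: eq_bigr => i _; apply: eq_bigr => j _; congr (_ * _).
  exact: (gformE i j Cv (subset_refl _) Hchi).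
exact: gval_psd.
Qed.

Lemma gquarter_lin xi : lin_on (Cc_inf U) (fun v => 4^-1 * gquad xi v).
Proof. by move=> c f g Cf Cg; rewrite gquad_lin//; ring. Qed.

Lemma gquarter_pos xi v : Cc_inf U v -> (forall x, 0 <= v x) -> 0 <= 4^-1 * gquad xi v.
Proof. by move=> Cv v0; rewrite mulr_ge0 ?invr_ge0//; exact: gquad_pos. Qed.

Definition gfunctional xi : pos_functional U :=
  PosFunctional (@gquarter_lin xi) (@gquarter_pos xi).

(* Polarization: [4 a b = (a + b)^2 - (a - b)^2]. *)
Definition diffp i j := riesz_measure (gfunctional (fun k => (k == i)%:R + (k == j)%:R)).
Definition diffm i j := riesz_measure (gfunctional (fun k => (k == i)%:R - (k == j)%:R)).

Lemma gquad_polar i j v :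
  4^-1 * gquad (fun k => (k == i)%:R + (k == j)%:R) v -
  4^-1 * gquad (fun k => (k == i)%:R - (k == j)%:R) v = gform i j v.
Proof.
have dsum (a b : 'I_n) : \sum_k \sum_l gform k l v * (l == b)%:R * (k == a)%:R = gform a b v.
  rewrite -[RHS](sum_delta b (fun l => gform a l v)).
  rewrite -[RHS](sum_delta a (fun k => \sum_l gform k l v * (l == b)%:R)).
  by apply: eq_bigr => k _; rewrite mulr_suml.
rewrite -mulrBr /gquad -sumrB.
have -> : \sum_k (\sum_l ((k == i)%:R + (k == j)%:R) * ((l == i)%:R + (l == j)%:R) * gform k l v
    - \sum_l ((k == i)%:R - (k == j)%:R) * ((l == i)%:R - (l == j)%:R) * gform k l v)
  = 2 * \sum_k \sum_l gform k l v * (l == j)%:R * (k == i)%:R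
  + 2 * \sum_k \sum_l gform k l v * (l == i)%:R * (k == j)%:R.
  rewrite !mulr_sumr -big_split; apply: eq_bigr => k _ /=.
  rewrite -sumrB !mulr_sumr -big_split; apply: eq_bigr => l _ /=.
  by move: (gform k l v) ((k == i)%:R) ((k == j)%:R) ((l == i)%:R) ((l == j)%:R) => a b c d e; ring.
by rewrite !dsum (gformC j i); field.
Qed.

Lemma diff_radon i j : radon_on U (diffp i j) /\ radon_on U (diffm i j).
Proof. by split; exact: riesz_radon. Qed.

Lemma diff_integral i j v : Cc_inf U v ->
  (\int[diffp i j]_(x in (U : set T)) (v x)%:E - \int[diffm i j]_(x in (U : set T)) (v x)%:E
  = (gform i j v)%:E)%E.
Proof. by move=> Cv; rewrite !riesz_integral// -EFinB /= gquad_polar. Qed.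

(** Symmetry and positivity hold for test functions and pass to [F] along the sequence of
    [compact_approx], which serves all the measures simultaneously. *)
Lemma diff_compact (F : set V) : compact F -> F `<=` U ->
  (forall i j, fine (diffp i j F) - fine (diffm i j F)
     = fine (diffp j i F) - fine (diffm j i F)) /\
  (forall xi : 'I_n -> R,
     0 <= \sum_(i < n) \sum_(j < n) xi i * xi j * (fine (diffp i j F) - fine (diffm i j F))).
Proof.
move=> kF FU; have [c [Cc c0 Hc]] := compact_approx oU kF FU.
have cv i j : (fun k => gform i j (c k)) @ \oo --> fine (diffp i j F) - fine (diffm i j F).
  have [rp rm] := diff_radon i j.
  have -> : (fun k => gform i j (c k)) =
    (fun k => fine (\int[diffp i j]_(x in (U : set T)) (c k x)%:E)%E
      - fine (\int[diffm i j]_(x in (U : set T)) (c k x)%:E)%E).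
    by apply: funext => k; rewrite !riesz_integral//= gquad_polar.
  exact: (cvgB (Hc _ rp) (Hc _ rm)).
split=> [i j|xi].
  apply: cvg_unique (cv i j) _ => //.
  have -> : (fun k => gform i j (c k)) = (fun k => gform j i (c k)).
    by apply: funext => k; exact: gformC.
  exact: cv.
have : (fun k => gquad xi (c k)) @ \oo -->
    \sum_(i < n) \sum_(j < n) xi i * xi j * (fine (diffp i j F) - fine (diffm i j F)).
  apply: cvg_big => [|i _]; first exact: add_continuous.
  apply: cvg_big => [|j _]; first exact: add_continuous.
  exact: (cvgM (cvg_cst _) (cv i j)).
move/cvgr_to_ge; apply.
by apply: nearW => k; exact: gquad_pos.
Qed.

(** * First order terms and truncation at distance delta *)

Variable delta : R.
Hypothesis delta0 : 0 < delta.
Local Notation ind := (@near_ind R n delta).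
Local Notation thick := (@thick R n delta).

Lemma measurable_near_ind d : 0 <= d -> measurable2 (@near_ind R n d).
Proof.
move=> d0; have -> : @near_ind R n d = (fun x y => if wdist x y <= d * d then 1 else 0).
  by apply: funext => x; apply: funext => y; rewrite near_indE.
have mw : measurable2 (@wdist R n).
  rewrite /measurable2 /wdist; apply: measurable_sum => i.
  by apply: measurable_funM; exact: measurable2_diff.
by apply: measurable_fun_ifT; [exact: measurable_fun_ler|exact: measurable_cst|exact: measurable_cst].
Qed.

(** The error of replacing the sharp truncation, which is not of finite rank, by the cutoff [chi] in
    a first order kernel. *)
Definition rten i chi g x y : R := (ind x y - chi x) * g y * (x ord0 i - y ord0 i).
(** A product of two first order differences, hence of second order and integrable, although the
    terms with g(y) and g(x) need not be so separately. *)
Definition sten i g x y : R := (y ord0 i - x ord0 i) * (g y - g x) * ind x y.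
(* [chi] is meant to be a cutoff of the [delta]-neighbourhood of the support of [g]: then
   [rten] vanishes where [|x - y| <= delta], and is integrable. *)
Definition psi chi i g : R := - 2^-1 * (\sum_j gval chi i j (dpart j g))
  - tform (lten i chi g) - 2 * Jint (rten i chi g) - Jint (sten i g).

Let m0 : 0 <= delta := ltW delta0.

Lemma coord_wdist i x y : `|x ord0 i - y ord0 i| * `|x ord0 i - y ord0 i| <= wdist x y.
Proof. by rewrite -normrM; exact: wdist_coord. Qed.

(** Within distance delta of a point where g is nonzero, [chi] is 1 and the kernel vanishes; beyond
    it, |x_i - y_i| is at most |x - y|^2 / delta. *)
Lemma rten_le i S chi g (M : R) x y : cutoff (thick S) chi -> fsupp g `<=` S ->
  0 <= M -> (forall x, `|g x| <= M) ->
  `|rten i chi g x y| <= M / delta * wten chi chi x y.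
Proof.
move=> Hchi gS M0 gM; have [_ chi0 _] := Hchi.
have HS := cutoff_sub (@sub_thick R n delta S) Hchi.
have gc := cutoff_dom HS gS M0 gM.
have rhs0 : 0 <= M / delta * wten chi chi x y.
  by rewrite !mulr_ge0 ?invr_ge0 ?wdist_ge0.
rewrite /rten near_indE//; case: ifPn => [xy|].
  have [gy|/fsupp_out ->] := pselect (fsupp g y); last by rewrite mulr0 mul0r normr0.
  rewrite (cutoff1 Hchi); last by exists y => //; exact: gS.
  by rewrite subrr !mul0r normr0.
rewrite -ltNge => xy; rewrite sub0r !normrM normrN (ger0_norm (chi0 x)).
have -> : M / delta * wten chi chi x y = chi x * (M * chi y) * (wdist x y / delta).
  by rewrite /wten; ring.
apply: ler_pM => //; first by rewrite mulr_ge0.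
  by apply: ler_wpM2l.
rewrite ler_pdivlMr//; have := coord_wdist i x y.
have := sqr_ge0 (`|x ord0 i - y ord0 i| - delta); rewrite expr2; move: xy.
by move: (wdist x y) `|_| => w b; nra.
Qed.

(** If one point lies in [S] and the distance is at most delta, both lie in [thick S], where [chi]
    is 1; each of the two differences contributes one power of |x - y|. *)
Lemma sten_le i S chi g (M : R) x y : cutoff (thick S) chi -> fsupp g `<=` S ->
  smooth g -> 0 <= M -> (forall j x, `|dpart j g x| <= M) ->
  `|sten i g x y| <= n%:R * M * wten chi chi x y.
Proof.
move=> Hchi gS sg M0 gM; have [_ chi0 _] := Hchi.
have rhs0 : 0 <= n%:R * M * wten chi chi x y.
  by rewrite !mulr_ge0 ?wdist_ge0.
rewrite /sten near_indE//; case: ifPn => [xy|_]; last by rewrite mulr0 normr0.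
have [gxy|gxy] := pselect (S x \/ S y); last first.
  have -> : g y = 0 by apply: fsupp_out => /gS H; apply: gxy; right.
  have -> : g x = 0 by apply: fsupp_out => /gS H; apply: gxy; left.
  by rewrite subrr mulr0 mul0r normr0.
have [tx ty] : thick S x /\ thick S y.
  case: gxy => H; split; try exact: sub_thick.
    by exists x => //; rewrite wdistC.
  by exists y.
rewrite /wten !(cutoff1 Hchi)// !mul1r mulr1 normrM.
have h1 : `|g y - g x| <= n%:R * M * `|y - x|.
  by apply: box_lipschitz => // j z; exact: smooth_derivable.
have h2 : `|y ord0 i - x ord0 i| <= `|y - x|.
  by have := ler_coord_norm (y - x) i; rewrite !mxE.
have h3 := wdist_norm y x; rewrite wdistC.
apply: le_trans (_ : `|y - x| * (n%:R * M * `|y - x|) <= _).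
  by apply: ler_pM.
by rewrite mulrCA; apply: ler_wpM2l => //; rewrite mulr_ge0.
Qed.

Lemma measurable_rten i chi g : Cc_inf U chi -> Cc_inf U g -> measurable2 (rten i chi g).
Proof.
move=> Cchi Cg; apply: measurable_funM; last exact: measurable2_diff.
apply: measurable_funM; last exact: (measurable2_snd (smooth_cont (Cc_smooth Cg))).
apply: measurable_funB; first exact: measurable_near_ind.
exact: (measurable2_fst (smooth_cont (Cc_smooth Cchi))).
Qed.

Lemma measurable_sten i g : Cc_inf U g -> measurable2 (sten i g).
Proof.
move=> Cg; have cg := smooth_cont (Cc_smooth Cg).
apply: measurable_funM; last exact: measurable_near_ind.
have ci := smooth_cont (@smooth_coord R n i).
apply: measurable_funM.
  by apply: measurable_funB; [exact: (measurable2_snd ci)|exact: (measurable2_fst ci)].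
by apply: measurable_funB; [exact: (measurable2_snd cg)|exact: (measurable2_fst cg)].
Qed.

Lemma dpart_bounded g : Cc_inf U g -> exists2 M : R, 0 <= M &
  (forall x, `|g x| <= M) /\ (forall j x, `|dpart j g x| <= M).
Proof.
move=> Cg; have [M0 M00 HM0] := Cc_bounded Cg.
have bd j : exists2 M : R, 0 < M & forall x, `|dpart j g x| <= M.
  by apply: (@Cc_bounded _ _ U); exact: Cc_dpart.
pose M j := projT1 (cid2 (bd j)).
have Mp j : 0 <= M j by rewrite /M; case: cid2 => /= ? /ltW.
have Ms : 0 <= \sum_j M j by exact: sumr_ge0.
exists (M0 + \sum_j M j); first by rewrite addr_ge0// ltW.
split=> [x|j x]; first by apply: ler_wpDr.
apply: ler_wpDl; first exact: ltW.
rewrite (bigD1 j)//=; apply: ler_wpDr; first exact: sumr_ge0.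
rewrite /M; case: cid2 => /= c _; exact.
Qed.

Section FixedCutoff.
Variables (S : set V) (chi : V -> R).
Hypothesis Hchi : cutoff (thick S) chi.

Let Cchi : Cc_inf U chi. Proof. by have [] := Hchi. Qed.
Let chi0 x : 0 <= chi x. Proof. by case: Hchi => _ H _; exact: H. Qed.

Lemma cutoffS g : fsupp g `<=` S -> cutoff (fsupp g) chi.
Proof. by move=> gS; apply: cutoff_sub Hchi => x /gS; exact: sub_thick. Qed.

Lemma fsupp_dpart j g : fsupp g `<=` S -> fsupp (dpart j g) `<=` S.
Proof.
move=> gS; apply: subset_trans gS; apply: fsupp_sub; first exact: fsupp_closed.
by move=> x; exact: dpart_out.
Qed.

Let JW : Jable (wten chi chi).
Proof. by have [] := wten_Jable Cchi Cchi chi0 chi0. Qed.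

Lemma rten_Jable i g : Cc_inf U g -> fsupp g `<=` S -> Jable (rten i chi g).
Proof.
move=> Cg gS; have [M M0 gM] := Cc_bounded Cg.
apply: (Jable_le (measurable_rten i Cchi Cg) (Jable_scale (M / delta) JW)) => x y.
by apply: (rten_le i x y Hchi gS _ gM); exact: ltW.
Qed.

Lemma sten_Jable i g : Cc_inf U g -> fsupp g `<=` S -> Jable (sten i g).
Proof.
move=> Cg gS; have [M M0 [gM dgM]] := dpart_bounded Cg.
apply: (Jable_le (measurable_sten i Cg) (Jable_scale (n%:R * M) JW)) => x y.
exact: (sten_le i x y Hchi gS (Cc_smooth Cg) M0 dgM).
Qed.

Lemma psi_lin i (c : R) f g : Cc_inf U f -> Cc_inf U g -> fsupp f `<=` S -> fsupp g `<=` S ->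
  psi chi i (fun x => c * f x + g x) = c * psi chi i f + psi chi i g.
Proof.
move=> Cf Cg fS gS.
have sf := Cc_smooth Cf; have sg := Cc_smooth Cg.
have E1 : Jint (rten i chi (fun x => c * f x + g x)) =
    c * Jint (rten i chi f) + Jint (rten i chi g).
  rewrite -(Jint_lin _ (rten_Jable i Cf fS) (rten_Jable i Cg gS)).
  by apply: Jint_ext => x y; rewrite /rten; ring.
have E2 : Jint (sten i (fun x => c * f x + g x)) =
    c * Jint (sten i f) + Jint (sten i g).
  rewrite -(Jint_lin _ (sten_Jable i Cf fS) (sten_Jable i Cg gS)).
  by apply: Jint_ext => x y; rewrite /sten; ring.
have E3 : tform (lten i chi (fun x => c * f x + g x)) =
    c * tform (lten i chi f) + tform (lten i chi g).
  rewrite -(tform_lin _ (tensor_lten i Cchi Cf) (tensor_lten i Cchi Cg)).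
  by congr tform; apply: funext => x; apply: funext => y; rewrite /lten; ring.
have E4 : \sum_j gval chi i j (dpart j (fun x => c * f x + g x)) =
    c * (\sum_j gval chi i j (dpart j f)) + \sum_j gval chi i j (dpart j g).
  rewrite mulr_sumr -big_split; apply: eq_bigr => j _ /=.
  have := dparts_add [:: j] (smooth_scale c sf) sg; have := dparts_scale [:: j] c sf.
  move=> /= -> ->; rewrite gval_lin//; try exact: Cc_dpart.
    by apply: cutoffS; exact: fsupp_dpart.
  by apply: cutoffS; exact: fsupp_dpart.
have alg (a b t t' r r' q q' a1 t1 r1 q1 : R) : r1 = c * r + r' -> q1 = c * q + q' ->
    t1 = c * t + t' -> a1 = c * a + b -> - 2^-1 * a1 - t1 - 2 * r1 - q1 =
    c * (- 2^-1 * a - t - 2 * r - q) + (- 2^-1 * b - t' - 2 * r' - q').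
  by move=> -> -> -> ->; ring.
exact: (alg _ _ _ _ _ _ _ _ _ _ _ _ E1 E2 E3 E4).
Qed.

(** Apart from the kernel [lten], every part of [psi] is bounded by g and its first derivatives.
    Only [lten] has to rely on the continuity of [E]. *)
Lemma psi_bound i : exists2 C : R, 0 <= C & forall g (M : R), Cc_inf U g -> fsupp g `<=` S ->
  0 <= M -> (forall x, `|g x| <= M) -> (forall j x, `|dpart j g x| <= M) ->
  `|psi chi i g + tform (lten i chi g)| <= C * M.
Proof.
pose Tw := tform (wten chi chi) + 2 * Jint (wten chi chi).
pose Jw := Jint (wten chi chi).
have Jw0 : 0 <= Jw.
  rewrite /Jw -Jint0; apply: (Jint_mono Jable0 JW) => x y.
  by rewrite !mulr_ge0 ?wdist_ge0.
have Tw0 : 0 <= Tw.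
  have [_] := wten_Jable Cchi Cchi chi0 chi0.
  by rewrite /Tw -/Jw; move: Jw0; lra.
exists (2^-1 * (n%:R * Tw) + 2 * (delta^-1 * Jw) + n%:R * Jw).
  have d0 : 0 <= delta^-1 by rewrite invr_ge0.
  apply: addr_ge0; first apply: addr_ge0; apply: mulr_ge0 => //.
  - exact: mulr_ge0.
  - exact: mulr_ge0.
move=> g M Cg gS M0 gM dgM.
have h1 : `|Jint (rten i chi g)| <= M * (delta^-1 * Jw).
  rewrite mulrA -(Jint_scale _ JW).
  apply: (Jint_norm (rten_Jable i Cg gS) (Jable_scale _ JW)) => x y.
  exact: (rten_le i x y Hchi gS M0 gM).
have h2 : `|Jint (sten i g)| <= M * (n%:R * Jw).
  rewrite mulrA (mulrC M) -(Jint_scale _ JW).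
  apply: (Jint_norm (sten_Jable i Cg gS) (Jable_scale _ JW)) => x y.
  exact: (sten_le i x y Hchi gS (Cc_smooth Cg) M0 dgM).
have h3 : `|\sum_j gval chi i j (dpart j g)| <= M * (n%:R * Tw).
  apply: le_trans (ler_norm_sum _ _ _) _.
  apply: (@le_trans _ _ (\sum_(j < n) M * Tw)).
    apply: ler_sum => j _; apply: (gval_bound i j Hchi) => //.
      exact: Cc_dpart.
    by apply: subset_trans (@sub_thick R n delta S); exact: fsupp_dpart.
  by rewrite sumr_const card_ord -[leLHS]mulr_natl (mulrCA M).
have -> : psi chi i g + tform (lten i chi g) = - 2^-1 * (\sum_j gval chi i j (dpart j g))
   - 2 * Jint (rten i chi g) - Jint (sten i g).
  have alg (a t r q : R) : a - t - r - q + t = a - r - q by ring.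
  exact: alg.
move: (\sum_j gval chi i j (dpart j g)) h3 (Jint (rten i chi g)) h1 (Jint (sten i g)) h2.
move: (n%:R * Tw) (delta^-1 * Jw) (n%:R * Jw) => a b c p.
rewrite ler_norml => /andP[p1 p2] q; rewrite ler_norml => /andP[q1 q2] r.
rewrite ler_norml => /andP[r1 r2]; rewrite ler_norml; apply/andP; split; lra.
Qed.

End FixedCutoff.

(** Expanding x_i - y_i gives two values of the form with g in the second argument, to which the
    continuity hypothesis on [E] applies. *)
Lemma tform_lten i chi g : Cc_inf U chi -> Cc_inf U g ->
  tform (lten i chi g) = E chi (fun x => x ord0 i * g x) - E (fun x => chi x * x ord0 i) g.
Proof.
move=> Cchi Cg; have si := @smooth_coord R n i.
have C1 : Cc_inf U (fun x => x ord0 i * g x) by exact: Cc_mull.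
have C2 : Cc_inf U (fun x => chi x * x ord0 i) by exact: Cc_mul.
have -> : lten i chi g = (fun x y => (-1) * (chi x * (y ord0 i * g y)) + chi x * x ord0 i * g y).
  by apply: funext => x; apply: funext => y; rewrite /lten; ring.
rewrite tform_lin ?tform_prod//; try exact: tensor_prod.
by rewrite mulN1r opprK.
Qed.

(** A change of cutoff alters the [lten] term by tform F and the [rten] integral by minus int F dJ,
    for a kernel [F] with tform F = 2 int F dJ, so the changes cancel. *)
Lemma psi_indep i g chi1 chi2 : Cc_inf U g -> cutoff (thick (fsupp g)) chi1 ->
  cutoff (thick (fsupp g)) chi2 -> psi chi1 i g = psi chi2 i g.
Proof.
move=> Cg H1 H2; have gg : fsupp g `<=` fsupp g by [].
have c1 := cutoffS H1 gg; have c2 := cutoffS H2 gg.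
have [C1 _ _] := H1; have [C2 _ _] := H2.
have [C12 W12] := cutoff_diff c1 c2.
have [TF JF EF] := jumpy_diff i C12 Cg W12.
set F := (fun x y => (chi1 x - chi2 x) * g y * (x ord0 i - y ord0 i)) in TF JF EF.
have JR2 := rten_Jable H2 i Cg gg.
have T2 := tensor_lten i C2 Cg.
have E1 : Jint (rten i chi1 g) = - Jint F + Jint (rten i chi2 g).
  rewrite -mulN1r -(Jint_lin _ JF JR2); apply: Jint_ext => x y.
  by rewrite /rten /F; ring.
have E2 : tform (lten i chi1 g) = tform F + tform (lten i chi2 g).
  rewrite -(tform_add TF T2); congr tform; apply: funext => x; apply: funext => y.
  by rewrite /lten /F; ring.
have E3 : \sum_j gval chi1 i j (dpart j g) = \sum_j gval chi2 i j (dpart j g).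
  apply: eq_bigr => j _; have dg : fsupp (dpart j g) `<=` fsupp g by exact: fsupp_dpart.
  apply: gval_indep; first exact: Cc_dpart.
    exact: cutoff_sub dg c1.
  exact: cutoff_sub dg c2.
have alg (a a1 t t1 r r1 q p s : R) : r1 = - s + r -> t1 = p + t -> p = 2 * s -> a1 = a ->
  - 2^-1 * a1 - t1 - 2 * r1 - q = - 2^-1 * a - t - 2 * r - q by move=> -> -> -> ->; ring.
exact: (alg _ _ _ _ _ _ _ _ _ E1 E2 EF E3).
Qed.

(** * The first order distributions *)

Hypothesis EC : E_continuous U E.

Lemma psi_cvg i W (gk : nat -> V -> R) g chi : rel_compact_open U W ->
  (forall k, Cc_inf W (gk k)) -> Cc_inf W g -> unif_all_deriv gk g ->
  cutoff (thick (closure W)) chi -> (fun k => psi chi i (gk k)) @ \oo --> psi chi i g.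
Proof.
move=> rW Ck Cg Hu Hchi; have [oW [kW WU]] := rW.
have [Cchi _ _] := Hchi; have si := @smooth_coord R n i.
have sW : W `<=` U by move=> x Wx; apply: WU; exact: subset_closure.
have CkU k : Cc_inf U (gk k) by exact: (Cc_sub sW).
have CgU : Cc_inf U g by exact: (Cc_sub sW).
have suppW f : Cc_inf W f -> fsupp f `<=` closure W.
  by move=> Cf x /(Cc_supp Cf) Wx; exact: subset_closure.
have cE : (fun k => tform (lten i chi (gk k))) @ \oo --> tform (lten i chi g).
  have -> : (fun k => tform (lten i chi (gk k))) =
      (fun k => E chi (fun x => x ord0 i * gk k x) - E (fun x => chi x * x ord0 i) (gk k)).
    by apply: funext => k; exact: tform_lten.
  rewrite tform_lten//; apply: cvgB.
    apply: (EC rW _ _ _ Cchi).2; [by move=> k; exact: Cc_mull|exact: Cc_mull|].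
    apply: (unif_mul kW si (Cc_smooth Cg)) => //.
      by move=> k; exact: (Cc_smooth (Ck k)).
      by move=> k; exact: suppW.
    exact: suppW.
  have C2 : Cc_inf U (fun x => chi x * x ord0 i) by exact: Cc_mul.
  exact: (EC rW Ck Cg Hu C2).2.
(* What is left of [psi] after removing [lten]; by [psi_bound], convergence of the functions and
   their first derivatives is enough for it. *)
pose P f := psi chi i f + tform (lten i chi f).
have cP : (fun k => P (gk k)) @ \oo --> P g.
  have [C C0 HC] := psi_bound Hchi i.
  apply/cvgrPdist_lt => e e0.
  have C1 : 0 < C + 1 by rewrite ltr_wpDl.
  pose d := e / (C + 1); have d0 : 0 < d by rewrite divr_gt0.
  have ex j : exists N, forall k, (N <= k)%N -> forall x,
      `|dpart j (gk k) x - dpart j g x| < d by exact: (Hu [:: j] d d0).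
  pose N1 j := projT1 (cid (ex j)).
  have [N0 H0] := Hu [::] d d0.
  exists (maxn N0 (\max_j N1 j)) => // k /=; rewrite geq_max => /andP[k0 k1].
  have sk := Cc_smooth (Ck k); have sg := Cc_smooth Cg.
  have -> : P g - P (gk k) = - P (fun x => gk k x - g x).
    have h : (fun x => gk k x - g x) = (fun x => (-1) * g x + gk k x).
      by apply: funext => x; ring.
    have t : lten i chi (fun x => gk k x - g x) =
        (fun x y => (-1) * lten i chi g x y + lten i chi (gk k) x y).
      by apply: funext => x; apply: funext => y; rewrite /lten; ring.
    have p : psi chi i (fun x => gk k x - g x) = - 1 * psi chi i g + psi chi i (gk k).
      by rewrite h; apply: (psi_lin Hchi) => //; exact: suppW.
    have q : tform (lten i chi (fun x => gk k x - g x)) =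
        - 1 * tform (lten i chi g) + tform (lten i chi (gk k)).
      by rewrite t; apply: tform_lin; exact: tensor_lten.
    have alg (a b c a' b' c' : R) : c = - 1 * a + b -> c' = - 1 * a' + b' ->
      (a + a') - (b + b') = - (c + c') by move=> -> ->; ring.
    exact: (alg _ _ _ _ _ _ p q).
  rewrite normrN; apply: (@le_lt_trans _ _ (C * d)).
    apply: HC; [exact: Cc_sub2| |exact: ltW| |].
    - apply: fsupp_sub; first exact: closed_closure.
      move=> x xW; rewrite !fsupp_out ?subrr// => Wx; apply: xW.
        exact: (suppW _ Cg).
      exact: (suppW _ (Ck k)).
    - by move=> x; apply: ltW; exact: H0.
    - move=> j x; have := dparts_sub [:: j] sk sg; move=> /= ->; apply: ltW.
      have kj : (N1 j <= k)%N by apply: leq_trans k1; exact: leq_bigmax.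
      by move: kj; rewrite /N1; case: cid => N H /= /H; exact.
  by rewrite /d mulrA ltr_pdivrMr// mulrC ltr_pM2l// ltrDl.
have -> : (fun k => psi chi i (gk k)) = (fun k => P (gk k) - tform (lten i chi (gk k))).
  by apply: funext => k; rewrite /P addrK.
have -> : psi chi i g = P g - tform (lten i chi g) by rewrite /P addrK.
exact: cvgB.
Qed.

(** For test functions of U^delta a cutoff exists, so the default value is not taken, and
    [psi_indep] makes the choice immaterial. *)
Definition Psi i g : R := psi (xget (fun=> 0) [set chi | cutoff (thick (fsupp g)) chi]) i g.

Lemma thick_cutoff (S : set V) : compact S -> S `<=` Udelta U delta ->
  exists chi, cutoff (thick S) chi.
Proof.
by move=> kS SU; apply: cutoff_ex => //; [exact: thick_compact|exact: thick_sub].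
Qed.

Lemma PsiE i S chi g : Cc_inf (Udelta U delta) g -> fsupp g `<=` S ->
  cutoff (thick S) chi -> Psi i g = psi chi i g.
Proof.
move=> Cg gS Hchi; have [chi' H'] := thick_cutoff (Cc_compact Cg) (Cc_supp Cg).
have Cg' : Cc_inf U g by apply: Cc_sub Cg; exact: Udelta_sub.
apply: psi_indep => //; last by apply: cutoff_sub Hchi; exact: thickS.
exact: (@xgetPex _ (fun=> 0) [set chi | cutoff (thick (fsupp g)) chi] (ex_intro _ chi' H')).
Qed.

Lemma Psi_gen_function i : gen_function (Udelta U delta) (Psi i).
Proof.
have US := @Udelta_sub R n U delta.
split=> [c f g Cf Cg|W rW gk g Ck Cg Hu].
  pose S := fsupp f `|` fsupp g.
  have kS : compact S by apply: compactU; [exact: Cc_compact Cf|exact: Cc_compact Cg].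
  have SU : S `<=` Udelta U delta by move=> x [/(Cc_supp Cf)|/(Cc_supp Cg)].
  have [chi Hchi] := thick_cutoff kS SU.
  have fS : fsupp f `<=` S by move=> x; left.
  have gS : fsupp g `<=` S by move=> x; right.
  rewrite (PsiE i Cf fS Hchi) (PsiE i Cg gS Hchi).
  have hS : fsupp (fun x => c * f x + g x) `<=` S.
    apply: fsupp_sub; first by apply: closedU; exact: fsupp_closed.
    by move=> x xS; rewrite !fsupp_out ?mulr0 ?addr0// => xg; apply: xS; [right|left].
  rewrite (PsiE i (Cc_lin c Cf Cg) hS Hchi).
  exact: (psi_lin Hchi i c (Cc_sub US Cf) (Cc_sub US Cg) fS gS).
have [oW [kW WU]] := rW.
have [chi Hchi] := thick_cutoff kW WU.
have WW : W `<=` closure W by exact: subset_closure.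
have Wd : W `<=` Udelta U delta by exact: subset_trans WU.
rewrite (PsiE i (Cc_sub Wd Cg) (subset_trans (Cc_supp Cg) WW) Hchi).
have -> : (fun k => Psi i (gk k)) = (fun k => psi chi i (gk k)).
  apply: funext => k.
  exact: (PsiE i (Cc_sub Wd (Ck k)) (subset_trans (Cc_supp (Ck k)) WW) Hchi).
apply: psi_cvg Ck Cg Hu Hchi; split=> //; split=> //; exact: subset_trans US.
Qed.

(** * Decomposition of the form on U^delta *)

Definition drift_ten u v x y : R := \sum_(i < n) (y ord0 i - x ord0 i) *
  (dpart i u y * v y - dpart i u x * v x) * ind x y.

Definition jump_ten u v x y : R :=
  2 * (u y - u x - (\sum_(i < n) (y ord0 i - x ord0 i) * dpart i u y) * ind x y) * v y.

(** The drift integral depends only on the functions g_i = (d_i u) v, so it is subtracted inside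
    [Psi] and restored here; the [rten] integrals likewise pass between [Psi] and the jump term. *)
Lemma beurling_deny_real u v :
  Cc_inf (Udelta U delta) u -> Cc_inf (Udelta U delta) v ->
  [/\ Jable (drift_ten u v), Jable (jump_ten u v) &
   E u v = 2^-1 * \sum_i \sum_j gform i j (fun x => dpart i u x * dpart j v x)
     + \sum_i Psi i (fun x => dpart i u x * v x)
     + Jint (drift_ten u v) + Jint (jump_ten u v) + Kint (fun x => u x * v x)].
Proof.
move=> Cu' Cv'; have US := @Udelta_sub R n U delta.
have Cu := Cc_sub US Cu'; have Cv := Cc_sub US Cv'.
have su := Cc_smooth Cu; have sv := Cc_smooth Cv.
pose S := fsupp u `|` fsupp v.
have kS : compact S by apply: compactU; [exact: Cc_compact Cu|exact: Cc_compact Cv].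
have SU : S `<=` Udelta U delta by move=> x [/(Cc_supp Cu')|/(Cc_supp Cv')].
have [chi Hchi] := thick_cutoff kS SU.
have HS : cutoff S chi := cutoff_sub (@sub_thick R n delta S) Hchi.
pose g i x := dpart i u x * v x; pose w i j x := dpart i u x * dpart j v x.
pose h i j x := dpart j (dpart i u) x * v x.
have sdu i : smooth (dpart i u) := smooth_dpart i su.
have Cg' i : Cc_inf (Udelta U delta) (g i) by exact: Cc_mull.
have Cg i : Cc_inf U (g i) by exact: Cc_mull.
have Ch i j : Cc_inf U (h i j) by apply: Cc_mull => //; exact: smooth_dpart.
have Cw i j : Cc_inf U (w i j) by apply: Cc_mull => //; exact: Cc_dpart.
have vS (p : V -> R) : (forall x, v x = 0 -> ~ fsupp v x -> p x = 0) -> fsupp p `<=` S.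
  move=> p0; apply: subset_trans (_ : fsupp v `<=` S); last by move=> x; right.
  apply: fsupp_sub; first exact: fsupp_closed.
  by move=> x vx; apply: p0 => //; exact: fsupp_out.
have gS i : fsupp (g i) `<=` S by apply: vS => x vx _; rewrite /g vx mulr0.
have hS i j : fsupp (h i j) `<=` S by apply: vS => x vx _; rewrite /h vx mulr0.
have wS i j : fsupp (w i j) `<=` S by apply: vS => x _ vx; rewrite /w (dpart_out _ vx) mulr0.
have [JB EB] := form_expansion Cu Cv HS.
set B := (fun x y => _) in JB EB.
have JR i : Jable (rten i chi (g i)) by exact: (rten_Jable Hchi).
have JS i : Jable (sten i (g i)) by exact: (sten_Jable Hchi).
have JD : Jable (drift_ten u v) by exact: (Jable_sum _ JS).
have JDE : Jint (drift_ten u v) = \sum_i Jint (sten i (g i)) by exact: (Jint_sum _ JS).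
have JRs : Jable (fun x y => \sum_i rten i chi (g i) x y) by exact: (Jable_sum _ JR).
have JBR : Jable (fun x y => B x y + \sum_i rten i chi (g i) x y) by exact: Jable_add.
(* [form_expansion] has chi(x) in its first order term where the jump integrand has the indicator;
   the [rten] kernels make up the difference. *)
have JE x y : 2 * (B x y + \sum_i rten i chi (g i) x y) = jump_ten u v x y.
  rewrite /jump_ten -mulrA; congr (2 * _).
  rewrite /B !mulrDl -addrA; congr (_ + _ + _).
  rewrite mulr_suml -big_split mulNr !mulr_suml -sumrN; apply: eq_bigr => i _ /=.
  by rewrite /rten /g; ring.
have JJ : Jable (jump_ten u v) by exact: (Jable_ext (Jable_scale 2 JBR)).
have JJE : Jint (jump_ten u v) = 2 * (Jint B + \sum_i Jint (rten i chi (g i))).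
  rewrite -(Jint_sum _ JR) -(Jint_add JB JRs) -(Jint_scale _ JBR).
  exact: Jint_ext.
split=> //; rewrite EB JDE JJE.
have PE i : Psi i (g i) = psi chi i (g i) by exact: (PsiE i (Cg' i) (gS i) Hchi).
(* The product rule d_j g_i = d_i u d_j v + v d_j d_i u replaces second derivatives of [u] by the
   gradient product and a term in g_i alone. This explains the coefficient -1/2 in [psi]. *)
have WE i j : gform i j (w i j) = gval chi i j (dpart j (g i)) - gval chi i j (h i j).
  rewrite (gformE i j (Cw i j) (wS i j) HS).
  have -> : dpart j (g i) = (fun x => 1 * w i j x + h i j x).
    rewrite /g dpartM; try by move=> x; exact: smooth_derivable.
    by apply: funext => x; rewrite /w /h mul1r (mulrC (v x)).
  rewrite gval_lin//; last 2 first.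
  - exact: cutoff_sub (wS i j) HS.
  - exact: cutoff_sub (hS i j) HS.
  by rewrite mul1r addrK.
have W2 : \sum_i \sum_j gform i j (w i j) =
    \sum_i \sum_j gval chi i j (dpart j (g i)) - \sum_i \sum_j gval chi i j (h i j).
  rewrite -sumrB; apply: eq_bigr => i _; rewrite -sumrB; apply: eq_bigr => j _; exact: WE.
have P2 : \sum_i Psi i (g i) = - 2^-1 * (\sum_i \sum_j gval chi i j (dpart j (g i)))
    - \sum_i tform (lten i chi (g i)) - 2 * (\sum_i Jint (rten i chi (g i)))
    - \sum_i Jint (sten i (g i)).
  rewrite !mulr_sumr -!sumrB; apply: eq_bigr => i _; exact: PE.
rewrite -/(g _) -/(w _) P2 W2.
have alg (b k t a c r q : R) : 2 * b + k - t - 2^-1 * c =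
  2^-1 * (a - c) + (- 2^-1 * a - t - 2 * r - q) + q + 2 * (b + r) + k by ring.
exact: alg.
Qed.

End BeurlingDeny.

Theorem theorem1p4 (R : realType) (n : nat) (U : set (Rn R n))
    (m : {measure set (Bor R n) -> \bar R})
    (D : set (Rn R n -> R)) (E : (Rn R n -> R) -> (Rn R n -> R) -> R)
    (J : {measure set (Bor R n * Bor R n) -> \bar R})
    (K : {measure set (Bor R n) -> \bar R}) (delta : R) :
  open U ->
  radon_on U m -> full_support U m ->
  semi_dirichlet m D E ->
  (forall f, Cc_inf U f -> D f) ->
  E_continuous U E ->
  jump_kill U E J K ->
  0 < delta -> Udelta U delta !=set0 ->
  exists (nup num : 'I_n -> 'I_n -> {measure set (Bor R n) -> \bar R})
         (Psi : 'I_n -> (Rn R n -> R) -> R),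
    [/\ (forall i j, radon_on U (nup i j) /\ radon_on U (num i j)),
        (forall F : set (Rn R n), compact F -> F `<=` U ->
           (forall i j, fine (nup i j F) - fine (num i j F)
                        = fine (nup j i F) - fine (num j i F)) /\
           (forall xi : 'I_n -> R,
              0 <= \sum_(i < n) \sum_(j < n)
                     xi i * xi j * (fine (nup i j F) - fine (num i j F)))),
        (forall i, gen_function (Udelta U delta) (Psi i)) &
        (forall u v, Cc_inf (Udelta U delta) u -> Cc_inf (Udelta U delta) v ->
          (E u v)%:E =
            ((2^-1)%:E *
               (\sum_(i < n) \sum_(j < n)
                  (\int[nup i j]_(x in (U : set (Bor R n))) (dpart i u x * dpart j v x)%:E
                   - \int[num i j]_(x in (U : set (Bor R n))) (dpart i u x * dpart j v x)%:E))
             + (\sum_(i < n) Psi i (fun x => dpart i u x * v x))%:E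
             + \int[J]_(p in offdiag U)
                 (\sum_(i < n) (p.2 ord0 i - p.1 ord0 i) *
                    (dpart i u p.2 * v p.2 - dpart i u p.1 * v p.1) *
                    (if enorm (p.1 - p.2) <= delta then 1 else 0))%:E
             + \int[J]_(p in offdiag U)
                 (2 * (u p.2 - u p.1
                       - (\sum_(i < n) (p.2 ord0 i - p.1 ord0 i) * dpart i u p.2) *
                         (if enorm (p.1 - p.2) <= delta then 1 else 0)) * v p.2)%:E
             + \int[K]_(x in (U : set (Bor R n))) (u x * v x)%:E)%E)].
Proof.
move=> oU rm fm SD CD EC JK d0 _.
(* The measures do not depend on [delta]; only the distributions do. *)
exists (diffp oU SD CD JK), (diffm oU SD CD JK), (Psi U E J delta); split.
- exact: diff_radon.
- exact: diff_compact.
- exact: (Psi_gen_function oU SD CD JK d0 EC).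
move=> u v Cu Cv; have [JD JJ ->] := beurling_deny_real oU SD CD JK d0 Cu Cv.
have Cu' := Cc_sub (@Udelta_sub R n U delta) Cu.
have Cv' := Cc_sub (@Udelta_sub R n U delta) Cv.
rewrite (KintE JK (Cc_mul (Cc_smooth Cv') Cu')).
have -> : (\int[J]_(p in offdiag U) (\sum_(i < n) (p.2 ord0 i - p.1 ord0 i) *
    (dpart i u p.2 * v p.2 - dpart i u p.1 * v p.1) *
    (if enorm (p.1 - p.2) <= delta then 1 else 0))%:E)%E = (Jint U J (drift_ten delta u v))%:E.
  exact: (JintE oU JD).
have -> : (\int[J]_(p in offdiag U) (2 * (u p.2 - u p.1
    - (\sum_(i < n) (p.2 ord0 i - p.1 ord0 i) * dpart i u p.2) *
    (if enorm (p.1 - p.2) <= delta then 1 else 0)) * v p.2)%:E)%E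
    = (Jint U J (jump_ten delta u v))%:E.
  exact: (JintE oU JJ).
have -> : (\sum_(i < n) \sum_(j < n)
    (\int[diffp oU SD CD JK i j]_(x in (U : set (Bor R n))) (dpart i u x * dpart j v x)%:E
    - \int[diffm oU SD CD JK i j]_(x in (U : set (Bor R n))) (dpart i u x * dpart j v x)%:E))%E
    = (\sum_(i < n) \sum_(j < n) gform U E J i j (fun x => dpart i u x * dpart j v x))%:E.
  rewrite -sumEFin; apply: eq_bigr => i _; rewrite -sumEFin; apply: eq_bigr => j _.
  exact: (diff_integral oU SD CD JK i j (Cc_mull (smooth_dpart i (Cc_smooth Cu')) (Cc_dpart j Cv'))).
by rewrite -EFinM -!EFinD.
Qed.
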